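(* For every formed space $E$ and every $U\in\mathcal{P}^\omega(E)$, the poset $\mathcal{P}^\omega(E,U)$ is Cohen–Macaulay.
   Context: Formed spaces over a field $\mathbb{F}$ with involution $\sigma$ ($\bar c=\sigma(c)$), $\varepsilon$ ($\varepsilon\bar\varepsilon=1$) and additive subgroup $\Lambda$ with $\{c-\varepsilon\bar c\}\le\Lambda\le\{c:c+\varepsilon\bar c=0\}$: a form on a finite-dimensional $E$ is a sesquilinear $f$ ($f(av,bw)=\bar af(v,w)b$) modulo those with $f(v,v)\in\Lambda$, $f(w,v)=-\varepsilon\overline{f(v,w)}$. $\omega_q(v,w)=q(v,w)+\varepsilon\overline{q(w,v)}$, $Q_q(v)=q(v,v)+\Lambda$; $K(E)=\{v:\omega_q(E,v)=0\}$, radical $R(E)=\{v\in K(E):Q_q(v)=0\}$; $U^\perp=\{v:\omega_q(v,U)=0\}$; isotropic means $\omega_q,Q_q$ vanish on the subspace. $\mathcal{P}^\omega(E)$ is the poset (inclusion) of isotropic $W$ with $R(E)<W<E$, and $\mathcal{P}^\omega(E,U)=\{W\in\mathcal{P}^\omega(E):W+U^\perp=E\}$. A graded poset is Cohen–Macaulay if for all $-\infty\le x\le y\le\infty$ the interval $(x,y)=\{z:x<z<y\}$ has $(\dim(x,y)-1)$-connected realization, $\dim$ being maximal chain length. *)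

(* Defs.v *)
From HB Require Import structures.
From mathcomp Require Import all_boot all_order all_algebra.
From mathcomp Require Import all_classical all_reals all_analysis.
From mathcomp Require Import Rstruct Rstruct_topology.

Set Implicit Arguments.
Unset Strict Implicit.
Unset Printing Implicit Defensive.

Import Order.TTheory GRing.Theory Num.Theory.
Local Open Scope ring_scope.
Local Open Scope classical_set_scope.

(* A poset is given by a carrier T, an order relation le on T, and a   *)
(* subset S of T (the elements of the poset).                          *)

Notation RR := Rdefinitions.R.

Section Posets.
Variables (T : eqType) (le : rel T).

Definition plt (a b : T) : bool := le a b && (a != b).

(* a chain of the poset S : a strictly increasing finite sequence in S;
   its length (as a chain) is size c - 1. *)
Definition is_chain (S : set T) (c : seq T) : Prop :=
  sorted plt c /\ (forall t, t \in c -> S t).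

Definition is_maxchain (S : set T) (c : seq T) : Prop :=
  is_chain S c /\
  (forall c', is_chain S c' -> {subset c <= c'} -> {subset c' <= c}).

(* dim S = d : maximal length of a chain (d = -1 for the empty poset) *)
Definition has_dim (S : set T) (d : int) : Prop :=
  (exists c, is_chain S c /\ (size c)%:Z = d + 1) /\
  (forall c, is_chain S c -> (size c)%:Z <= d + 1).

Definition graded (S : set T) : Prop :=
  exists d, has_dim S d /\ forall c, is_maxchain S c -> (size c)%:Z = d + 1.

(* Geometric realization of the order complex of S: points are
   functions alpha : T -> R, nonnegative, supported on a chain of S,
   with coordinates summing to 1. *)
Definition realization (S : set T) : set (T -> RR) :=
  [set alpha | exists c, [/\ is_chain S c,
     forall t, t \notin c -> alpha t = 0,
     forall t, 0 <= alpha t & \sum_(t <- c) alpha t = 1]].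

Definition std_simplex (n : nat) : set 'rV[RR]_n :=
  [set l | (forall i, 0 <= l ord0 i) /\ \sum_(i < n) l ord0 i = 1].
Arguments std_simplex n : clear implicits.

(* the characteristic (barycentric) map of the simplex spanned by c *)
Definition bary (c : seq T) (l : 'rV[RR]_(size c)) : T -> RR :=
  fun t => \sum_(i < size c | nth t c i == t) l ord0 i.
Arguments bary c l : clear implicits.

(* coherent (weak) topology on the realization: O is open iff its trace
   on every closed simplex is open in that simplex *)
Definition coh_open (S : set T) (O : set (T -> RR)) : Prop :=
  forall c, is_chain S c ->
    exists V : set 'rV[RR]_(size c), open V /\
      std_simplex (size c) `&` (bary c @^-1` O) = std_simplex (size c) `&` V.

Definition cont_into (S : set T) (m : nat) (A : set 'rV[RR]_m)
  (f : 'rV[RR]_m -> T -> RR) : Prop :=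
  (forall x, A x -> realization S (f x)) /\
  (forall O, coh_open S O ->
     exists V : set 'rV[RR]_m, open V /\ A `&` (f @^-1` O) = A `&` V).

Definition sphere (n : nat) : set 'rV[RR]_n.+1 :=
  [set x | \sum_(i < n.+1) x ord0 i ^+ 2 = 1].
Definition ball_closed (n : nat) : set 'rV[RR]_n.+1 :=
  [set x | \sum_(i < n.+1) x ord0 i ^+ 2 <= 1].
Arguments sphere n : clear implicits.
Arguments ball_closed n : clear implicits.

(* |S| is k-connected (k : int, k >= -1 meaningful): nonempty if
   k >= -1, and every continuous map S^n -> |S| with n <= k extends
   to a continuous map D^(n+1) -> |S|.  For k <= -2 no condition. *)
Definition k_connected (S : set T) (k : int) : Prop :=
  (-1 <= k -> exists alpha, realization S alpha) /\
  (forall n : nat, (n%:Z <= k) ->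
     forall f, cont_into S (sphere n) f ->
       exists g, cont_into S (ball_closed n) g /\
                 (forall x, sphere n x -> g x = f x)).

Inductive ext := Bot | Mid of T | Top.

Definition ext_le (x y : ext) : Prop :=
  match x, y with
  | Bot, _ => True
  | _, Top => True
  | Mid a, Mid b => le a b
  | _, _ => False
  end.

Definition ext_lt (x y : ext) : Prop := ext_le x y /\ x <> y.

Definition in_ext (S : set T) (x : ext) : Prop :=
  match x with Mid a => S a | _ => True end.

Definition open_interval (S : set T) (x y : ext) : set T :=
  [set z | S z /\ ext_lt x (Mid z) /\ ext_lt (Mid z) y].

Definition cohen_macaulay (S : set T) : Prop :=
  graded S /\
  forall x y : ext, in_ext S x -> in_ext S y -> ext_le x y ->
    exists d, has_dim (open_interval S x y) d /\
              k_connected (open_interval S x y) (d - 1).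

End Posets.

Section Formed.
Variables (F : fieldType) (E : vectType F).
Variables (sigma : {rmorphism F -> F}) (eps : F) (Lambda : pred F).

Definition form_parameters : Prop :=
  [/\ involutive sigma, eps * sigma eps = 1,
      (forall a b, a \in Lambda -> b \in Lambda -> a - b \in Lambda),
      (forall c, c - eps * sigma c \in Lambda) &
      (forall c, c \in Lambda -> c + eps * sigma c = 0)].

Definition sesquilinear (q : E -> E -> F) : Prop :=
  [/\ forall v v' w, q (v + v') w = q v w + q v' w,
      forall v w w', q v (w + w') = q v w + q v w' &
      forall a b v w, q (a *: v) (b *: w) = sigma a * q v w * b].

Variable q : E -> E -> F.

Definition omega (v w : E) : F := q v w + eps * sigma (q w v).

(* Q_q(v) = 0 in F / Lambda *)
Definition Qzero (v : E) : Prop := q v v \in Lambda.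

Definition Kset (v : E) : Prop := forall u, omega u v = 0.
Definition Rad (v : E) : Prop := Kset v /\ Qzero v.

Definition perp (U : {vspace E}) (v : E) : Prop :=
  forall u, u \in U -> omega v u = 0.

Definition isotropic (W : {vspace E}) : Prop :=
  (forall v w, v \in W -> w \in W -> omega v w = 0) /\
  (forall v, v \in W -> Qzero v).

Definition Pomega (W : {vspace E}) : Prop :=
  [/\ isotropic W,
      (forall v, Rad v -> v \in W),
      (exists2 w, w \in W & ~ Rad w) &
      W <> fullv].

Definition PomegaU (U : {vspace E}) (W : {vspace E}) : Prop :=
  Pomega W /\
  forall e : E, exists w x, [/\ w \in W, perp U x & e = w + x].

End Formed.

Definition vsub_le (F : fieldType) (E : vectType F) : rel {vspace E} :=
  fun A B => (A <= B)%VS.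

(* Main.v *)
Require Import Defs.
From HB Require Import structures.
From mathcomp Require Import all_boot all_order all_algebra.
From mathcomp Require Import all_classical all_reals all_analysis.
From mathcomp Require Import Rstruct Rstruct_topology zify ring lra.

Set Implicit Arguments.
Unset Strict Implicit.
Unset Printing Implicit Defensive.

Import Order.TTheory GRing.Theory Num.Theory numFieldNormedType.Exports.
Local Open Scope ring_scope.
Local Open Scope classical_set_scope.

(** Attaching to a complex [X] cones over [(k - 1)]-connected subcomplexes preserves
    [k]-connectivity: a map of a sphere of dimension at most [k] is pushed off the cone
    points cell by cell, on a fine cubical grid. All intervals of the poset are built in
    this way from contractible pieces.

    Modulo the radical, an isotropic [W] belongs to the poset iff no nonzero vector of [U] is
    orthogonal to [W]. Induct on [dim U]: write [U = U' + <u>] and choose an isotropic [w]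
    orthogonal to [U'] with [omega u w <> 0]. The [W] containing [w] form the poset of [U']
    in [w^perp / w]. The [W] such that [W :&: w^perp] is still in the poset deform
    to them. For any other [W] there is a unique [z] in [U] with [w - z] orthogonal
    to [W]. These [W] are attached in two rounds: first, by increasing dimension, those
    which do not contain [w - z], along the join of the [W'] below [W] (supplements of
    [W :&: U^perp] in [W]) with the [W'] above [W] which are not orthogonal to [w - z], an
    instance of the same problem for a single, possibly anisotropic, vector; then, by
    decreasing dimension, those which contain [w - z], along the join of the
    supplements avoiding [w - z] with all isotropic subspaces above [W]. *)

(** * Maps from cubes to flag complexes *)

(** Connectivity is never computed algebraically: it means that maps of cube boundaries extend, so
    one attaching lemma covers all degrees and the fundamental group needs no separate treatment.

    The obstacle is formed by the [W] for which [y = w - z] is orthogonal to [W] for some [z]. Above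
    such a [W], the subspaces already present are those not orthogonal to [y]. If [y] lies in [W],
    up to the kernel of the form, there are none; such a [W] has to wait until everything above it
    is present, which is why the second round runs downwards. As [y] is in general not isotropic,
    the case of a single vector is proved on its own, for arbitrary vectors, before the general
    case.

    The numbers fit exactly: over a base [A], with [g] the largest dimension of an isotropic
    subspace, the lower part of the link of [W] contributes [dim W - dim Z - dim A] and the upper
    part [g - dim W]. The sum [g - dim A - dim Z] does not depend on [W]. *)

Section Continuity.
Variable R : realType.

(** Points are sequences, so that cubes, faces and prisms of every dimension live in one space; a
    cube varies in finitely many coordinates only. *)
Definition close (d : R) (x y : nat -> R) := forall i, `|x i - y i| < d.

Definition cts (X : set (nat -> R)) (phi : (nat -> R) -> R) :=
  forall x, X x -> forall e, 0 < e ->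
    exists2 d, 0 < d & forall y, X y -> close d x y -> `|phi x - phi y| < e.

Lemma close_le d d' x y : d <= d' -> close d x y -> close d' x y.
Proof. by move=> h c i; exact: lt_le_trans (c i) h. Qed.

Lemma seq_min_pos (K : eqType) (s : seq K) (P : K -> R -> Prop) :
  (forall k d d', d' <= d -> P k d -> P k d') ->
  (forall k, k \in s -> exists2 d, 0 < d & P k d) ->
  exists2 d, 0 < d & forall k, k \in s -> P k d.
Proof.
move=> mP; elim: s => [|k s IH] h; first by exists 1.
have [d d0 hd] := h k (mem_head _ _).
have [d' d'0 hd'] : exists2 d, 0 < d & forall k, k \in s -> P k d.
  by apply: IH => j js; apply: h; rewrite inE js orbT.
exists (Num.min d d'); first by rewrite lt_min d0.
move=> j; rewrite inE => /orP[/eqP->|js].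
  by apply: mP hd; rewrite ge_min lexx.
by apply: mP (hd' _ js); rewrite ge_min lexx orbT.
Qed.

Lemma cts_sub X Y phi : Y `<=` X -> cts X phi -> cts Y phi.
Proof.
move=> sYX h x Yx e e0; have [d d0 hd] := h x (sYX _ Yx) e e0.
by exists d => // y Yy; apply: hd; apply: sYX.
Qed.

Lemma cts_eq X phi psi : cts X phi -> (forall x, X x -> phi x = psi x) -> cts X psi.
Proof.
move=> h eqf x Xx e e0; have [d d0 hd] := h x Xx e e0.
by exists d => // y Xy c; rewrite -!eqf //; apply: hd.
Qed.

Lemma cts_cst X c : cts X (fun=> c).
Proof. by move=> x Xx e e0; exists 1 => // y _ _; rewrite subrr normr0. Qed.

Lemma cts_coord X i : cts X (fun x => x i).
Proof. by move=> x Xx e e0; exists e. Qed.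

Lemma ctsD X phi psi : cts X phi -> cts X psi -> cts X (fun x => phi x + psi x).
Proof.
move=> h1 h2 x Xx e e0; have e20 : 0 < e / 2 by lra.
have [d1 d10 hd1] := h1 x Xx _ e20; have [d2 d20 hd2] := h2 x Xx _ e20.
exists (Num.min d1 d2); first by rewrite lt_min d10.
move=> y Xy c.
have c1 : close d1 x y by apply: close_le c; rewrite ge_min lexx.
have c2 : close d2 x y by apply: close_le c; rewrite ge_min lexx orbT.
have := hd1 y Xy c1; have := hd2 y Xy c2.
rewrite !ltr_norml => /andP[a1 a2] /andP[b1 b2]; apply/andP; split; lra.
Qed.

Lemma ctsM X phi psi : cts X phi -> cts X psi -> cts X (fun x => phi x * psi x).
Proof.
move=> h1 h2 x Xx e e0.
pose M := 1 + `|phi x| + `|psi x|.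
have M1 : 1 <= M by rewrite /M; have := normr_ge0 (phi x); have := normr_ge0 (psi x); lra.
(* The bound 1 controls the product of the two increments. The three error terms then add up to at
   most [e' * M], which is at most half of [e]. *)
pose e' := Num.min 1 (e / (2 * M)).
have e'0 : 0 < e' by rewrite lt_min ltr01 divr_gt0 // mulr_gt0 //; lra.
have [d1 d10 hd1] := h1 x Xx _ e'0; have [d2 d20 hd2] := h2 x Xx _ e'0.
exists (Num.min d1 d2); first by rewrite lt_min d10.
move=> y Xy c.
have c1 : close d1 x y by apply: close_le c; rewrite ge_min lexx.
have c2 : close d2 x y by apply: close_le c; rewrite ge_min lexx orbT.
have := hd1 y Xy c1; have := hd2 y Xy c2.
have e'1 : e' <= 1 by rewrite ge_min lexx.
have e'M : e' * (2 * M) <= e by rewrite -ler_pdivlMr ?ge_min ?lexx ?orbT //; lra.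
set a := phi x in M M1 e' e'0 hd1 hd2 e'1 e'M *; set b := psi x in M M1 e' e'0 hd1 hd2 e'1 e'M *.
set a' := phi y; set b' := psi y => hb ha.
have -> : a * b - a' * b' = (a - a') * b + a * (b - b') - (a - a') * (b - b') by ring.
apply: le_lt_trans (ler_normB _ _) _; apply: le_lt_trans (lerD (ler_normD _ _) (lexx _)) _.
rewrite !normrM.
set u := `|a - a'| in ha *; set v := `|b - b'| in hb *.
have u0 : 0 <= u by exact: normr_ge0. have v0 : 0 <= v by exact: normr_ge0.
rewrite /M in e'M; set A := `|a| in e'M *; set B := `|b| in e'M *.
have A0 : 0 <= A by exact: normr_ge0. have B0 : 0 <= B by exact: normr_ge0.
have : u * v <= e' * 1 by apply: ler_pM => //; lra.
have : u * B <= e' * B by apply: ler_pM => //; lra.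
have : A * v <= A * e' by apply: ler_pM => //; lra.
have : 0 < e' * (1 + A + B) by apply: mulr_gt0 => //; lra.
nra.
Qed.

Lemma ctsB X phi psi : cts X phi -> cts X psi -> cts X (fun x => phi x - psi x).
Proof.
move=> h1 h2; apply: (cts_eq (ctsD h1 (ctsM (@cts_cst X (-1)) h2))).
by move=> x _; ring.
Qed.

Lemma cts_norm X phi : cts X phi -> cts X (fun x => `|phi x|).
Proof.
move=> h x Xx e e0; have [d d0 hd] := h x Xx e e0; exists d => // y Xy c.
by apply: le_lt_trans (hd y Xy c); exact: ler_dist_dist.
Qed.

Lemma cts_max X phi psi : cts X phi -> cts X psi ->
  cts X (fun x => Num.max (phi x) (psi x)).
Proof.
move=> h1 h2.
apply: (@cts_eq _ (fun x => (phi x + psi x + `|phi x - psi x|) * 2^-1)).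
  by apply: ctsM; last exact: cts_cst; apply: ctsD; [exact: ctsD|apply/cts_norm/ctsB].
move=> x _; case: (leP (phi x) (psi x)) => h.
  by rewrite ler0_norm ?subr_le0 //; lra.
by rewrite gtr0_norm ?subr_gt0 //; lra.
Qed.

Lemma ctsV X phi : (forall x, X x -> phi x != 0) -> cts X phi -> cts X (fun x => (phi x)^-1).
Proof.
move=> n0 h x Xx e e0; set a := phi x; have an0 : 0 < `|a| by rewrite normr_gt0 n0.
pose e' := Num.min (`|a| / 2) (e * `|a| ^+ 2 / 2).
have e'0 : 0 < e' by rewrite lt_min !divr_gt0 ?mulr_gt0 ?exprn_gt0.
have [d d0 hd] := h x Xx _ e'0; exists d => // y Xy c.
have := hd y Xy c; rewrite -/a; set b := phi y; rewrite lt_min => /andP[h1 h2].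
have b2 : `|a| / 2 < `|b|.
  have : `|a| <= `|a - b| + `|b| by rewrite -{1}(subrK b a) ler_normD.
  lra.
have bn0 : b != 0 by rewrite -normr_gt0; lra.
have an : a != 0 by rewrite -normr_gt0.
have -> : a^-1 - b^-1 = (b - a) / (a * b) by field; rewrite an bn0.
rewrite normrM normfV normrM distrC ltr_pdivrMr ?mulr_gt0 ?normr_gt0 //.
apply: lt_le_trans h2 _.
have -> : e * `|a| ^+ 2 / 2 = (e * `|a|) * (`|a| / 2) by field.
by rewrite [leRHS]mulrA ler_pM2l ?mulr_gt0 // ltW.
Qed.

Lemma cts_sum X (K : Type) (s : seq K) (P : pred K) (phi : K -> (nat -> R) -> R) :
  (forall k, cts X (phi k)) -> cts X (fun x => \sum_(k <- s | P k) phi k x).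
Proof.
move=> h; elim: s => [|k s IH].
  by apply: (cts_eq (@cts_cst X 0)) => x _; rewrite big_nil.
case Pk : (P k).
  by apply: (cts_eq (ctsD (h k) IH)) => x _; rewrite big_cons Pk.
by apply: (cts_eq IH) => x _; rewrite big_cons Pk.
Qed.

Lemma cts_bigmax X (s : seq nat) (phi : nat -> (nat -> R) -> R) :
  (forall k, cts X (phi k)) -> cts X (fun x => \big[Num.max/0]_(k <- s) phi k x).
Proof.
move=> h; elim: s => [|k s IH].
  by apply: (cts_eq (@cts_cst X 0)) => x _; rewrite big_nil.
by apply: (cts_eq (cts_max (h k) IH)) => x _; rewrite big_cons.
Qed.

(* Only the coordinates in [D] of [u x] vary with [x], so that finitely many
   moduli of continuity suffice. *)
Lemma cts_subst X Y (D : seq nat) (c : nat -> R) (u : (nat -> R) -> nat -> R) phi :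
  (forall x, Y x -> X (u x)) ->
  (forall i x, i \notin D -> Y x -> u x i = c i) ->
  (forall i, i \in D -> cts Y (fun x => u x i)) ->
  cts X phi -> cts Y (fun x => phi (u x)).
Proof.
move=> sub uc ucts h x Yx e e0; have [d d0 hd] := h _ (sub _ Yx) e e0.
have [d' d'0 hd'] : exists2 d', 0 < d' & forall i, i \in D ->
    forall y, Y y -> close d' x y -> `|u x i - u y i| < d.
  apply: (@seq_min_pos _ D (fun i d' => forall y, Y y -> close d' x y -> `|u x i - u y i| < d)).
    by move=> k a b ba H y Yy c'; apply: H => //; apply: close_le c'.
  by move=> i iD; exact: ucts.
exists d' => // y Yy c'; apply: hd; first exact: sub.
move=> i; case: (boolP (i \in D)) => iD; first exact: hd'.
by rewrite (uc i x iD Yx) (uc i y iD Yy) subrr normr0.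
Qed.

Definition closed_in (X A : set (nat -> R)) :=
  forall x, X x -> ~ A x -> exists2 d, 0 < d & forall y, X y -> close d x y -> ~ A y.

Lemma cts_glue X (K : eqType) (s : seq K) (A : K -> set (nat -> R)) phi :
  (forall x, X x -> exists2 k, k \in s & A k x) ->
  (forall k, k \in s -> closed_in X (A k)) ->
  (forall k, k \in s -> cts (X `&` A k) phi) -> cts X phi.
Proof.
move=> cov cl h x Xx e e0.
have [d d0 hd] : exists2 d, 0 < d & forall k, k \in s ->
    forall y, X y -> close d x y -> A k y -> `|phi x - phi y| < e.
  apply: (@seq_min_pos _ s
    (fun k d => forall y, X y -> close d x y -> A k y -> `|phi x - phi y| < e)).
    by move=> k a b ba H y Xy c; apply: H => //; apply: close_le c.
  move=> k ks; have [Ax|nAx] := pselect (A k x).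
    have [d d0 hd] := h k ks x (conj Xx Ax) e e0.
    by exists d => // y Xy c Ay; apply: hd.
  have [d d0 hd] := cl k ks x Xx nAx.
  by exists d => // y Xy c Ay; case: (hd y Xy c).
exists d => // y Xy c; have [k ks Ay] := cov y Xy.
exact: hd ks _ Xy c Ay.
Qed.

End Continuity.

Section FlagComplex.
Variables (R : realType) (T : eqType) (cmp : rel T).
Hypotheses (cmpxx : reflexive cmp) (cmpC : symmetric cmp).
Implicit Types (S : set T) (X Y : set (nat -> R)) (f g : (nat -> R) -> T -> R).

(** Barycentric coordinates of a point of the flag complex of [cmp] on [S]: the support is a clique.
    The list [ts] only has to contain the support, so it can serve many points at once. *)
Definition geo S (ts : seq T) (a : T -> R) :=
  [/\ forall t, 0 <= a t, forall t, t \notin ts -> a t = 0,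
      forall t, a t != 0 -> S t,
      forall s t, a s != 0 -> a t != 0 -> cmp s t &
      \sum_(t <- ts) a t = 1].

(** One finite [ts] must do for all of [X]. The image then lies in a finite subcomplex, where
    coordinatewise continuity is continuity for the weak topology. *)
Definition fct S X f :=
  exists2 ts, uniq ts & (forall x, X x -> geo S ts (f x)) /\ forall t, cts X (f^~ t).

Lemma sum_wider (ts ts' : seq T) (a : T -> R) : uniq ts -> uniq ts' ->
  {subset ts <= ts'} -> (forall t, t \notin ts -> a t = 0) ->
  \sum_(t <- ts') a t = \sum_(t <- ts) a t.
Proof.
move=> u u' sub a0; rewrite (bigID (mem ts)) /= [X in _ + X]big1 ?addr0; last first.
  by move=> t /a0.
rewrite -big_filter; apply: perm_big; apply: uniq_perm; rewrite ?filter_uniq //.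
by move=> t; rewrite mem_filter /=; case: (boolP (t \in ts)) => // /sub ->.
Qed.

Lemma geo_wider S ts ts' a : uniq ts -> uniq ts' -> {subset ts <= ts'} ->
  geo S ts a -> geo S ts' a.
Proof.
move=> u u' sub [h1 h2 h3 h4 h5]; split=> //; last by rewrite (sum_wider u).
by move=> t nt; apply: h2; apply: contra nt; apply: sub.
Qed.

Lemma geo_sub S S' ts a : S `<=` S' -> geo S ts a -> geo S' ts a.
Proof. by move=> sub [h1 h2 h3 h4 h5]; split=> // t /h3/sub. Qed.

Lemma geo_le1 S ts a t : uniq ts -> geo S ts a -> a t <= 1.
Proof.
move=> u [h1 h2 h3 h4 h5]; case: (boolP (t \in ts)) => [tin|/h2->//].
by rewrite -h5 (big_rem t) //= lerDl sumr_ge0.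
Qed.

Lemma geo_conv S ts a b s : 0 <= s -> s <= 1 -> geo S ts a -> geo S ts b ->
  (forall x y, a x != 0 -> b y != 0 -> cmp x y) ->
  geo S ts (fun t => (1 - s) * a t + s * b t).
Proof.
move=> s0 s1 [h1 h2 h3 h4 h5] [k1 k2 k3 k4 k5] ab.
have nz t : (1 - s) * a t + s * b t != 0 -> a t != 0 \/ b t != 0.
  case: (eqVneq (a t) 0) => [->|]; last by left.
  by case: (eqVneq (b t) 0) => [->|]; [rewrite !mulr0 addr0 eqxx|right].
split.
- by move=> t; rewrite addr_ge0 // mulr_ge0 // subr_ge0.
- by move=> t nt; rewrite h2 // k2 // !mulr0 addr0.
- by move=> t /nz[/h3|/k3].
- move=> x y /nz[ax|bx] /nz[ay|by']; [exact: h4|exact: ab|rewrite cmpC; exact: ab|exact: k4].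
- by rewrite big_split /= -!mulr_sumr h5 k5; ring.
Qed.

Lemma geo_delta S ts v : uniq ts -> v \in ts -> S v -> geo S ts (fun t => (t == v)%:R).
Proof.
move=> u vin Sv; split.
- by move=> t; rewrite ler0n.
- by move=> t; case: (eqVneq t v) => // ->; rewrite vin.
- by move=> t; case: (eqVneq t v) => [->|_]; rewrite ?eqxx.
- by move=> s t; case: (eqVneq s v) => [->|_]; case: (eqVneq t v) => [->|_]; rewrite ?eqxx.
- rewrite (big_rem v) //= eqxx big_seq big1 ?addr0 // => t.
  by rewrite mem_rem_uniq // inE => /andP[/negPf->].
Qed.

Lemma fct_sub S S' X Y f : S `<=` S' -> Y `<=` X -> fct S X f -> fct S' Y f.
Proof.
move=> sS sX [ts u [h1 h2]]; exists ts => //; split=> [x /sX/h1|t]; first exact: geo_sub.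
exact: cts_sub (h2 t).
Qed.

Lemma fct_eq S X f g : fct S X f -> (forall x, X x -> f x = g x) -> fct S X g.
Proof.
move=> [ts u [h1 h2]] e; exists ts => //; split=> [x Xx|t]; first by rewrite -e //; exact: h1.
by apply: (cts_eq (h2 t)) => x Xx; rewrite e.
Qed.

Lemma fct_glue S X (K : eqType) (s : seq K) (A : K -> set (nat -> R)) f :
  (forall x, X x -> exists2 k, k \in s & A k x) ->
  (forall k, k \in s -> closed_in X (A k)) ->
  (forall k, k \in s -> fct S (X `&` A k) f) -> fct S X f.
Proof.
move=> cov cl h.
have [ts uts hts] : exists2 ts, uniq ts & forall k, k \in s -> forall x, X x -> A k x -> geo S ts (f x).
  elim: s {cov cl} h => [|k s IH] h; first by exists [::].
  have [ts1 u1 h1] : exists2 ts, uniq ts & forall k, k \in s -> forall x, X x -> A k x -> geo S ts (f x).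
    by apply: IH => j js; apply: h; rewrite inE js orbT.
  have [ts2 u2 [h2 _]] := h k (mem_head _ _).
  exists (undup (ts1 ++ ts2)); first exact: undup_uniq.
  move=> j; rewrite inE => /orP[/eqP->|js] x Xx Ax.
    apply: geo_wider u2 (undup_uniq _) _ (h2 _ (conj Xx Ax)) => t tin.
    by rewrite mem_undup mem_cat tin orbT.
  apply: geo_wider u1 (undup_uniq _) _ (h1 _ js _ Xx Ax) => t tin.
  by rewrite mem_undup mem_cat tin.
exists ts => //; split=> [x Xx|t].
  by have [k ks Ax] := cov x Xx; exact: hts Ax.
by apply: cts_glue cov cl _ => k ks; have [? ? [_]] := h k ks; apply.
Qed.

Lemma fct_subst S X Y (D : seq nat) (c : nat -> R) (u : (nat -> R) -> nat -> R) f :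
  (forall x, Y x -> X (u x)) ->
  (forall i x, i \notin D -> Y x -> u x i = c i) ->
  (forall i, i \in D -> cts Y (fun x => u x i)) ->
  fct S X f -> fct S Y (fun x => f (u x)).
Proof.
move=> sub uc ucts [ts uts [h1 h2]]; exists ts => //; split=> [x /sub/h1//|t].
exact: (cts_subst sub uc ucts (h2 t)).
Qed.

Definition cube (D : seq nat) (c : nat -> R) (rho : R) : set (nat -> R) :=
  [set x | forall i, `|x i - c i| <= if i \in D then rho else 0].

Definition bdry (D : seq nat) (c : nat -> R) (rho : R) : set (nat -> R) :=
  [set x | cube D c rho x /\ exists2 i, i \in D & `|x i - c i| = rho].

(** The vanishing of homotopy in degree [j - 1], with cubes for balls. For [j = 0] the boundary is
    empty, and filling it yields a point of the complex. *)
Definition fills (j : nat) S := forall D c rho f, uniq D -> size D = j -> 0 < rho ->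
  fct S (bdry D c rho) f ->
  exists2 g, fct S (cube D c rho) g & forall x, bdry D c rho x -> g x = f x.

Definition nrm (D : seq nat) (c x : nat -> R) := \big[Num.max/0]_(i <- D) `|x i - c i|.

Lemma nrm_cts X D c : cts X (nrm D c).
Proof.
by apply: (cts_bigmax D) => k; apply/cts_norm/ctsB; [exact: cts_coord|exact: cts_cst].
Qed.

Lemma nrm_ge0 D c x : 0 <= nrm D c x.
Proof.
by rewrite /nrm; elim: D => [|i D IH]; rewrite ?big_nil // big_cons le_max IH orbT.
Qed.

Lemma nrm_ge D c x i : i \in D -> `|x i - c i| <= nrm D c x.
Proof.
rewrite /nrm; elim: D => // j D IH; rewrite inE big_cons le_max.
by case/orP => [/eqP->|/IH->]; rewrite ?lexx ?orbT.
Qed.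

Lemma nrm_le D c x r : 0 <= r -> (forall i, i \in D -> `|x i - c i| <= r) -> nrm D c x <= r.
Proof.
move=> r0; rewrite /nrm; elim: D => [|i D IH] h; first by rewrite big_nil.
rewrite big_cons ge_max h ?mem_head //=; apply: IH => j jD.
by apply: h; rewrite inE jD orbT.
Qed.

Lemma nrm_attained D c x : 0 < nrm D c x -> exists2 i, i \in D & `|x i - c i| = nrm D c x.
Proof.
rewrite /nrm; elim: D => [|i D IH]; first by rewrite big_nil ltxx.
rewrite big_cons; case: (leP `|x i - c i| (\big[Num.max/0]_(j <- D) `|x j - c j|)) => h.
  by move/IH => [j jD e]; exists j => //; rewrite inE jD orbT.
by move=> _; exists i; rewrite ?mem_head.
Qed.

Lemma nrm_bdry D c rho x : 0 < rho -> bdry D c rho x -> nrm D c x = rho.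
Proof.
move=> r0 [cx [i iD e]]; apply/eqP; rewrite eq_le -{2}e nrm_ge // andbT.
by apply: nrm_le (ltW r0) _ => j jD; have := cx j; rewrite jD.
Qed.

Lemma cube_off D c rho x i : cube D c rho x -> i \notin D -> x i = c i.
Proof.
move=> cx iD; have := cx i; rewrite (negPf iD) normr_le0 subr_eq0.
by move/eqP.
Qed.

Definition radial D c rho x i : R := c i + rho / nrm D c x * (x i - c i).

Lemma radial_bdry D c rho x : 0 < rho -> cube D c rho x -> 0 < nrm D c x ->
  bdry D c rho (radial D c rho x).
Proof.
move=> r0 cx n0.
have k0 : 0 <= rho / nrm D c x by rewrite divr_ge0 // ltW.
have sc i : `|radial D c rho x i - c i| = rho / nrm D c x * `|x i - c i|.
  by rewrite /radial addrAC subrr add0r normrM ger0_norm.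
split; last first.
  by have [i iD e] := nrm_attained n0; exists i; rewrite // sc e divfK ?gt_eqF.
move=> i; rewrite sc; case: (boolP (i \in D)) => iD.
  by rewrite mulrAC ler_pdivrMr // ler_wpM2l ?nrm_ge // ltW.
by rewrite (cube_off cx iD) subrr normr0 mulr0.
Qed.

Lemma radial_id D c rho x : rho != 0 -> nrm D c x = rho -> radial D c rho x = x.
Proof.
by move=> r0 e; apply/funext => i; rewrite /radial e divff // mul1r addrC subrK.
Qed.

Lemma radial_cts X D c rho i : (forall x, X x -> nrm D c x != 0) ->
  cts X (fun x => radial D c rho x i).
Proof.
move=> n0; apply: ctsD (@cts_cst _ _ _) _; apply: ctsM; last first.
  by apply: ctsB; [exact: cts_coord|exact: cts_cst].
by apply: ctsM (@cts_cst _ _ _) _; apply: ctsV => //; exact: nrm_cts.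
Qed.

Lemma closed_le X (phi : (nat -> R) -> R) a : cts X phi -> closed_in X [set x | phi x <= a].
Proof.
move=> h x Xx /negP; rewrite -ltNge => lt.
have [|d d0 hd] := h x Xx (phi x - a); first by rewrite subr_gt0.
exists d => // y Xy c /=; have := hd y Xy c; rewrite ltr_norml => /andP[_ ?]; apply/negP.
by rewrite -ltNge; lra.
Qed.

Lemma closed_ge X (phi : (nat -> R) -> R) a : cts X phi -> closed_in X [set x | a <= phi x].
Proof.
move=> h x Xx /negP; rewrite -ltNge => lt.
have [|d d0 hd] := h x Xx (a - phi x); first by rewrite subr_gt0.
exists d => // y Xy c /=; have := hd y Xy c; rewrite ltr_norml => /andP[? _]; apply/negP.
by rewrite -ltNge; lra.
Qed.

Lemma cone_fills j S v : S v -> (forall s, S s -> cmp s v) -> fills j S.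
Proof.
move=> Sv hv D c rho f uD sD r0 [ts0 uts0 [h1 h2]].
pose ts := undup (v :: ts0).
have uts : uniq ts by exact: undup_uniq.
have tsv : v \in ts by rewrite mem_undup mem_head.
have h1' x : bdry D c rho x -> geo S ts (f x).
  move=> /h1; apply: geo_wider => // t tin.
  by rewrite mem_undup inE tin orbT.
pose dl : T -> R := fun t => (t == v)%:R.
have gd : geo S ts dl by exact: geo_delta.
pose s x := nrm D c x / rho.
pose g x : T -> R := if nrm D c x == 0 then dl else
  fun t => (1 - s x) * dl t + s x * f (radial D c rho x) t.
have s0 x : 0 <= s x by rewrite divr_ge0 ?nrm_ge0 // ltW.
have s1 x : cube D c rho x -> s x <= 1.
  move=> cx; rewrite ler_pdivrMr // mul1r; apply: nrm_le (ltW r0) _ => i iD.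
  by have := cx i; rewrite iD.
have sc X : cts X s by apply: ctsM; [exact: nrm_cts|exact: cts_cst].
exists g; last first.
  move=> x bx; rewrite /g (nrm_bdry r0 bx) gt_eqF // radial_id ?gt_eqF ?(nrm_bdry r0 bx) //.
  by apply/funext => t; rewrite /s (nrm_bdry r0 bx) divff ?gt_eqF // subrr mul0r add0r mul1r.
have gg x : cube D c rho x -> geo S ts (g x).
  move=> cx; rewrite /g; case: eqP => // /eqP n0.
  have n1 : 0 < nrm D c x by rewrite lt_neqAle eq_sym n0 nrm_ge0.
  have gf := h1' _ (radial_bdry r0 cx n1).
  apply: geo_conv => //; first exact: s1.
  move=> a b; rewrite /dl; case: (eqVneq a v) => [->|]; rewrite ?eqxx // => _ fb.
  by rewrite cmpC; apply: hv; case: gf => _ _ h _ _; apply: h fb.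
exists ts => //; split=> // t.
move=> x cx e e0; case: (eqVneq (nrm D c x) 0) => n0; last first.
  pose U : set (nat -> R) := [set y | nrm D c y != 0].
  have hU : cts (cube D c rho `&` U) (fun x => (1 - s x) * dl t + s x * f (radial D c rho x) t).
    apply: ctsD; apply: ctsM; [by apply: ctsB (sc _); exact: cts_cst|exact: cts_cst|exact: sc|].
    apply: (@cts_subst _ (bdry D c rho) _ D c) (h2 t).
    - move=> y [cy /= n]; apply: radial_bdry => //.
      by rewrite lt_neqAle eq_sym n nrm_ge0.
    - by move=> i y iD [cy _]; rewrite /radial (cube_off cy iD) subrr mulr0 addr0.
    - by move=> i _; apply: radial_cts => y [].
  have [d d0 hd] := hU x (conj cx n0) e e0.
  have [|d' d'0 hd'] := @nrm_cts (cube D c rho) D c x cx (nrm D c x).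
    by rewrite lt_neqAle eq_sym n0 nrm_ge0.
  exists (Num.min d d'); first by rewrite lt_min d0.
  move=> y cy cl.
  have c1 : close d x y by apply: close_le cl; rewrite ge_min lexx.
  have c2 : close d' x y by apply: close_le cl; rewrite ge_min lexx orbT.
  have ny : nrm D c y != 0.
    by apply/eqP => ny; have := hd' y cy c2; rewrite ny subr0 ger0_norm ?nrm_ge0 // ltxx.
  by rewrite /g (negPf n0) (negPf ny); apply: hd.
(* At the centre the radial projection has no meaning, but there the weight [s y] of [f] tends to 0,
   and the coordinates of [f] are bounded by 1. *)
have [d d0 hd] := sc (cube D c rho) x cx e e0.
exists d => // y cy cl; have := hd y cy cl.
rewrite {1}/s n0 mul0r sub0r normrN ger0_norm // => se.
rewrite /g n0 eqxx; case: eqP => ny; first by rewrite subrr normr0.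
apply: le_lt_trans se.
have -> : dl t - ((1 - s y) * dl t + s y * f (radial D c rho y) t) =
  s y * (dl t - f (radial D c rho y) t) by ring.
rewrite normrM ger0_norm // -[leRHS]mulr1; apply: ler_wpM2l => //.
have gf : geo S ts (f (radial D c rho y)).
  apply/h1'/radial_bdry => //; rewrite lt_neqAle nrm_ge0 andbT eq_sym; exact/eqP.
have := geo_le1 t uts gf; have := geo_le1 t uts gd.
have : 0 <= dl t by rewrite ler0n. have : 0 <= f (radial D c rho y) t by case: gf.
by move=> *; rewrite ler_norml; apply/andP; split; lra.
Qed.

Definition upd (x : nat -> R) i s : nat -> R := fun k => if k == i then s else x k.

(** The time of a homotopy is stored in a coordinate [i0], taken outside [D] in the lemmas below, so
    that the cylinder over the boundary is again a set of sequences. *)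
Definition prism D c rho i0 : set (nat -> R) :=
  [set y | bdry D c rho (upd y i0 (c i0)) /\ 0 <= y i0 <= 1].

Lemma upd_id x i : upd x i (x i) = x.
Proof. by apply/funext => k; rewrite /upd; case: eqP => [->|]. Qed.

Lemma updK x i s t : upd (upd x i s) i t = upd x i t.
Proof. by apply/funext => k; rewrite /upd; case: eqP. Qed.

Lemma bdry_prism D c rho i0 x s : i0 \notin D -> bdry D c rho x -> 0 <= s <= 1 ->
  prism D c rho i0 (upd x i0 s).
Proof.
move=> iD bx s01; split; last by rewrite /upd eqxx.
by rewrite updK -(cube_off (proj1 bx) iD) upd_id.
Qed.

(* Collar argument: a homotopy on the boundary lives on the outer half of the cube,
   and the filling of its end on the inner half. *)
Lemma homotopy_fills S D c rho i0 h f g : i0 \notin D -> 0 < rho ->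
  fct S (prism D c rho i0) h -> fct S (cube D c rho) g ->
  (forall x, bdry D c rho x -> f x = h (upd x i0 0)) ->
  (forall x, bdry D c rho x -> g x = h (upd x i0 1)) ->
  exists2 G, fct S (cube D c rho) G & forall x, bdry D c rho x -> G x = f x.
Proof.
move=> iD r0 fh fg hf hg.
pose s x := nrm D c x / rho.
have rn0 : rho != 0 by rewrite gt_eqF.
have s0 x : 0 <= s x by rewrite divr_ge0 ?nrm_ge0 // ltW.
have s1 x : cube D c rho x -> s x <= 1.
  move=> cx; rewrite ler_pdivrMr // mul1r; apply: nrm_le (ltW r0) _ => i iD'.
  by have := cx i; rewrite iD'.
have sc X : cts X s by apply: ctsM; [exact: nrm_cts|exact: cts_cst].
have sn x : 0 < s x -> 0 < nrm D c x by rewrite /s => ?; rewrite -(@pmulr_lgt0 _ rho^-1) ?invr_gt0.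
(* [dbl] stretches the inner half of the cube to the whole cube; on the outer half the time
   [2 - 2 * s x] runs from 0 on the boundary to 1. Where [s x = 2^-1], [dbl] is the radial
   projection, and the two formulas agree by [hg]. *)
pose dbl x i : R := c i + 2 * (x i - c i).
pose G x := if 2^-1 <= s x then h (upd (radial D c rho x) i0 (2 - 2 * s x)) else g (dbl x).
exists G; last first.
  move=> x bx; have sx : s x = 1 by rewrite /s (nrm_bdry r0 bx) divff.
  rewrite /G sx invf_le1 ?ltr0n // ler1n /= mulr1 subrr radial_id ?(nrm_bdry r0 bx) //.
  by rewrite hf.
pose A (b : bool) : set (nat -> R) := if b then [set x | 2^-1 <= s x] else [set x | s x <= 2^-1].
apply: (@fct_glue _ _ _ [:: true; false] A).
- move=> x _; case: (leP 2^-1 (s x)) => h2; [exists true|exists false] => //=.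
  exact: ltW.
- by move=> [] _; [apply: closed_ge|apply: closed_le].
move=> [] _.
  apply: (@fct_eq _ _ (fun x => h (upd (radial D c rho x) i0 (2 - 2 * s x)))); last first.
    by move=> x [_ /= h2]; rewrite /G h2.
  apply: (@fct_subst _ (prism D c rho i0) _ (i0 :: D) c) fh.
  - move=> x [cx /= h2]; apply: bdry_prism => //.
      by apply: radial_bdry => //; apply: sn; lra.
    by have := s1 x cx; move=> ?; apply/andP; split; lra.
  - move=> i x; rewrite inE negb_or => /andP[ni niD] [cx _].
    by rewrite /upd (negPf ni) /radial (cube_off cx niD) subrr mulr0 addr0.
  - move=> i _; rewrite /upd; case: eqP => _.
      by apply: ctsB; [exact: cts_cst|apply: ctsM; [exact: cts_cst|exact: sc]].
    by apply: radial_cts => x [_ /= ?]; rewrite gt_eqF //; apply: sn; lra.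
apply: (@fct_eq _ _ (fun x => g (dbl x))).
  apply: (@fct_subst _ (cube D c rho) _ D c) fg.
  - move=> x [cx /= h2] i; rewrite /dbl addrAC subrr add0r normrM ger0_norm ?ler0n //.
    case: (boolP (i \in D)) => iD'; last by rewrite (cube_off cx iD') subrr normr0 mulr0.
    have := nrm_ge c x iD'; rewrite /s ler_pdivrMr // in h2; lra.
  - by move=> i x niD [cx _]; rewrite /dbl (cube_off cx niD) subrr mulr0 addr0.
  - move=> i _; apply: ctsD; first exact: cts_cst.
    by apply: ctsM; [exact: cts_cst|apply: ctsB; [exact: cts_coord|exact: cts_cst]].
move=> x [cx /= h2]; rewrite /G; case: leP => // h3.
have sx : s x = 2^-1 by apply/eqP; rewrite eq_le h2.
have nx : nrm D c x = rho / 2 by rewrite -(divfK rn0 (nrm D c x)) -/(s x) sx mulrC.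
have dr : dbl x = radial D c rho x.
  apply/funext => i; rewrite /dbl /radial nx; congr (_ + _ * _).
  by rewrite invfM invrK mulrA divff // mul1r.
rewrite sx mulfV ?pnatr_eq0 // (_ : 2 - 1 = 1); last by ring.
rewrite dr hg //; apply: radial_bdry => //; rewrite nx divr_gt0 //.
Qed.

End FlagComplex.

Lemma prod_nbhs (R : realType) (x : prod_topology (fun _ : nat => R)) (s : seq nat) (d : R) :
  0 < d -> nbhs x [set x' : prod_topology (fun _ : nat => R) |
    forall i, i \in s -> `|x i - x' i| < d].
Proof.
move=> d0.
have h i : nbhs x [set x' : prod_topology (fun _ : nat => R) | `|x i - x' i| < d].
  exact: (@proj_continuous nat (fun=> R) i x _ (nbhsx_ballx (x i) d d0)).
elim: s => [|i s IH].
  have -> : [set x' : prod_topology (fun _ : nat => R) |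
      forall i, i \in [::] -> `|x i - x' i| < d] = setT.
    by apply/seteqP; split.
  exact: filterT.
refine (filterS _ (filterI (h i) IH)) => x' [h1 h2] j.
by rewrite inE => /orP[/eqP->|]; [exact: h1|exact: h2].
Qed.

Section UniformContinuity.
Variable R : realType.

(** Heine-Cantor: the cube is a product of segments, degenerate outside [D], hence compact by
    Tychonoff. Product neighbourhoods control finitely many coordinates only, but points of the cube
    agree outside [D]. *)
Lemma cube_unif (D : seq nat) (c : nat -> R) (rho : R) (phi : (nat -> R) -> R) :
  cts (cube D c rho) phi -> forall e, 0 < e ->
  exists2 d, 0 < d & forall x y, cube D c rho x -> cube D c rho y ->
    close d x y -> `|phi x - phi y| < e.
Proof.
move=> h e e0.
pose r i : R := if i \in D then rho else 0.
have cK : compact (cube D c rho : set (prod_topology (fun _ : nat => R))).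
  have -> : cube D c rho = [set x : nat -> R | forall i, `[c i - r i, c i + r i]%classic (x i)].
    apply/seteqP; split => x cx i; have := cx i; rewrite /= in_itv /=.
      by rewrite -/(r i) ler_norml => /andP[? ?]; apply/andP; split; lra.
    by rewrite -/(r i) ler_norml => /andP[? ?]; apply/andP; split; lra.
  apply: (@tychonoff nat (fun=> R) (fun i => `[c i - r i, c i + r i]%classic)) => i.
  exact: segment_compact.
have /compact_near_coveringP/(_ R (0^'+) (fun d x => cube D c rho x -> forall y, cube D c rho y ->
    close d x y -> `|phi x - phi y| < e)) := cK.
case.
- move=> x cx; have e20 : 0 < e / 2 by lra.
  have [d d0 hd] := h x cx _ e20.
  have d20 : 0 < d / 2 by lra.
  have N1 := prod_nbhs (x : prod_topology (fun _ : nat => R)) D d20.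
  exists ([set x' | forall i, i \in D -> `|x i - x' i| < d / 2], [set d' | d' < d / 2]).
    split => //=; exact: nbhs_right_lt.
  move=> [x' d'] /= [hx' hd'] cx' y cy cl.
  have cl1 : close d x x'.
    move=> i; case: (boolP (i \in D)) => iD; first by apply: lt_trans (hx' _ iD) _; lra.
    by rewrite (cube_off cx iD) (cube_off cx' iD) subrr normr0.
  have cl2 : close d x y.
    move=> i; case: (boolP (i \in D)) => iD; last first.
      by rewrite (cube_off cx iD) (cube_off cy iD) subrr normr0.
    have := hx' i iD; have := cl i; rewrite !ltr_norml => /andP[? ?] /andP[? ?].
    by apply/andP; split; lra.
  have := hd _ cx' cl1; have := hd _ cy cl2; rewrite !ltr_norml => /andP[? ?] /andP[? ?].
  by apply/andP; split; lra.
move=> d d0 hd; exists (d / 2) => /=; first by rewrite divr_gt0.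
move=> x y cx cy cl; apply: (hd (d / 2)) => //=.
- by rewrite sub0r normrN gtr0_norm ?divr_gt0 // ltr_pdivrMr // ltr_pMr // ltr1n.
- by rewrite divr_gt0.
Qed.

End UniformContinuity.

(** * Cubical grids and extension along carriers *)

Section Grid.
Variables (R : realType) (T : eqType) (cmp : rel T).
Variables (b : nat -> R) (eta : R).
Hypothesis eta0 : 0 < eta.
Implicit Types (m n : nat -> nat) (x : nat -> R).

(* The cells of the cubical grid of mesh [2 * eta] based at [b] are encoded by
   [m : nat -> nat]: an odd [m i] is the midpoint of a free edge, an even [m i] a
   fixed coordinate. *)
Definition corner m i : R := b i + eta * (m i)%:R.

Definition ccell m : set (nat -> R) :=
  [set x | forall i, `|x i - corner m i| <= if odd (m i) then eta else 0].

Definition ocell m : set (nat -> R) :=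
  [set x | ccell m x /\ forall i, odd (m i) -> `|x i - corner m i| < eta].

Definition face n m := forall i, n i = m i \/ odd (m i) /\ (n i = (m i).+1 \/ (n i).+1 = m i).

Lemma face_ccell n m : face n m -> ccell n `<=` ccell m.
Proof.
move=> nm x cx i; have := cx i; case: (nm i) => [e|[om e]].
  by rewrite /corner e.
have -> : odd (n i) = false by case: e; lia.
rewrite om normr_le0 subr_eq0 => /eqP ->; rewrite /corner.
have -> : b i + eta * (n i)%:R - (b i + eta * (m i)%:R) = eta * ((n i)%:R - (m i)%:R) by ring.
rewrite normrM gtr0_norm // -[leRHS]mulr1 ler_pM2l //.
case: e => [->|<-]; rewrite -natr1.
  by rewrite (_ : _ + 1 - _ = 1) ?normr1 //; ring.
by rewrite (_ : _ - (_ + 1) = -1) ?normrN1 //; ring.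
Qed.

Lemma natdist (p q k : nat) : `|eta * p%:R - eta * q%:R| < eta * k%:R ->
  (p < q + k)%N /\ (q < p + k)%N.
Proof.
rewrite -mulrBr normrM gtr0_norm // ltr_pM2l // ltr_norml => /andP[h1 h2].
by split; rewrite -(ltr_nat R) natrD; lra.
Qed.

(** Centres differ by integer multiples of [eta] in each coordinate, and parity leaves only the
    multiples allowed in a face. Hence relative interiors of distinct cells are disjoint, and a
    closed cell meets only the interiors of its faces. *)
Lemma ocell_face n m x : ocell n x -> ccell m x -> face n m.
Proof.
move=> [cn on] cm i; have := cn i; have := cm i; have := on i; rewrite /corner.
set y := x i; set bi := b i => h1 h2 h3.
have tri (r s : R) : `|y - (bi + eta * (n i)%:R)| <= r -> `|y - (bi + eta * (m i)%:R)| <= s ->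
   `|eta * (n i)%:R - eta * (m i)%:R| <= r + s.
  by rewrite !ler_norml => /andP[? ?] /andP[? ?]; apply/andP; split; lra.
have tri' (r s : R) : `|y - (bi + eta * (n i)%:R)| < r -> `|y - (bi + eta * (m i)%:R)| <= s ->
   `|eta * (n i)%:R - eta * (m i)%:R| < r + s.
  by rewrite !ltr_norml !ler_norml => /andP[? ?] /andP[? ?]; apply/andP; split; lra.
case on' : (odd (n i)) h1 h3; case om : (odd (m i)) h2 => h2 h1 h3.
- left; have := tri' _ _ (h1 isT) h2; rewrite (_ : eta + eta = eta * 2%:R); last by ring.
  by move/natdist => [? ?]; lia.
- have : `|eta * (n i)%:R - eta * (m i)%:R| < eta * 1%:R.
    by have := tri' _ _ (h1 isT) h2; rewrite addr0 mulr1.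
  by move/natdist => [? ?]; lia.
- right; split=> //; have := tri _ _ h3 h2; rewrite add0r => le.
  have : `|eta * (n i)%:R - eta * (m i)%:R| < eta * 2%:R.
    by apply: le_lt_trans le _; rewrite mulr_natr mulr2n ltrDl.
  by move/natdist => [? ?]; lia.
- left; have := tri _ _ h3 h2; rewrite addr0 => le.
  have : `|eta * (n i)%:R - eta * (m i)%:R| < eta * 1%:R by apply: le_lt_trans le _; rewrite mulr1.
  by move/natdist => [? ?]; lia.
Qed.

Definition updn m i k : nat -> nat := fun j => if j == i then k else m j.

Definition subface m (p : nat * bool) := updn m p.1 (if p.2 then (m p.1).+1 else (m p.1).-1).

Lemma subface_face m p : odd (m p.1) -> face (subface m p) m /\ subface m p <> m.
Proof.
case: p => i s /= om; split.
  move=> j; rewrite /subface /updn /=; case: (eqVneq j i) => [->|]; last by left.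
  by right; split=> //; case: s; [left|right; lia].
by move/(congr1 (fun f => f i)); rewrite /subface /updn /= eqxx; case: s; lia.
Qed.

Lemma ccell_bdry m x : ccell m x -> ~ ocell m x ->
  exists p, odd (m p.1) /\ ccell (subface m p) x.
Proof.
move=> cx nox.
have [i [om ei]] : exists i, odd (m i) /\ `|x i - corner m i| = eta.
  apply: contrapT => nex; apply: nox; split=> // i om; rewrite lt_neqAle.
  have := cx i; rewrite om => ->; rewrite andbT; apply/eqP => e.
  by apply: nex; exists i.
exists (i, 0 <= x i - corner m i); split=> //= j; rewrite /corner /subface /updn /=.
case: (eqVneq j i) => [->|_]; last exact: cx.
have op : odd (m i).-1 = false by lia.
case: (leP 0 (x i - corner m i)) ei => h; rewrite ?op /= ?om /=.
  rewrite ger0_norm // => e; rewrite normr_le0 -natr1.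
  by move: e; rewrite /corner => e; apply/eqP; lra.
rewrite ltr0_norm // => e; rewrite normr_le0.
have : ((m i).-1)%:R + 1 = (m i)%:R :> R by rewrite natr1 prednK //; lia.
move: e; rewrite /corner; move: (m i).-1%:R => u e eu; apply/eqP; rewrite -eu in e; lra.
Qed.

Lemma ccell_closed X m : closed_in X (ccell m).
Proof.
move=> x Xx nc.
have [i hi] : exists i, (if odd (m i) then eta else 0) < `|x i - corner m i|.
  apply: contrapT => nex; apply: nc => i; rewrite leNgt; apply/negP => h; apply: nex.
  by exists i.
exists (`|x i - corner m i| - (if odd (m i) then eta else 0)); first by rewrite subr_gt0.
move=> y Xy cl cy; have := cl i; have := cy i.
set r := (if _ then _ else _) => h1 h2.
have := ler_normD (x i - y i) (y i - corner m i); rewrite addrA subrK => h3.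
by lra.
Qed.

Variable D0 : seq nat.
Hypothesis uD0 : uniq D0.

Definition free m := [seq i <- D0 | odd (m i)].
Definition dm m := count (fun i => odd (m i)) D0.

Lemma ccellE m : (forall i, odd (m i) -> i \in D0) -> ccell m = cube (free m) (corner m) eta.
Proof.
move=> h; apply/seteqP; split=> x cx i; have := cx i; rewrite mem_filter.
  by case om : (odd (m i)) => //=; rewrite h.
by case om : (odd (m i)) => //=; rewrite h.
Qed.

Lemma bdryE m x : (forall i, odd (m i) -> i \in D0) ->
  bdry (free m) (corner m) eta x -> ccell m x /\ ~ ocell m x.
Proof.
move=> h [cx [i]]; rewrite mem_filter => /andP[om _] e; split; first by rewrite ccellE.
by move=> [_ /(_ i om)]; rewrite e ltxx.
Qed.

Lemma dm_face n m : (forall i, odd (m i) -> i \in D0) -> face n m -> n <> m -> (dm n < dm m)%N.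
Proof.
move=> h nm ne.
have [i ni] : exists i, n i <> m i.
  apply: contrapT => nex; apply: ne; apply/funext => i; apply: contrapT => e.
  by apply: nex; exists i.
have [e|[om e]] := nm i; first by case: ni.
have sub j : odd (n j) -> odd (m j) by case: (nm j) => [->|[]].
have iD := h i om.
rewrite /dm !(seq.permP (perm_to_rem iD)) /= om.
have -> : odd (n i) = false by case: e; lia.
rewrite add0n add1n ltnS; exact: sub_count.
Qed.

(** Induction on the dimension of cells. On the boundary of a cell outside [L] the values already
    lie in [C m]: on faces in [L], where [f] is kept, by hypothesis, and on the other faces by
    monotonicity of [C]. Then [fills] extends them. *)
Lemma carrier_extension (X L : set (nat -> nat)) (C : (nat -> nat) -> set T)
    (f : (nat -> R) -> T -> R) :
  (forall m, X m -> forall i, odd (m i) -> i \in D0) ->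
  (forall m n, X m -> face n m -> X n) ->
  (forall m n, L m -> face n m -> L n) ->
  (forall m, X m -> ~ L m -> fills R cmp (dm m) (C m)) ->
  (forall m n, X m -> ~ L m -> face n m -> n <> m -> L n -> fct cmp (C m) (ccell n) f) ->
  (forall m n, X m -> ~ L m -> face n m -> n <> m -> ~ L n -> C n `<=` C m) ->
  exists2 g, (forall m x, L m -> ccell m x -> g x = f x) &
    forall m, X m -> ~ L m -> fct cmp (C m) (ccell m) g.
Proof.
move=> XD Xf Lf fl LC CC.
suff [g gL gX] : exists2 g, (forall m x, L m -> ccell m x -> g x = f x) &
    forall m, X m -> ~ L m -> (dm m < (size D0).+1)%N -> fct cmp (C m) (ccell m) g.
  by exists g => // m Xm nLm; apply: gX => //; rewrite ltnS count_size.
elim: (size D0).+1 => [|k [g gL gX]]; first by exists f.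
pose ok m := [/\ X m, ~ L m & dm m = k].
have /choice[H HP] : forall m, exists h, ok m -> fct cmp (C m) (ccell m) h /\
    forall x, ccell m x -> ~ ocell m x -> h x = g x.
  move=> m; have [[Xm nLm dk]|nok] := pselect (ok m); last by exists f.
  have oD := XD m Xm.
  have fg : fct cmp (C m) (bdry (free m) (corner m) eta) g.
    apply: (@fct_glue _ _ _ _ _ _ [seq (i, s) | i <- free m, s <- [:: true; false]]
       (fun p => ccell (subface m p))).
    - move=> x /(bdryE oD)[cx nox]; have [[i s] [om cs]] := ccell_bdry cx nox.
      exists (i, s) => //; apply/allpairsP; exists (i, s); split=> //=.
        by rewrite mem_filter om oD.
      by case: (s).
    - by move=> p _; exact: ccell_closed.
    move=> p /allpairsP[[i s] [/= ip _ ->]].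
    move: ip; rewrite mem_filter => /andP[om _].
    have [fp np] := @subface_face m (i, s) om.
    have Xp := Xf _ _ Xm fp.
    have [Lp|nLp] := pselect (L (subface m (i, s))).
      apply: (fct_eq (f := f)); last by move=> x [_ cx]; rewrite (gL _ _ Lp cx).
      by apply: fct_sub (LC _ _ Xm nLm fp np Lp) => // x [].
    have dp := dm_face oD fp np; rewrite dk in dp.
    by apply: fct_sub (gX _ Xp nLp dp); [exact: CC|move=> x []].
  have uf : uniq (free m) by exact: filter_uniq.
  have sf : size (free m) = dm m by rewrite size_filter.
  have [h fh hb] := fl m Xm nLm _ _ _ _ uf sf eta0 fg.
  exists h => _; split; first by rewrite ccellE.
  move=> x cx nox; apply: hb; split; first by rewrite -ccellE.
  apply: contrapT => nex; apply: nox; split=> // i om; rewrite lt_neqAle.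
  have := cx i; rewrite om => ->; rewrite andbT; apply/eqP => e.
  by apply: nex; exists i; rewrite // mem_filter om oD.
(* Open cells of equal dimension are disjoint, so at most one [m] is eligible and the choice made by
   [cid] is forced. *)
pose g' x := if pselect (exists m, ok m /\ ocell m x) is left e then H (projT1 (cid e)) x else g x.
have g'in m x : ok m -> ccell m x -> g' x = H m x.
  move=> okm cx; rewrite /g'; case: pselect => [e|ne].
    case: (cid e) => /= m' [[Xm' nLm' dm'] ox].
    have fm := ocell_face ox cx.
    suff -> : m' = m by [].
    apply: contrapT => ne; case: okm => Xm nLm dmk.
    by have := dm_face (XD _ Xm) fm ne; rewrite dm' dmk ltnn.
  case: (HP m okm) => _ ->  // ox; apply: ne; by exists m.
have g'out x : (forall m, ok m -> ~ ocell m x) -> g' x = g x.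
  by move=> h; rewrite /g'; case: pselect => // -[m [okm ox]]; case: (h m okm).
exists g'.
  move=> m x Lm cx; rewrite g'out ?(gL _ _ Lm cx) // => m' [Xm' nLm' _] ox.
  by apply: nLm'; exact: Lf Lm (ocell_face ox cx).
move=> m Xm nLm; rewrite ltnS leq_eqVlt => /orP[/eqP dk|dk].
  have okm : ok m by [].
  by apply: (fct_eq (proj1 (HP m okm))) => x cx; rewrite (g'in m).
apply: (fct_eq (gX _ Xm nLm dk)) => x cx; rewrite g'out // => m' [Xm' nLm' dk'] ox.
have fm := ocell_face ox cx.
have [e|ne] := pselect (m' = m); first by move: dk; rewrite -e dk' ltnn.
by have := ltn_trans (dm_face (XD _ Xm) fm ne) dk; rewrite dk' ltnn.
Qed.

End Grid.

Lemma fresh_index (D : seq nat) : exists i, i \notin D.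
Proof.
exists (\max_(i <- D) i).+1; apply/negP => h.
by have := @leq_bigmax_seq _ D xpredT id _ h isT; rewrite ltnn.
Qed.

(** * Pushing maps off the attached vertices *)

Section Push.
Variables (R : realType) (T : eqType) (cmp : rel T).
Hypotheses (cmpxx : reflexive cmp) (cmpC : symmetric cmp).
Variables (S0 S : set T).
Hypothesis anti : forall u v, S u -> S v -> ~ S0 u -> ~ S0 v -> cmp u v -> u = v.

(* At a vertex outside [S0] the coordinate [a] becomes [max 0 (2 * a - 1)], and the
   coordinates in [S0] are rescaled accordingly. *)
Lemma push_off (X : set (nat -> R)) (f : (nat -> R) -> T -> R) : fct cmp S X f ->
  exists2 f1, fct cmp S X f1 &
    (forall x t, X x -> f1 x t != 0 -> f x t != 0) /\
    (forall x t, X x -> ~ S0 t -> f1 x t != 0 -> 2^-1 < f x t).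
Proof.
move=> [ts uts [geof cf]].
pose P t := `[< S0 t >].
pose a x := \sum_(t <- ts | ~~ P t) f x t.
(* By [anti] a simplex has at most one vertex outside [S0], whose new coordinate is
   [max 0 (2 * a x - 1)]. Division by [k x] makes the [S0] part add up to the complement: 1 if
   [a x <= 2^-1], and [2 * (1 - a x)] otherwise. *)
pose k x := Num.max (1 - a x) 2^-1.
pose f1 x t : R := if P t then f x t / k x else Num.max 0 (2 * f x t - 1).
have k0 x : 0 < k x by rewrite lt_max invr_gt0 ltr0n orbT.
have ge0 x t : X x -> 0 <= f x t by move=> /geof[].
have f1f x t : X x -> f1 x t != 0 -> f x t != 0.
  move=> Xx; rewrite /f1; case: (P t); first by apply: contra => /eqP->; rewrite mul0r.
  apply: contra => /eqP->; rewrite mulr0 sub0r; apply/eqP/max_idPl; lra.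
exists f1; last first.
  split=> // x t Xx nS; rewrite /f1 /P asboolF //.
  case: (leP (2 * f x t - 1) 0) => [h|h _]; first by rewrite eqxx.
  lra.
exists ts => //; split; last first.
  have ca : cts X a by apply: cts_sum.
  have ck : cts X k by apply: cts_max; [apply: ctsB ca; exact: cts_cst|exact: cts_cst].
  move=> t; rewrite /f1; case: (P t).
    by apply: ctsM => //; apply: ctsV ck => x _; rewrite gt_eqF.
  apply: cts_max; first exact: cts_cst.
  by apply: ctsB; [apply: ctsM; [exact: cts_cst|exact: cf]|exact: cts_cst].
move=> x Xx; have [g1 g2 g3 g4 g5] := geof x Xx.
split.
- by move=> t; rewrite /f1; case: (P t); rewrite ?divr_ge0 // ?(ltW (k0 x)) // le_max lexx.
- by move=> t nt; apply: contrapT => /eqP /f1f -/(_ Xx); rewrite g2 ?eqxx.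
- by move=> t /f1f -/(_ Xx)/g3.
- by move=> s t /f1f -/(_ Xx) hs /f1f -/(_ Xx); exact: g4.
rewrite (bigID P) /= -big_filter.
have -> : \sum_(t <- [seq t <- ts | P t]) f1 x t = (1 - a x) / k x.
  rewrite big_filter -[in RHS]g5 [in RHS](bigID P) /= /a addrK mulr_suml.
  by apply: eq_bigr => t Pt; rewrite /f1 Pt.
have -> : \sum_(t <- ts | ~~ P t) f1 x t = Num.max 0 (2 * a x - 1).
  have [[v [nS vin fv]]|nex] := pselect (exists v, [/\ ~ S0 v, v \in ts & f x v != 0]).
    have z t : t \in rem v ts -> ~~ P t -> f x t = 0.
      rewrite mem_rem_uniq // inE => /andP[tv _] /asboolP nSt; apply/eqP.
      apply: contraNT tv => ft; apply/eqP; apply: anti nSt nS _; [exact: g3|exact: g3|exact: g4].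
    have nP : ~~ P v by apply/asboolP.
    have ax : a x = f x v.
      by rewrite /a (big_rem v) //= nP big_seq_cond big1 ?addr0 // => t /andP[]; exact: z.
    rewrite (big_rem v) //= nP big_seq_cond big1 ?addr0; last first.
      move=> t /andP[h1 h2]; rewrite /f1 (negPf h2) z // mulr0 sub0r.
      by apply/max_idPl; lra.
    by rewrite /f1 (negPf nP) ax.
  have z t : t \in ts -> ~~ P t -> f x t = 0.
    move=> tin /asboolP nS; apply: contrapT => /eqP ft; apply: nex.
    by exists t.
  have ax : a x = 0 by rewrite /a big_seq_cond big1 // => t /andP[]; exact: z.
  rewrite ax mulr0 sub0r (max_idPl _); last lra.
  rewrite big_seq_cond big1 // => t /andP[h1 h2]; rewrite /f1 (negPf h2) z // mulr0 sub0r.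
  by apply/max_idPl; lra.
rewrite /k; case: (leP (1 - a x) 2^-1) => h.
  by rewrite (max_idPr _); [rewrite invrK; lra|lra].
rewrite (max_idPl _); last lra.
by rewrite divff ?addr0 // gt_eqF //; lra.
Qed.

(** As the support of [f1 x] lies in that of [f x], the segment joining them stays in one simplex,
    so the linear homotopy is a map to the complex. *)
Lemma linear_homotopy_fills (D : seq nat) c rho (f f1 : (nat -> R) -> T -> R) : 0 < rho ->
  fct cmp S (bdry D c rho) f -> fct cmp S (bdry D c rho) f1 ->
  (forall x t, bdry D c rho x -> f1 x t != 0 -> f x t != 0) ->
  (exists2 g, fct cmp S (cube D c rho) g & forall x, bdry D c rho x -> g x = f1 x) ->
  (exists2 g, fct cmp S (cube D c rho) g & forall x, bdry D c rho x -> g x = f x).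
Proof.
move=> r0 [ts1 u1 [g1 c1]] [ts2 u2 [g2 c2]] sup [g fg gf].
have [i0 i0D] := fresh_index D.
pose b y := upd y i0 (c i0).
pose h (y : nat -> R) t := (1 - y i0) * f (b y) t + y i0 * f1 (b y) t.
apply: (@homotopy_fills _ _ _ S D c rho i0 h f g) => //.
- pose ts := undup (ts1 ++ ts2).
  have uts : uniq ts by exact: undup_uniq.
  exists ts => //; split.
    move=> y [by' /andP[y0 y1]].
    have G1 := g1 _ by'; have G2 := g2 _ by'.
    apply: geo_conv => //.
    + by apply: geo_wider G1 => // t tin; rewrite mem_undup mem_cat tin.
    + by apply: geo_wider G2 => // t tin; rewrite mem_undup mem_cat tin orbT.
    + move=> s t fs f1t; case: G1 => _ _ _ h4 _; apply: h4 fs _.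
      exact: sup f1t.
  have cb (phi : (nat -> R) -> R) : cts (bdry D c rho) phi ->
      cts (prism D c rho i0) (fun y => phi (b y)).
    apply: (@cts_subst _ _ _ D c).
    + by move=> y [].
    + by move=> i y iD [[cy _] _]; exact: cube_off cy iD.
    + move=> i iD; rewrite /b /upd; case: eqP => [ei|_]; last exact: cts_coord.
      by rewrite -ei iD in i0D.
  move=> t; apply: ctsD; apply: ctsM.
  + by apply: ctsB; [exact: cts_cst|exact: cts_coord].
  + exact: cb (c1 t).
  + exact: cts_coord.
  + exact: cb (c2 t).
- move=> x bx; apply/funext => t; rewrite /h /b updK -(cube_off (proj1 bx) i0D) upd_id.
  by rewrite /upd eqxx subr0 mul1r mul0r addr0.
- move=> x bx; rewrite gf //; apply/funext => t; rewrite /h /b updK -(cube_off (proj1 bx) i0D) upd_id.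
  by rewrite /upd eqxx subrr mul1r mul0r add0r.
Qed.

End Push.

(** The last clause forces degenerate cells at even integers. Points on the bottom, on the top or on
    an outer facet of a gridded prism thus get cells lying there, which identifies the values at
    both ends of the homotopy. *)
Lemma grid_coord (R : realType) (y : R) (K : nat) : 0 <= y -> y <= K%:R -> ~~ odd K ->
  exists k, [/\ (k <= K)%N, `|y - k%:R| <= (odd k)%:R &
    forall q, ~~ odd q -> y = q%:R -> k = q].
Proof.
move=> y0 yK eK; have /andP[j1 j2] := truncn_itv y0; set j := Num.truncn y in j1 j2.
have jK : (j <= K)%N by rewrite -(ler_nat R); exact: le_trans yK.
have jq q : y = q%:R -> j = q.
  by move: (j) j1 j2 => k k1 k2 e; move: k1 k2; rewrite e ler_nat ltr_nat; lia.
rewrite -natr1 in j2.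
case oj : (odd j).
  exists j; split=> //; first by rewrite oj ger0_norm ?subr_ge0 //= ; lra.
  by move=> q oq /jq.
have [yj|yj] := eqVneq y j%:R.
  by exists j; split=> //; [rewrite yj subrr normr0 ler0n|move=> q _ /jq].
have jy : j%:R < y by rewrite lt_neqAle eq_sym yj.
exists j.+1; split.
- by rewrite -(ltr_nat R); exact: lt_le_trans yK.
- by rewrite /= oj /= -natr1 ler_norml; apply/andP; split; lra.
- by move=> q _ /[dup] /jq <- e; rewrite e eqxx in yj.
Qed.

Lemma face_le (p q K : nat) : ~~ odd K -> odd q -> p = q.+1 \/ p.+1 = q -> (q <= K)%N -> (p <= K)%N.
Proof. by move=> eK oq [|]; lia. Qed.

Lemma le2_cases (k : nat) : (k <= 2)%N -> k <> 0%N -> k = 1%N \/ k = 2%N.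
Proof. by lia. Qed.

Lemma odd_lt_even (p K : nat) : odd p -> ~~ odd K -> (p <= K)%N -> (p < K)%N.
Proof. by lia. Qed.

Lemma finite_cells (D : seq nat) (K : nat) :
  exists s : seq (nat -> nat), forall m, (forall i, i \notin D -> m i = 0%N) ->
    (forall i, (m i <= K)%N) -> m \in s.
Proof.
elim: D => [|i D [s hs]].
  by exists [:: fun=> 0%N] => m m0 _; rewrite inE; apply/eqP/funext => i; rewrite m0.
exists [seq updn m i k | m <- s, k <- iota 0 K.+1] => m m0 mK.
apply/allpairsP; exists (updn m i 0, m i); split.
- apply: hs => j; rewrite /= /updn; case: (eqVneq j i) => // ji.
  by move=> jD; apply: m0; rewrite inE negb_or ji.
- by rewrite mem_iota leq0n add0n ltnS /= mK.
- by apply/funext => j; rewrite /= /updn; case: (eqVneq j i) => // ->.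
Qed.

(** * Attaching cones over connected links *)

Section Attach.
Variables (R : realType) (T : eqType) (cmp : rel T).
Hypotheses (cmpxx : reflexive cmp) (cmpC : symmetric cmp).

(** The boundary is a finite union of facets, each a cube with the coordinate [i] frozen, so uniform
    continuity is applied facet by facet. Comparing points of a common facet suffices, as every grid
    cell of the boundary lies in one. *)
Lemma bdry_mesh (D : seq nat) (c : nat -> R) rho (f : (nat -> R) -> T -> R) (ts : seq T) e :
  uniq D -> 0 < e -> 0 < rho -> (forall t, cts (bdry D c rho) (f^~ t)) ->
  exists2 d, 0 < d & forall i (s : bool) t x y, i \in D -> t \in ts ->
    bdry D c rho x -> bdry D c rho y ->
    x i = c i + (-1) ^+ s * rho -> y i = c i + (-1) ^+ s * rho ->
    close d x y -> `|f x t - f y t| < e.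
Proof.
move=> uD e0 r0 cf.
pose P (k : nat * bool * T) (d : R) := forall x y,
    bdry D c rho x -> bdry D c rho y ->
    x k.1.1 = c k.1.1 + (-1) ^+ k.1.2 * rho -> y k.1.1 = c k.1.1 + (-1) ^+ k.1.2 * rho ->
    close d x y -> `|f x k.2 - f y k.2| < e.
pose ks := [seq (p, t) | p <- [seq (i, s) | i <- D, s <- [:: true; false]], t <- ts].
have [||d d0 hd] := @seq_min_pos _ _ ks P.
- by move=> k d d' dd h x y bx by' ex ey cl; apply: h => //; exact: close_le cl.
- move=> k /allpairsP[[p t] [/allpairsP[[i s] [/= iD _ ->]] tts ->]] {p k}.
  pose c' := upd c i (c i + (-1) ^+ s * rho).
  have sgn : `|(-1) ^+ s * rho| = rho by rewrite normrM normr_sign mul1r gtr0_norm.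
  have toc x : bdry D c rho x -> x i = c i + (-1) ^+ s * rho -> cube (rem i D) c' rho x.
    move=> [cx _] ex j; rewrite mem_rem_uniq // inE /c' /upd; case: (eqVneq j i) => [->|ji] /=.
      by rewrite ex subrr normr0.
    exact: cx.
  have ofc x : cube (rem i D) c' rho x -> bdry D c rho x.
    move=> cx; have ei : x i = c i + (-1) ^+ s * rho.
      by rewrite (cube_off cx) ?mem_rem_uniq // ?inE ?eqxx // /c' /upd eqxx.
    split; last by exists i; rewrite // ei addrAC subrr add0r.
    move=> j; case: (eqVneq j i) => [->|ji]; first by rewrite iD ei addrAC subrr add0r sgn.
    by have := cx j; rewrite mem_rem_uniq // inE ji /c' /upd (negPf ji).
  have [d d0 hd] := cube_unif (cts_sub ofc (cf t)) e0.
  by exists d => // x y bx by' ex ey cl; apply: hd => //; exact: toc.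
exists d => // i s t x y iD tts bx by' ex ey cl.
apply: (hd (i, s, t)) => //; apply/allpairsP; exists ((i, s), t); split=> //.
by apply/allpairsP; exists (i, s); split=> //; case: (s).
Qed.

Variables (S0 S : set T).
Hypothesis S0S : S0 `<=` S.
Hypothesis anti : forall u v, S u -> S v -> ~ S0 u -> ~ S0 v -> cmp u v -> u = v.

Definition lk (v : T) : set T := [set s | S0 s /\ cmp s v].

(* On a fine grid every cell of the boundary is either mapped by [f1] to [S0] or mapped
   to the star of a single vertex [v]. On the cells of the second kind [f1] is replaced,
   cell by cell, by a map to the link of [v], and the homotopy is filled in the star. *)
Lemma attach_pushed N (D : seq nat) (c : nat -> R) rho (f f1 : (nat -> R) -> T -> R) :
  uniq D -> (size D <= N)%N -> 0 < rho ->
  (forall v j, S v -> ~ S0 v -> (j < N)%N -> fills R cmp j (lk v)) ->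
  (forall j, (j <= N)%N -> fills R cmp j S0) ->
  fct cmp S (bdry D c rho) f -> fct cmp S (bdry D c rho) f1 ->
  (forall x t, bdry D c rho x -> f1 x t != 0 -> f x t != 0) ->
  (forall x t, bdry D c rho x -> ~ S0 t -> f1 x t != 0 -> 2^-1 < f x t) ->
  exists2 g, fct cmp S (cube D c rho) g & forall x, bdry D c rho x -> g x = f1 x.
Proof.
move=> uD sD r0 fl fl0 ff ff1 sup half.
have [ts uts [gf cf]] := ff.
have [i0 i0D] := fresh_index D.
(* A vertex outside [S0] in the support of [f1 x] has weight above 1/2 in [f x]; if [f] varies by
   less than 1/4 on a cell, the vertex stays in the support of [f] on the whole cell. *)
have [|d d0 mesh] := @bdry_mesh D c rho f ts 4^-1 uD _ r0 cf; first by rewrite invr_gt0.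
(* The side [2 * rho] is cut into [2 * n] cells of width [2 * eta < d], so the codes of cells run
   from 0 to [4 * n]. *)
pose n := (Num.bound (rho / d)).+1.
pose eta := rho / (2 * n%:R).
have n0 : 0 < n%:R :> R by rewrite ltr0n.
have eta0 : 0 < eta by rewrite divr_gt0 // mulr_gt0.
have etan : eta * (4 * n)%:R = 2 * rho.
  by rewrite natrM /eta; field; rewrite gt_eqF.
have etad : 2 * eta < d.
  have h : rho / d < n%:R.
    apply: lt_trans (archi_boundP (divr_ge0 (ltW r0) (ltW d0))) _.
    by rewrite ltr_nat.
  have -> : 2 * eta = rho / n%:R by rewrite /eta; field; rewrite gt_eqF.
  by rewrite ltr_pdivrMr // mulrC -ltr_pdivrMr.
clearbody eta.
have e20 : 0 <= 2 * eta by rewrite mulr_ge0 // ltW.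
pose b i : R := if i \in D then c i - rho else if i == i0 then 0 else c i.
have b0 : b i0 = 0 by rewrite /b (negPf i0D) eqxx.
(* Cells of the boundary times one layer of height [2 * eta]: at [i0] the code is 0 on the bottom, 1
   inside the layer and 2 on the top, and some coordinate in [D] is extreme. *)
pose X : set (nat -> nat) := [set m | [/\ forall i, i \notin i0 :: D -> m i = 0%N, (m i0 <= 2)%N,
   forall i, i \in D -> (m i <= 4 * n)%N & exists2 i, i \in D & m i = 0%N \/ m i = (4 * n)%N]].
pose base (x : nat -> R) := upd x i0 (c i0).
pose P : set (nat -> R) := [set x | bdry D c rho (base x) /\ 0 <= x i0 <= 2 * eta].
have Xodd m : X m -> forall i, odd (m i) -> i \in i0 :: D.
  by move=> [m0 _ _ _] i; apply: contraTT => /m0 ->.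
have Xface m m' : X m -> face m' m -> X m'.
  move=> [m0 mi mD [i iD ei]] fm; split.
  - by move=> j jD; have := m0 j jD; case: (fm j) => [->|[om _]] // e; rewrite e in om.
  - by case: (fm i0) => [->|[om h]] //; exact: face_le om h mi.
  - move=> j jD; have := mD j jD; case: (fm j) => [->|[om h]] //.
    by apply: face_le om h => //; rewrite oddM.
  - by exists i => //; case: (fm i) => [->|[om h]] //; case: ei om => ->; rewrite ?oddM.
have XP m : X m -> ccell b eta m `<=` P.
  move=> [m0 mi mD [i iD ei]] x cx.
  have ci j : j \in D -> `|x j - c j| <= rho.
    move=> jD; have := cx j; rewrite /corner /b jD => h.
    have mj := mD j jD.
    have le1 : eta * (m j)%:R <= eta * (4 * n)%:R by rewrite ler_pM2l // ler_nat.
    have lo : 0 <= eta * (m j)%:R by rewrite mulr_ge0 ?ler0n // ltW.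
    case oj : (odd (m j)) h => h.
      have lo1 : eta <= eta * (m j)%:R by rewrite -{1}(mulr1 eta) ler_pM2l // ler1n odd_gt0.
      have le2 : eta * (m j)%:R + eta <= eta * (4 * n)%:R.
        by rewrite -{2}(mulr1 eta) -mulrDr natr1 ler_pM2l // ler_nat odd_lt_even // oddM.
      by move: h; rewrite !ler_norml => /andP[? ?]; apply/andP; split; lra.
    by move: h; rewrite !ler_norml => /andP[? ?]; apply/andP; split; lra.
  split; last first.
    have := cx i0; rewrite /corner b0 add0r; move: mi; case: (m i0) => [|[|[|]]] //= _.
    + by rewrite mulr0 subr0 normr_le0 => /eqP ->; rewrite lexx mulr_ge0 // ltW.
    + by rewrite mulr1 ler_norml => /andP[? ?]; apply/andP; split; lra.
    + by rewrite normr_le0 subr_eq0 => /eqP ->; apply/andP; split; lra.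
  split.
    move=> j; rewrite /base /upd; case: (eqVneq j i0) => [->|ji].
      by rewrite subrr normr0; case: ifP => // _; exact: ltW.
    case: ifP => jD; first exact: ci.
    have := cx j; rewrite m0 ?inE ?negb_or ?ji ?jD //= /corner m0 ?inE ?negb_or ?ji ?jD //.
    by rewrite mulr0 addr0 /b jD (negPf ji).
  exists i => //; rewrite /base /upd; case: (eqVneq i i0) => [ii|_]; first by rewrite -ii iD in i0D.
  have em : odd (m i) = false by case: ei => ->; rewrite ?oddM.
  have := cx i; rewrite em normr_le0 subr_eq0 /corner /b iD => /eqP ->.
  case: ei => ->; first by rewrite mulr0 addr0 addrAC subrr sub0r normrN gtr0_norm.
  by rewrite etan (_ : _ - c i = rho) ?gtr0_norm //; ring.
have cov x : P x -> exists2 m, X m & ccell b eta m x /\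
    forall q, ~~ odd q -> x i0 = eta * q%:R -> m i0 = q.
  move=> [[cx [i iD ei]] /andP[x0 x1]].
  have offi j : j \notin i0 :: D -> x j = c j.
    rewrite inE negb_or => /andP[ji jD].
    by have := cube_off cx jD; rewrite /base /upd (negPf ji).
  have onD j : j \in D -> x j = base x j.
    by rewrite /base /upd; case: (eqVneq j i0) => // -> ; rewrite (negPf i0D).
  pose y j := (x j - b j) / eta.
  have ey j : x j = b j + eta * y j by rewrite /y mulrC divfK ?gt_eqF // addrC subrK.
  pose K j := if j \in D then (4 * n)%N else if j == i0 then 2%N else 0%N.
  have yK j : 0 <= y j /\ y j <= (K j)%:R.
    rewrite /y /K ler_pdivrMr // (mulrC _ eta); case: ifP => jD.
      rewrite etan /b jD; have := cx j; rewrite jD -onD // ler_norml => /andP[? ?].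
      by split; [apply: divr_ge0; lra|lra].
    case: (eqVneq j i0) => [->|ji]; first by rewrite b0 subr0 divr_ge0 // ?(ltW eta0) // mulrC.
    rewrite /b jD (negPf ji) offi ?inE ?negb_or ?ji ?jD // subrr mul0r mulr0; split=> //.
  have /choice[m hm] : forall j, exists k, [/\ (k <= K j)%N, `|y j - k%:R| <= (odd k)%:R &
    forall q, ~~ odd q -> y j = q%:R -> k = q].
    move=> j; have [h1 h2] := yK j; apply: grid_coord => //.
    by rewrite /K; case: ifP => _; [rewrite oddM|case: ifP].
  exists m.
    split.
    - move=> j; rewrite inE negb_or => /andP[ji jD].
      by have [] := hm j; rewrite /K (negPf ji) (negPf jD) leqn0 => /eqP.
    - by have [] := hm i0; rewrite /K (negPf i0D) eqxx.
    - by move=> j jD; have [] := hm j; rewrite /K jD.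
    - exists i => //; have [_ _ hq] := hm i.
      rewrite -onD // in ei; rewrite (ey i) /b iD in ei.
      have : `|eta * y i - rho| = rho by rewrite -[RHS]ei; congr `|_|; ring.
      move/eqP; rewrite eqr_norml => /andP[/orP[/eqP e|/eqP e] _].
        right; apply: hq; first by rewrite oddM.
        by apply: (mulfI (lt0r_neq0 eta0)); rewrite etan; lra.
      left; apply: hq => //; apply: (mulfI (lt0r_neq0 eta0)); rewrite mulr0; lra.
  split.
    move=> j; rewrite /corner (ey j) (_ : _ - _ = eta * (y j - (m j)%:R)); last by ring.
    rewrite normrM gtr0_norm //; have [_ h _] := hm j; case: (odd (m j)) h => /= h.
      by rewrite -[leRHS]mulr1 ler_pM2l.
    by rewrite -[leRHS](mulr0 eta) ler_pM2l.
  move=> q oq e; have [_ _] := hm i0; apply=> //.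
  by rewrite /y b0 subr0 e mulrAC divff ?mul1r // gt_eqF.
have fin : exists s : seq (nat -> nat), forall m, X m -> m \in s.
  have [s hs] := finite_cells (i0 :: D) (4 * n + 2); exists s => m [m0 mi mD _].
  apply: hs => // j; case: (boolP (j \in i0 :: D)) => [|/m0 -> //].
  rewrite inE => /orP[/eqP->|/mD h]; first exact: leq_trans mi (leq_addl _ _).
  exact: leq_trans h (leq_addr _ _).
have [s hs] := fin.
pose fb x := f1 (base x).
have fbS : fct cmp S P fb.
  apply: (@fct_subst _ _ _ _ (bdry D c rho) _ D c) ff1.
  - by move=> x [].
  - by move=> i x iD [[cx _] _]; exact: cube_off cx iD.
  - move=> i iD; rewrite /base /upd; case: eqP => [ii|_]; last exact: cts_coord.
    by rewrite -ii iD in i0D.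
pose ty0 m := forall x, ccell b eta m x -> forall t, fb x t != 0 -> S0 t.
(* On [L] the homotopy equals [f1], constant in time: on the bottom, where it starts, and over cells
   which [f1] already maps to [S0]. *)
pose L m := X m /\ (m i0 = 0%N \/ ty0 m).
have nLv m : X m -> ~ L m -> exists v, [/\ S v, ~ S0 v &
    forall x, ccell b eta m x -> f (base x) v != 0].
  move=> Xm nL.
  have [x [v [cx fv nS]]] : exists x v, [/\ ccell b eta m x, fb x v != 0 & ~ S0 v].
    apply: contrapT => nex; apply: nL; split=> //; right => x cx t ft.
    by apply: contrapT => nS; apply: nex; exists x, t.
  have [bx _] := XP _ Xm _ cx.
  exists v; split=> //.
    by have [ts1 u1 [g1 _]] := ff1; have [_ _ h _ _] := g1 _ bx; exact: h.
  move=> y cy; have [by' _] := XP _ Xm _ cy.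
  have hv := half _ _ bx nS fv.
  have vts : v \in ts.
    apply: contraT => nv; have [_ h _ _ _] := gf _ bx; move: hv; rewrite h //; lra.
  have [_ _ mD [i iD ei]] := Xm.
  have em : odd (m i) = false by case: ei => ->; rewrite ?oddM.
  have val z : ccell b eta m z -> base z i = c i + (-1) ^+ (m i == 0%N) * rho.
    move=> cz; rewrite /base /upd; case: (eqVneq i i0) => [ii|_]; first by rewrite -ii iD in i0D.
    have := cz i; rewrite em normr_le0 subr_eq0 /corner /b iD => /eqP ->.
    case: ei => ->; first by rewrite eqxx /= mulr0 expr1; lra.
    by rewrite etan (_ : (4 * n == 0)%N = false) //= expr0; ring.
  have cl : close d (base x) (base y).
    move=> j; rewrite /base /upd; case: (eqVneq j i0) => [_|ji]; first by rewrite subrr normr0.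
    have := cx j; have := cy j; case: (odd (m j)); rewrite !ler_norml => /andP[? ?] /andP[? ?];
      rewrite ltr_norml; apply/andP; split; lra.
  have := mesh i _ v _ _ iD vts bx by' (val _ cx) (val _ cy) cl.
  rewrite ltr_norml => /andP[_ h]; rewrite gt_eqF //; lra.
pose vv m := if pselect (exists v, [/\ S v, ~ S0 v &
    forall x, ccell b eta m x -> f (base x) v != 0]) is left e then Some (projT1 (cid e)) else None.
(* Top cells must end in the link of [v], while the cells between bottom and top may use the star,
   which is a cone. The default [set0] is never met on cells of [X] outside [L]. *)
pose C m : set T := if vv m is Some v then
   (if m i0 == 2%N then lk v else [set t | t = v \/ lk v t]) else set0.
have vvP m : X m -> ~ L m -> exists v, [/\ vv m = Some v, S v, ~ S0 v &
    forall x, ccell b eta m x -> f (base x) v != 0].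
  move=> Xm nL; rewrite /vv; case: pselect => [e|ne]; last by case: ne; exact: nLv.
  by case: (cid e) => /= v [Sv nS hv]; exists v.
have i0val m : X m -> ~ L m -> m i0 = 1%N \/ m i0 = 2%N.
  move=> Xm nL; have [_ mi _ _] := Xm.
  by apply: le2_cases mi _ => h; apply: nL; split=> //; left.
have inC m m' v : X m -> vv m = Some v -> S v -> ~ S0 v ->
    (forall x, ccell b eta m x -> f (base x) v != 0) -> face m' m ->
    (m i0 = 1%N \/ ty0 m') -> fct cmp (C m) (ccell b eta m') fb.
  move=> Xm ev Sv nS hv fm h.
  have sP : ccell b eta m' `<=` P by apply: subset_trans (XP _ Xm); exact: face_ccell.
  have [ts1 u1 [g1 c1]] := fct_sub (fun t => id) sP fbS.
  exists ts1 => //; split=> // x cx; have [k1 k2 k3 k4 k5] := g1 _ cx; split=> // t ft.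
  have [bx _] := sP _ cx.
  have ft' : f (base x) t != 0 by apply: sup ft.
  have fv := hv _ (face_ccell eta0 fm cx).
  have [_ _ l3 l4 _] := gf _ bx.
  have ctv := l4 _ _ ft' fv.
  rewrite /C ev; have [S0t|nS0t] := pselect (S0 t); first by case: ifP => _; [split|right].
  have tv : t = v := anti (l3 _ ft') Sv nS0t nS ctv.
  case: h => [->|h]; first by left.
  by case: nS0t; exact: h ft.
have uD0 : uniq (i0 :: D) by rewrite /= i0D.
have [g gL gX] : exists2 g, (forall m x, L m -> ccell b eta m x -> g x = fb x) &
    forall m, X m -> ~ L m -> fct cmp (C m) (ccell b eta m) g.
  apply: (@carrier_extension _ _ cmp b eta eta0 (i0 :: D) uD0 X L C fb) => //.
  - move=> m m' [Xm h] fm; split; first exact: Xface fm.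
    case: h => [h|h]; last by right => x cx; apply: h; exact: face_ccell fm _ cx.
    by left; case: (fm i0) => [->//|[]]; rewrite h.
  - move=> m Xm nL; have [v [ev Sv nS hv]] := vvP m Xm nL; rewrite /C ev.
    case: (i0val m Xm nL) => mi; rewrite mi /=.
      apply: (@cone_fills _ _ _ cmpxx cmpC _ _ v); first by left.
      by move=> t [->|[_ //]]; exact: cmpxx.
    (* On a top cell [i0] and some coordinate in [D] are fixed, so fewer than [size D] are free;
       hence links need one degree of connectivity less. *)
    apply: fl => //; apply: leq_trans sD; rewrite /dm /= mi /= add0n.
    have [_ _ _ [i iD ei]] := Xm.
    have := count_predC (fun i => odd (m i)) D.
    have : has (predC (fun i => odd (m i))) D.
      by apply/hasP; exists i => //=; case: ei => ->; rewrite ?oddM.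
    by rewrite has_count => h <-; rewrite -{1}(addn0 (count _ _)) ltn_add2l.
  - move=> m m' Xm nL fm ne [Xm' h]; have [v [ev Sv nS hv]] := vvP m Xm nL.
    apply: (@inC m m' v) => //.
    case: (i0val m Xm nL) => mi; [by left|right].
    by case: h => // h; case: (fm i0); rewrite mi h // => -[].
  - move=> m m' Xm nL fm ne nL'; have [v [ev Sv nS hv]] := vvP m Xm nL.
    have Xm' := Xface _ _ Xm fm.
    have [v' [ev' Sv' nS' hv']] := vvP m' Xm' nL'.
    (* At the centre of the smaller cell both vertices lie in the support of one point, so they are
       comparable and [anti] identifies them. *)
    have vv' : v' = v.
      pose x := corner b eta m'.
      have cx : ccell b eta m' x by move=> j; rewrite subrr normr0; case: ifP => // _; exact: ltW.
      have cx' := face_ccell eta0 fm cx.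
      have [bx _] := XP _ Xm _ cx'; have [_ _ _ l4 _] := gf _ bx.
      by apply: anti => //; apply: l4; [exact: hv'|exact: hv].
    rewrite /C ev ev' vv'.
    case: (i0val m Xm nL) => mi; rewrite mi /=; first by case: ifP => _ //= t; right.
    by case: (fm i0) => [->|[]]; rewrite mi.
have CS m : X m -> ~ L m -> C m `<=` S.
  move=> Xm nL; have [v [ev Sv nS hv]] := vvP m Xm nL; rewrite /C ev.
  by case: ifP => _ t => [[/S0S]//|[->//|[/S0S]]].
have gS : fct cmp S P g.
  apply: (@fct_glue _ _ _ _ _ _ [seq m <- s | `[< X m >]] (fun m => ccell b eta m)).
  - move=> x /cov[m Xm [cx _]]; exists m => //; rewrite mem_filter hs // andbT.
    exact/asboolP.
  - by move=> m _; exact: ccell_closed.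
  move=> m; rewrite mem_filter => /andP[/asboolP Xm _].
  have [Lm|nLm] := pselect (L m).
    apply: (fct_eq (f := fb)); last by move=> x [_ cx]; rewrite (gL m).
    by apply: fct_sub fbS => // x [].
  by apply: fct_sub (gX _ Xm nLm); [exact: CS|move=> x []].
pose Ptop := [set x | P x /\ x i0 = 2 * eta].
have gS0 : fct cmp S0 Ptop g.
  apply: (@fct_glue _ _ _ _ _ _ [seq m <- s | `[< X m /\ m i0 = 2%N >]] (fun m => ccell b eta m)).
  - move=> x [/cov[m Xm [cx hq]] xi]; exists m => //; rewrite mem_filter hs // andbT.
    by apply/asboolP; split=> //; apply: hq => //; rewrite xi mulrC.
  - by move=> m _; exact: ccell_closed.
  move=> m; rewrite mem_filter => /andP[/asboolP [Xm mi] _].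
  have [Lm|nLm] := pselect (L m).
    apply: (fct_eq (f := fb)); last by move=> x [_ cx]; rewrite (gL m).
    case: (Lm) => _ []; first by rewrite mi.
    move=> h; have [ts1 u1 [g1 c1]] := fbS; exists ts1 => //; split.
      move=> x [[Px _] cx]; have [k1 k2 k3 k4 k5] := g1 x Px; split=> // t; exact: h.
    by move=> t; apply: cts_sub (c1 t) => x [[]].
  apply: fct_sub (gX _ Xm nLm); last by move=> x [].
  have [v [ev Sv nS hv]] := vvP m Xm nLm; rewrite /C ev mi /=.
  by move=> t [].
pose h (y : nat -> R) := g (upd y i0 (2 * eta * y i0)).
have hS : fct cmp S (prism D c rho i0) h.
  apply: (@fct_subst _ _ _ _ P _ (i0 :: D) c) gS.
  - move=> x [bx /andP[x0 x1]]; split; first by rewrite /base updK.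
    by rewrite /upd eqxx mulr_ge0 //= -[leRHS]mulr1 ler_wpM2l.
  - move=> i x; rewrite inE negb_or => /andP[ii iD] [[cx _] _].
    by have := cube_off cx iD; rewrite /upd (negPf ii).
  - move=> i _; rewrite /upd; case: eqP => _; last exact: cts_coord.
    by apply: ctsM; [exact: cts_cst|exact: cts_coord].
have hS0 : fct cmp S0 (bdry D c rho) (fun x => h (upd x i0 1)).
  apply: (@fct_subst _ _ _ _ Ptop _ D (fun i => if i == i0 then 2 * eta else c i)) gS0.
  - move=> x bx; split; last by rewrite /upd eqxx mulr1.
    split; first by rewrite /base !updK -(cube_off (proj1 bx) i0D) upd_id.
    by rewrite /upd eqxx mulr1 lexx andbT mulr_ge0 // ltW.
  - move=> i x iD [cx _]; rewrite /upd; case: eqP => _; first by rewrite eqxx mulr1.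
    exact: cube_off cx iD.
  - move=> i iD; rewrite /upd; case: (eqVneq i i0) => [ii|_]; last exact: cts_coord.
    by rewrite -ii iD in i0D.
have [g0 fg0 eg0] := fl0 _ sD D c rho _ uD erefl r0 hS0.
apply: (@homotopy_fills _ _ _ S D c rho i0 h f1 g0) => //.
  exact: fct_sub fg0.
move=> x bx; rewrite /h updK /upd eqxx mulr0 -/(upd x i0 0).
have Px : P (upd x i0 0).
  split; first by rewrite /base updK -(cube_off (proj1 bx) i0D) upd_id.
  by rewrite /upd eqxx lexx mulr_ge0 // ltW.
have [m Xm [cx hq]] := cov _ Px.
have mi : m i0 = 0%N by apply: hq => //; rewrite /upd eqxx mulr0.
rewrite (gL m) //; last by split=> //; left.
by rewrite /fb /base updK -(cube_off (proj1 bx) i0D) upd_id.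
Qed.

Lemma attach_fills N :
  (forall v j, S v -> ~ S0 v -> (j < N)%N -> fills R cmp j (lk v)) ->
  (forall j, (j <= N)%N -> fills R cmp j S0) ->
  forall j, (j <= N)%N -> fills R cmp j S.
Proof.
move=> fl fl0 j jN D c rho f uD sD r0 ff.
have [f1 ff1 [sup half]] := push_off anti ff.
apply: (linear_homotopy_fills _ r0 ff ff1 sup) => //.
have sN : (size D <= N)%N by rewrite sD.
exact: (attach_pushed uD sN r0 fl fl0 ff ff1 sup half).
Qed.

End Attach.

(** * Constructible connectivity *)

Section Connectivity.
Variables (T : eqType) (cmp : rel T).
Hypotheses (cmpxx : reflexive cmp) (cmpC : symmetric cmp).

(* [con N S] certifies that the flag complex of [S] is [(N - 2)]-connected; when
   [S] is spherical, [N] is the number of elements of a maximal chain. *)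
Inductive con : nat -> set T -> Prop :=
| con_zero S : con 0 S
| con_cone N S v : S v -> (forall s, S s -> cmp s v) -> con N S
| con_attach N S0 S : S0 `<=` S ->
    (forall u v, S u -> S v -> ~ S0 u -> ~ S0 v -> cmp u v -> u = v) ->
    con N S0 -> (forall v, S v -> ~ S0 v -> con N.-1 (lk cmp S0 v)) -> con N S.

Lemma con_fills (R : realType) N S : con N S -> forall j, (j < N)%N -> fills R cmp j S.
Proof.
elim=> {N S} [//|N S v Sv hv j _|N S0 S sub anti _ IH0 _ IH j].
  exact: (cone_fills cmpxx cmpC Sv hv).
case: N IH0 IH => // N IH0 IH; rewrite ltnS => jN.
apply: (attach_fills cmpxx cmpC sub anti (N := N)) => //.
by move=> v i Sv nS iN; exact: IH.
Qed.

Lemma con_mono N N' S : (N' <= N)%N -> con N S -> con N' S.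
Proof.
move=> le h; elim: h N' le => {N S} [S|N S v Sv hv|N S0 S sub anti _ IH0 _ IH] N' le.
- by move: le; rewrite leqn0 => /eqP ->; exact: con_zero.
- exact: con_cone Sv hv.
- apply: (con_attach sub anti); first exact: IH0.
  by move=> v Sv nS; apply: IH => //; lia.
Qed.

Lemma con_inhabited N S : con N.+1 S -> exists t, S t.
Proof.
move=> h; have [n nN] : exists n, n = N.+1 by exists N.+1.
rewrite -nN in h; elim: h nN => {n S} // [n S v Sv _ _|n S0 S sub _ _ IH _ _ e].
  by exists v.
by have [v /sub] := IH e; exists v.
Qed.

Lemma con_build N (S0 S : set T) (r : T -> nat) (B : nat) : S0 `<=` S ->
  (forall u v, S u -> S v -> ~ S0 u -> ~ S0 v -> cmp u v -> r u = r v -> u = v) ->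
  (forall s, S s -> ~ S0 s -> (r s < B)%N) ->
  con N S0 ->
  (forall v, S v -> ~ S0 v ->
     con N.-1 [set s | [/\ S s, S0 s \/ (r s < r v)%N & cmp s v]]) ->
  con N S.
Proof.
move=> sub anti bd c0 hl.
suff h b : con N [set s | S s /\ (S0 s \/ (r s < b)%N)].
  have -> : S = [set s | S s /\ (S0 s \/ (r s < B)%N)]; last exact: h.
  apply/seteqP; split=> [s Ss|s []//]; split=> //.
  by have [?|nS] := pselect (S0 s); [left|right; apply: bd].
elim: b => [|b IH].
  have -> : [set s | S s /\ (S0 s \/ (r s < 0)%N)] = S0; last exact: c0.
  by apply/seteqP; split=> [s [_ []]//|s S0s]; split; [exact: sub|left].
have rb v : ~ (S v /\ (S0 v \/ (r v < b)%N)) -> S v -> ~ S0 v -> (r v < b.+1)%N -> r v = b.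
  move=> nS Sv nS0 rv; apply/eqP; rewrite eqn_leq -ltnS rv /= leqNgt; apply/negP => lt.
  by apply: nS; split=> //; right.
apply: con_attach IH _.
- by move=> s [Ss h]; split=> //; case: h => [|h]; [left|right; lia].
- move=> u v [Su hu] [Sv hv] nu nv c.
  have nSu : ~ S0 u by move=> h; apply: nu; split=> //; left.
  have nSv : ~ S0 v by move=> h; apply: nv; split=> //; left.
  have ru : r u = b by apply: (rb u nu Su nSu); case: hu.
  have rv : r v = b by apply: (rb v nv Sv nSv); case: hv.
  exact: anti Su Sv nSu nSv c (etrans ru (esym rv)).
- move=> v [Sv hv] nv.
  have nSv : ~ S0 v by move=> h; apply: nv; split=> //; left.
  have rv : r v = b by apply: (rb v nv Sv nSv); case: hv.
  have := hl v Sv nSv; rewrite rv; congr con; apply/seteqP; split=> s.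
    by move=> [].
  by move=> [[]].
Qed.

(* The elements above the vertex [v] form a cone; the remaining [x] are added from
   the top, each along [[set s | x < s]], which contracts conically to [phi x]. *)
Lemma con_conical (le : rel T) (mu : T -> nat) B N (S : set T) v (phi : T -> T) :
  reflexive le -> transitive le -> antisymmetric le ->
  (forall x y, cmp x y = le x y || le y x) ->
  (forall x y, le x y -> x != y -> (mu y < mu x)%N) ->
  (forall x, S x -> (mu x < B)%N) -> S v ->
  (forall x, S x -> [/\ S (phi x), le x (phi x) & le v (phi x)]) ->
  (forall x y, S x -> S y -> le x y -> le (phi x) (phi y)) ->
  con N S.
Proof.
move=> rl tr an cE mono; elim: B N S v => [|B IH] N S v hB Sv hphi mphi.
  by have := hB v Sv.
apply: (@con_build N [set x | S x /\ le v x] S mu B.+1).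
- by move=> x [].
- move=> x y Sx Sy _ _; rewrite cE => c e; apply/eqP; apply: contraT => ne.
  by case/orP: c => /mono; rewrite e ?ltnn => ->; rewrite // eq_sym.
- by move=> s /hB.
- by apply: (@con_cone _ _ v) => // s [_ h]; rewrite cE h orbT.
move=> x Sx nx.
have nvx : ~~ le v x by apply/negP => h; apply: nx.
have -> : [set s | [/\ S s, (S s /\ le v s) \/ (mu s < mu x)%N & cmp s x]] =
    [set s | [/\ S s, le x s & s != x]].
  apply/seteqP; split=> s /=.
    move=> [Ss h c]; have sx : s != x.
      apply/eqP => e; case: h => [[_ h]|]; last by rewrite e ltnn.
      by rewrite -e h in nvx.
    split=> //; move: c; rewrite cE => /orP[lsx|//]; case: h => [[_ h]|h].
      by rewrite (tr _ _ _ h lsx) in nvx.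
    by have := ltn_trans h (mono _ _ lsx sx); rewrite ltnn.
  move=> [Ss lxs sx]; split=> //; last by rewrite cE lxs orbT.
  by right; apply: mono; rewrite // eq_sym.
have [Sp lp vp] := hphi x Sx.
apply: (IH _ _ (phi x)).
- move=> s [Ss lxs sx]; have := hB x Sx; rewrite ltnS; apply: leq_trans.
  by apply: mono; rewrite // eq_sym.
- by split=> //; apply/eqP => e; rewrite e in vp; rewrite vp in nvx.
- move=> s [Ss lxs sx]; have [Sps lps _] := hphi s Ss; split=> //; last exact: mphi.
  split=> //; first exact: tr lps.
  apply/eqP => e; rewrite e in lps; case/eqP: sx; apply: an.
  by rewrite lps lxs.
- by move=> a c [Sa _ _] [Sc _ _]; exact: mphi.
Qed.

Variable (rk : T -> nat) (B : nat).
Hypothesis rk_bound : forall x, (rk x < B)%N.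
Hypothesis rk_cmp : forall x y, cmp x y -> rk x = rk y -> x = y.

(** A join with an arbitrary complex does not lower connectivity: when the vertices of [A] are added
    by rank, the link of each is again a join with [A']. This is the case of [con_join] where
    nothing is known about [A]. *)
Lemma con_join_any b (A A' : set T) : (forall x y, A x -> A' y -> cmp x y) ->
  con b A' -> con b (A `|` A').
Proof.
move=> cA cb.
suff gen n : forall A : set T, (forall x y, A x -> A' y -> cmp x y) ->
    (forall x, A x -> (rk x < n)%N) -> con b (A `|` A').
  by apply: (gen B) => // x _; exact: rk_bound.
elim: n => [|n IH] {cA} {}A cA rA.
  have -> : A `|` A' = A'; last by [].
  by apply/seteqP; split=> x; [case=> // /rA|right].
apply: (@con_build b A' _ rk n.+1).
- by move=> x; right.
- by move=> u v _ _ _ _; exact: rk_cmp.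
- by move=> s [/rA//|? []].
- by [].
move=> v [Av|//] nv; apply: (@con_mono b); first exact: leq_pred.
have -> : [set s | [/\ (A `|` A') s, A' s \/ (rk s < rk v)%N & cmp s v]] =
  [set s | [/\ A s, (rk s < rk v)%N & cmp s v]] `|` A'.
  apply/seteqP; split=> s /=.
    move=> [[As|As] h c]; last by right.
    by case: h => h; [right|left].
  move=> [[As h c]|As]; first by split=> //; [left|right].
  by split; [right|left|rewrite cmpC; exact: cA].
apply: IH; first by move=> x y [Ax _ _]; exact: cA.
by move=> x [_ h _]; apply: leq_trans h _; rewrite -ltnS rA.
Qed.

(** Induction on the certificate of [A]: the link of [v] in the join of [A0] and [A'] is the join of
    its link in [A0] with [A']. The bounds add up without a shift because [con N] stands for
    [N - 2]. *)
Lemma con_join a b (A A' : set T) : (forall x y, A x -> A' y -> cmp x y) ->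
  con a A -> con b A' -> con (a + b) (A `|` A').
Proof.
move=> cA ca cb; elim: ca cA => {a A} [A|N A v Av hv|N A0 A sub anti _ IH0 _ IH] cA.
- exact: con_join_any.
- apply: (@con_cone _ _ v); first by left.
  by move=> s [/hv//|As]; rewrite cmpC; exact: cA.
apply: (@con_attach _ (A0 `|` A')).
- by move=> x [/sub|]; [left|right].
- move=> u v [Au|Au] [Av|Av] nu nv; try by [case: nu; right|case: nv; right].
  by apply: anti => // h; [apply: nu|apply: nv]; left.
- by apply: IH0 => x y /sub; exact: cA.
move=> v [Av|Av] nv; last by case: nv; right.
have nA0 : ~ A0 v by move=> h; apply: nv; left.
have -> : lk cmp (A0 `|` A') v = lk cmp A0 v `|` A'.
  apply/seteqP; split=> s /=.
    by move=> [[As|As] c]; [left|right].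
  move=> [[As c]|As]; first by split=> //; left.
  by split; [right|rewrite cmpC; exact: cA].
apply: (con_mono _ (IH v Av nA0 _)); first by lia.
by move=> x y [/sub Ax _]; exact: cA.
Qed.

End Connectivity.

(** * Spheres in the realization of a poset *)

Section RowTopology.
Variable R : realType.

Lemma rv_openP n (V : set 'rV[R]_n) :
  open V <-> forall x, V x -> exists2 d, 0 < d &
    forall y : 'rV[R]_n, (forall i, `|x ord0 i - y ord0 i| < d) -> V y.
Proof.
rewrite openE; split=> h x Vx.
  have /nbhs_ballP[d /= d0 hd] := h x Vx; exists d => // y hy; apply: hd.
  by split=> // i j; rewrite (ord1 i); exact: hy.
have [d d0 hd] := h x Vx; apply/nbhs_ballP; exists d => //= y [_ hy].
by apply: hd => i; exact: hy.
Qed.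

End RowTopology.

Section Realization.
Variables (T : eqType) (le : rel T).
Hypotheses (refl_le : reflexive le) (trans_le : transitive le) (anti_le : antisymmetric le).

Definition comp : rel T := fun x y => le x y || le y x.

Lemma compxx : reflexive comp. Proof. by move=> x; rewrite /comp refl_le. Qed.
Lemma compC : symmetric comp. Proof. by move=> x y; rewrite /comp orbC. Qed.

Lemma plt_trans : transitive (plt le).
Proof.
move=> y x z /andP[xy nxy] /andP[yz nyz]; rewrite /plt (trans_le xy yz) /=.
apply: contra nxy => /eqP xz; rewrite -xz in yz.
by apply/eqP/anti_le; rewrite xy yz.
Qed.

Lemma chain_uniq (S : set T) c : is_chain le S c -> uniq c.
Proof.
move=> [sc _]; apply: sorted_uniq sc; first exact: plt_trans.
by move=> x; rewrite /plt eqxx andbF.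
Qed.

Lemma chain_comp (S : set T) c x y : is_chain le S c -> x \in c -> y \in c -> comp x y.
Proof.
move=> [sc _]; elim: c sc => // t c IH /= pc.
have ha := order_path_min plt_trans pc.
rewrite !inE => /orP[/eqP->|xc] /orP[/eqP->|yc]; first exact: compxx.
- by move/allP: ha => /(_ _ yc)/andP[h _]; rewrite /comp h.
- by move/allP: ha => /(_ _ xc)/andP[h _]; rewrite /comp h orbT.
- by apply: IH => //; exact: path_sorted pc.
Qed.

Lemma sort_chain (S : set T) c : uniq c -> (forall t, t \in c -> S t) ->
  (forall s t, s \in c -> t \in c -> comp s t) -> is_chain le S (sort le c).
Proof.
move=> u cS cc; split; last by move=> t; rewrite mem_sort; exact: cS.
have sl : sorted le (sort le c).
  apply: (@sort_sorted_in _ (mem c)) => [s t sc tc|]; first exact: cc.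
  exact/allP.
rewrite (sorted_pairwise plt_trans).
rewrite -[pairwise _ _]/(pairwise [rel x y | le x y && (x != y)] (sort le c)).
by rewrite pairwise_relI -uniq_pairwise sort_uniq u andbT -(sorted_pairwise trans_le).
Qed.

Definition supp_chain (a : T -> RR) (ts : seq T) := sort le [seq t <- ts | a t != 0].

Lemma supp_chainP (S : set T) ts a : uniq ts -> geo comp S ts a ->
  [/\ is_chain le S (supp_chain a ts), forall t, t \notin supp_chain a ts -> a t = 0,
      forall t, t \in supp_chain a ts -> a t != 0 &
      \sum_(t <- supp_chain a ts) a t = 1].
Proof.
move=> u [h1 h2 h3 h4 h5].
have nin t : t \notin supp_chain a ts -> a t = 0.
  rewrite mem_sort mem_filter negb_and negbK => /orP[/eqP//|]; exact: h2.
have uc : uniq (supp_chain a ts) by rewrite sort_uniq filter_uniq.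
split=> //.
- apply: sort_chain; first exact: filter_uniq.
    by move=> t; rewrite mem_filter => /andP[/h3].
  by move=> s t; rewrite !mem_filter => /andP[sn _] /andP[tn _]; exact: h4.
- by move=> t; rewrite mem_sort mem_filter => /andP[].
- by rewrite -h5; apply/esym/sum_wider => // t; rewrite mem_sort mem_filter => /andP[].
Qed.

Lemma geo_realization (S : set T) ts a : uniq ts -> geo comp S ts a -> realization le S a.
Proof.
move=> u g; have [h1 h2 h3 h4] := supp_chainP u g; exists (supp_chain a ts); split=> //.
by case: g.
Qed.

Lemma realization_geo (S : set T) a : realization le S a -> exists2 ts, uniq ts & geo comp S ts a.
Proof.
move=> [c [cc h1 h2 h3]]; exists c; first exact: chain_uniq cc.
have inc t : a t != 0 -> t \in c by apply: contraNT => /h1 ->.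
split=> //; first by move=> t /inc; exact: (proj2 cc).
by move=> s t /inc sc /inc; exact: chain_comp cc _.
Qed.

Lemma bary_row (c : seq T) (a : T -> RR) : uniq c -> (forall t, t \notin c -> a t = 0) ->
  bary (\row_(i < size c) a (tnth (in_tuple c) i)) = a.
Proof.
move=> u h; apply/funext => t; rewrite /bary.
rewrite (eq_bigr (fun i => a (tnth (in_tuple c) i))); last by move=> i _; rewrite mxE.
rewrite (eq_bigl (fun i => tnth (in_tuple c) i == t)); last first.
  by move=> i; rewrite (tnth_nth t).
rewrite -(big_tnth _ _ c (fun s => s == t)).
case: (boolP (t \in c)) => tc; last first.
  by rewrite h // big_seq_cond big1 // => s /andP[sc /eqP e]; rewrite e (negPf tc) in sc.
rewrite (big_rem t) //= eqxx big_seq_cond big1 ?addr0 // => s /andP[].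
by rewrite mem_rem_uniq // inE => /andP[/negPf->].
Qed.

Fixpoint subs (s : seq T) : seq (seq T) :=
  if s is x :: s' then subs s' ++ map (cons x) (subs s') else [:: [::]].

Lemma filter_subs (p : pred T) s : [seq x <- s | p x] \in subs s.
Proof.
elim: s => //= x s IH; rewrite mem_cat; case: (p x); last by rewrite IH.
by rewrite (map_f (cons x)) ?orbT.
Qed.

(** Only the finitely many chains in [ts] occur as supports. Near [x], a chain [c] missing a vertex
    of the support of [f x] is excluded by continuity of that coordinate; for any other chain, [f x]
    lies in the closed simplex of [c], where the open trace of [O] gives a radius. *)
Lemma geo_cont_into (S : set T) m (K : set 'rV[RR]_m) (f : 'rV[RR]_m -> T -> RR) ts :
  uniq ts -> (forall x, K x -> geo comp S ts (f x)) ->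
  (forall t x, K x -> forall e, 0 < e -> exists2 d, 0 < d &
    forall y, K y -> (forall i, `|x ord0 i - y ord0 i| < d) -> `|f x t - f y t| < e) ->
  cont_into le S K f.
Proof.
move=> u gf cf; split=> [x Kx|O hO]; first exact: geo_realization (gf x Kx).
have loc x : K x -> O (f x) -> exists2 d, 0 < d &
    forall y, K y -> (forall i, `|x ord0 i - y ord0 i| < d) -> O (f y).
  move=> Kx Ox.
  have [||d d0 hd] := @seq_min_pos _ _ (map (sort le) (subs ts)) (fun c d =>
      forall y, K y -> (forall i, `|x ord0 i - y ord0 i| < d) -> supp_chain (f y) ts = c -> O (f y)).
  - by move=> c d d' dd h y Ky hy; apply: h => // i; apply: lt_le_trans (hy i) dd.
  - move=> c _; have [cc|ncc] := pselect (is_chain le S c); last first.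
      by exists 1 => // y Ky _ e; case: ncc; rewrite -e; have [] := supp_chainP u (gf y Ky).
    have uc := chain_uniq cc.
    have [[t tx tc]|nex] := pselect (exists2 t, f x t != 0 & t \notin c).
      have [|d d0 hd] := cf t x Kx `|f x t|; first by rewrite normr_gt0.
      exists d => // y Ky hy e; have := hd y Ky hy.
      have [_ h _ _] := supp_chainP u (gf y Ky); rewrite h ?e // subr0 ltxx //.
    have hx t : t \notin c -> f x t = 0.
      by move=> tc; apply: contrapT => /eqP ft; apply: nex; exists t.
    have [V [oV eV]] := hO c cc.
    pose l y : 'rV[RR]_(size c) := \row_(i < size c) f y (tnth (in_tuple c) i).
    have spl y : K y -> (forall t, t \notin c -> f y t = 0) -> std_simplex (l y).
      move=> Ky hy; have [h1 h2 h3 h4 h5] := gf y Ky; split; first by move=> i; rewrite mxE.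
      rewrite -h5; under eq_bigr do rewrite mxE.
      rewrite -(big_tnth _ _ c xpredT).
      have -> : \sum_(t <- c) f y t = \sum_(t <- undup (c ++ ts)) f y t.
        by apply/esym/sum_wider; rewrite ?undup_uniq // => t tc; rewrite mem_undup mem_cat tc.
      apply: sum_wider; rewrite ?undup_uniq // => t tc.
      by rewrite mem_undup mem_cat tc orbT.
    have Vx : V (l x).
      have : (@std_simplex (size c) `&` (@bary _ c @^-1` O)) (l x).
        by split; [exact: spl|rewrite /= bary_row].
      by rewrite eV => -[].
    have [e e0 he] := (proj1 (rv_openP V)) oV _ Vx.
    have [||d d0 hd] := @seq_min_pos _ _ c (fun t d =>
      forall y, K y -> (forall i, `|x ord0 i - y ord0 i| < d) -> `|f x t - f y t| < e).
    + by move=> t d d' dd h y Ky hy; apply: h => // i; apply: lt_le_trans (hy i) dd.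
    + by move=> t _; exact: cf.
    exists d => // y Ky hy ec.
    have hy' t : t \notin c -> f y t = 0.
      by have [_ h _ _] := supp_chainP u (gf y Ky); rewrite -ec; exact: h.
    have Vy : V (l y) by apply: he => i; rewrite !mxE; apply: hd => //; exact: mem_tnth.
    have : (@std_simplex (size c) `&` V) (l y) by split=> //; exact: spl.
    by rewrite -eV => -[_]; rewrite /= bary_row.
  exists d => // y Ky hy; apply: hd hy _ => //.
  by apply: map_f; exact: filter_subs.
exists [set y | exists x d, [/\ K x, 0 < d, (forall i, `|x ord0 i - y ord0 i| < d) &
    forall z, K z -> (forall i, `|x ord0 i - z ord0 i| < d) -> O (f z)]]; split.
  apply/rv_openP => y [x [d [Kx d0 xy hd]]].
  have [||e e0 he] := @seq_min_pos _ _ (enum 'I_m) (fun i e => `|x ord0 i - y ord0 i| + e <= d).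
  - by move=> i a b ba h; lra.
  - by move=> i _; exists (d - `|x ord0 i - y ord0 i|); [rewrite subr_gt0|lra].
  exists e => // z yz; exists x, d; split=> // i.
  have := he i (mem_enum _ _); have := yz i.
  have := ler_normD (x ord0 i - y ord0 i) (y ord0 i - z ord0 i); rewrite addrA subrK; lra.
apply/seteqP; split=> y [Ky h]; split=> //=.
  have [d d0 hd] := loc y Ky h; exists y, d; split=> // i.
  by rewrite subrr normr0.
by case: h => x [d [Kx d0 xy hd]]; apply: hd.
Qed.

End Realization.

Section Embedding.
Variable R : realType.

Definition emb n (l : 'rV[R]_n) : nat -> R := fun i => if insub i is Some k then l ord0 k else 0.

Lemma emb_ord n (l : 'rV[R]_n) (i : 'I_n) : emb l i = l ord0 i.
Proof. by rewrite /emb valK. Qed.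

Lemma emb_out n (l : 'rV[R]_n) i : (n <= i)%N -> emb l i = 0.
Proof. by move=> h; rewrite /emb insubF // ltnNge h. Qed.

Lemma emb_close n (l l' : 'rV[R]_n) d : 0 < d ->
  (forall i, `|l ord0 i - l' ord0 i| < d) -> close d (emb l) (emb l').
Proof.
move=> d0 h i; rewrite /emb; case: insubP => [k _ _|_]; first exact: h.
by rewrite subrr normr0.
Qed.

End Embedding.

(** * Maps from compact sets into the realization *)

Section Spheres.
Variables (T : eqType) (le : rel T).
Hypotheses (refl_le : reflexive le) (trans_le : transitive le) (anti_le : antisymmetric le).
Let comp := comp le.

Lemma bary_cts (c : seq T) (t : T) (l : 'rV[RR]_(size c)) (e : RR) : 0 < e ->
  exists2 d, 0 < d & forall l' : 'rV[RR]_(size c), (forall i, `|l ord0 i - l' ord0 i| < d) ->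
    `|@bary _ c l t - @bary _ c l' t| < e.
Proof.
move=> e0; pose phi (x : nat -> RR) := \sum_(i < size c | nth t c i == t) x i.
have cphi : cts setT phi by apply: cts_sum => k; exact: cts_coord.
have ephi (l' : 'rV[RR]_(size c)) : @bary _ c l' t = phi (emb l').
  by rewrite /bary /phi; apply: eq_bigr => i _; rewrite emb_ord.
have [d d0 hd] := cphi (emb l) I e e0.
exists d => // l' hl; rewrite !ephi; apply: hd => //.
exact: emb_close.
Qed.

Lemma bary_open_dist (c : seq T) (t : T) (a e : RR) :
  open [set l : 'rV[RR]_(size c) | `|a - @bary _ c l t| < e].
Proof.
apply/rv_openP => l /= hl.
have [|d d0 hd] := @bary_cts c t l (e - `|a - @bary _ c l t|); first by rewrite subr_gt0.
exists d => // l' /hd h.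
have := ler_normD (a - @bary _ c l t) (@bary _ c l t - @bary _ c l' t); rewrite addrA subrK.
by move=> h'; apply: le_lt_trans h' _; rewrite -ltrBrDl.
Qed.

Lemma bary_open_ne (c : seq T) (t : T) (a : RR) :
  open [set l : 'rV[RR]_(size c) | @bary _ c l t <> a].
Proof.
apply/rv_openP => l /= hl.
have [|d d0 hd] := @bary_cts c t l (`|@bary _ c l t - a|).
  by rewrite normr_gt0 subr_eq0; exact/eqP.
by exists d => // l' /hd h e; move: h; rewrite e ltxx.
Qed.

Lemma cont_into_coord (S : set T) m (K : set 'rV[RR]_m) f : cont_into le S K f ->
  forall t x, K x -> forall e, 0 < e -> exists2 d, 0 < d &
    forall y, K y -> (forall i, `|x ord0 i - y ord0 i| < d) -> `|f x t - f y t| < e.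
Proof.
move=> [_ hf] t x Kx e e0.
have [|V [oV eV]] := hf [set a | `|f x t - a t| < e].
  by move=> c _; eexists; split; [exact: (@bary_open_dist c t (f x t) e)|].
have Vx : V x.
  have : (K `&` f @^-1` [set a | `|f x t - a t| < e]) x by split=> //=; rewrite subrr normr0.
  by rewrite eV => -[].
have [d d0 hd] := (proj1 (rv_openP V)) oV x Vx.
exists d => // y Ky hy.
have : (K `&` V) y by split=> //; exact: hd.
by rewrite -eV => -[].
Qed.

(* If infinitely many vertices were needed, points [x n] of [K] could be chosen such
   that [f (x n)] involves a vertex [t n] used by no earlier [f (x i)]; every subset
   of the [f (x n)] is then closed, against the compactness of [K]. *)
Lemma compact_support (S : set T) m (K : set 'rV[RR]_m) f : compact K -> cont_into le S K f ->
  exists2 ts, uniq ts & forall x, K x -> geo comp S ts (f x).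
Proof.
move=> cK [rf hf].
suff [ts hts] : exists ts : seq T, forall x t, K x -> f x t != 0 -> t \in ts.
  exists (undup ts); first exact: undup_uniq.
  move=> x Kx; have [ts' u' g] := realization_geo refl_le trans_le anti_le (rf x Kx).
  have [h1 h2 h3 h4 h5] := g.
  have z t : t \notin undup ts -> f x t = 0.
    by rewrite mem_undup => nt; apply: contrapT => /eqP /(hts x t Kx); exact/negP.
  split=> //; rewrite -h5.
  have -> : \sum_(t <- undup ts) f x t = \sum_(t <- undup (ts ++ ts')) f x t.
    apply/esym/sum_wider => //; rewrite ?undup_uniq // => t.
    by rewrite !mem_undup mem_cat => ->.
  by apply: sum_wider; rewrite ?undup_uniq // => t tin; rewrite mem_undup mem_cat tin orbT.
apply: contrapT => nts.
have pick (ts : seq T) : exists p : 'rV[RR]_m * T, [/\ K p.1, f p.1 p.2 != 0 & p.2 \notin ts].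
  apply: contrapT => nex; apply: nts; exists ts => x t Kx ft; apply: contrapT => /negP nt.
  by apply: nex; exists (x, t).
have /choice[p hp] := pick.
have /choice[su hsu] : forall x, exists c : seq T, K x -> forall t, f x t != 0 -> t \in c.
  move=> x; have [Kx|nKx] := pselect (K x); last by exists [::].
  have [c _ [_ h _ _ _]] := realization_geo refl_le trans_le anti_le (rf x Kx).
  by exists c => _ t; apply: contraNT => /h ->.
pose tss n := iter n (fun ts => ts ++ su (p ts).1) [::].
pose x n := (p (tss n)).1; pose t n := (p (tss n)).2.
have Kx n : K (x n) by have [] := hp (tss n).
have ft n : f (x n) (t n) != 0 by have [] := hp (tss n).
have tn n : t n \notin tss n by have [] := hp (tss n).
have tsm i n : (i <= n)%N -> {subset tss i <= tss n}.
  elim: n => [|n IH]; first by rewrite leqn0 => /eqP ->.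
  rewrite leq_eqVlt => /orP[/eqP-> //|]; rewrite ltnS => /IH h s /h sin.
  by rewrite /tss iterS mem_cat -/(tss n) sin.
have old i n s : (i < n)%N -> f (x i) s != 0 -> s \in tss n.
  move=> lt fs; apply: (tsm i.+1) => //; rewrite /tss iterS mem_cat -/(tss i).
  by rewrite (hsu _ (Kx i)) ?orbT.
(* The complement of the tail of the sequence. A vertex is [t i] for at most one [i], so a simplex
   contains finitely many points of the tail, and [O j] is open. These sets cover, as the [f (x i)]
   are distinct; compactness gives one [J] for all of [K], contradicted by [x J]. *)
pose O j : set (T -> RR) := [set a | forall i, (j <= i)%N -> a <> f (x i)].
have oO j : coh_open le S (O j).
  move=> c _; exists (~` (\bigcup_(i in [set i | (j <= i)%N /\ t i \in c])
    [set l : 'rV[RR]_(size c) | @bary _ c l = f (x i)])); split; last first.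
    apply/seteqP; split=> l [sl h]; split=> //.
      by move=> [i [ji _] /= e]; apply: (h i).
    move=> i ji e; apply: h; exists i => //=; split=> //.
    apply: contraT => nt; have := ft i; rewrite -e /bary big1 ?eqxx // => k /eqP ek.
    by move: nt; rewrite -{1}ek mem_nth.
  apply: closed_openC; apply: closed_bigcup.
    have [M hM] : exists M, forall i, t i \in c -> (i < M)%N.
      elim: (c) => [|s c' [M hM]]; first by exists 0%N.
      have [[i ei]|nei] := pselect (exists i, t i = s); last first.
        by exists M => k; rewrite inE => /orP[/eqP e|/hM//]; case: nei; exists k.
      exists (maxn M i.+1) => k; rewrite inE => /orP[/eqP e|/hM h]; last by rewrite leq_max h.
      have -> : k = i; last by rewrite leq_max ltnSn orbT.
      have [lt|lt|//] := ltngtP k i.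
        by have := tn i; rewrite ei -e (old k i).
      by have := tn k; rewrite e -ei (old i k).
    by apply: (@sub_finite_set _ _ `I_M) (finite_II M) => i [_ /hM].
  move=> i _.
  have -> : [set l : 'rV[RR]_(size c) | @bary _ c l = f (x i)] =
      \bigcap_(s in setT) ~` [set l : 'rV[RR]_(size c) | @bary _ c l s <> f (x i) s].
    apply/seteqP; split=> l /=; first by move=> e s _ /=; rewrite e; apply.
    by move=> h; apply/funext => s; apply: contrapT; exact: h s I.
  by apply: closed_bigI => s _; apply: open_closedC; exact: bary_open_ne.
have [V hV] : exists V : nat -> set 'rV[RR]_m, forall j, open (V j) /\ K `&` f @^-1` O j = K `&` V j.
  by have /choice[V hV] := fun j => hf _ (oO j); exists V.
have := (proj1 (compact_near_coveringP K)) cK nat (\oo) (fun j y => K y -> O j (f y)) _.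
case.
- move=> y Ky.
  have [j Oj] : exists j, O j (f y).
    apply: contrapT => nO.
    have [i [_ ei]] : exists i, (0 <= i)%N /\ f y = f (x i).
      apply: contrapT => nex; apply: nO; exists 0%N => i _ e; apply: nex; by exists i.
    have [k [ik ek]] : exists k, (i < k)%N /\ f y = f (x k).
      apply: contrapT => nex; apply: nO; exists i.+1 => k ik e; apply: nex; by exists k.
    by have := tn k; rewrite (old i k) // -ei ek.
  have Vy : V j y.
    have : (K `&` f @^-1` O j) y by [].
    by rewrite (proj2 (hV j)) => -[].
  exists (V j, [set k | (j <= k)%N]).
    split=> /=; first by apply: open_nbhs_nbhs; split=> //; exact: (proj1 (hV j)).
    by exists j => // k /=.
  move=> [z k] /= [Vz jk] Kz i ki.
  have : (K `&` V j) z by [].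
  by rewrite -(proj2 (hV j)) => -[_]; apply; exact: leq_trans jk ki.
move=> J _ hJ; have := hJ J (leqnn J) (x J) (Kx J) (Kx J) J (leqnn J).
exact.
Qed.

End Spheres.

(** * Radial comparison of balls and cubes *)

Section BallCube.
Variable R : realType.

Definition sqnorm n (x : nat -> R) := \sum_(i < n) x i ^+ 2.

Lemma sqnorm_cts (X : set (nat -> R)) n : cts X (sqnorm n).
Proof. by apply: cts_sum => k; apply: ctsM; exact: cts_coord. Qed.

Lemma sqnorm_ge0 n (x : nat -> R) : 0 <= sqnorm n x.
Proof. by apply: sumr_ge0 => i _; exact: sqr_ge0. Qed.

Lemma sqnorm_ge n (x : nat -> R) i : (i < n)%N -> x i ^+ 2 <= sqnorm n x.
Proof.
move=> lt; rewrite /sqnorm (bigD1 (Ordinal lt)) //= lerDl.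
by apply: sumr_ge0 => j _; exact: sqr_ge0.
Qed.

Lemma sqrt_cts X (phi : (nat -> R) -> R) : (forall x, X x -> 0 <= phi x) -> cts X phi ->
  cts X (fun x => Num.sqrt (phi x)).
Proof.
move=> p0 h x Xx e e0.
have [|d d0 hd] := h x Xx (e ^+ 2); first by rewrite exprn_gt0.
exists d => // y Xy c; have := hd y Xy c.
have a0 := p0 x Xx; have b0 := p0 y Xy.
rewrite -{1}(sqr_sqrtr a0) -{1}(sqr_sqrtr b0).
have := sqrtr_ge0 (phi x); have := sqrtr_ge0 (phi y).
move: (Num.sqrt (phi x)) (Num.sqrt (phi y)) => a b ha hb.
rewrite !ltr_norml => /andP[h1 h2]; apply/andP; split; rewrite ltNge; apply/negP => h3; nra.
Qed.

Definition nrm2 n (x : nat -> R) := Num.sqrt (sqnorm n x).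

Lemma nrm2_cts (X : set (nat -> R)) n : cts X (nrm2 n).
Proof. by apply: sqrt_cts => [x _|]; [exact: sqnorm_ge0|exact: sqnorm_cts]. Qed.

Lemma nrm2_ge n (x : nat -> R) i : (i < n)%N -> `|x i| <= nrm2 n x.
Proof. by move=> lt; rewrite -sqrtr_sqr ler_sqrt ?sqnorm_ge0 // sqnorm_ge. Qed.

Lemma sqnormZ n (x : nat -> R) (a : R) : sqnorm n (fun i => a * x i) = a ^+ 2 * sqnorm n x.
Proof. by rewrite mulr_sumr; apply: eq_bigr => i _; rewrite exprMn. Qed.

Let zero : nat -> R := fun=> 0.

(* Radial rescaling turning the Euclidean norm into the sup norm; it vanishes at the
   origin since [x / 0 = 0]. *)
Definition squash n (x : nat -> R) i : R := x i * (nrm2 n x / nrm (iota 0 n) zero x).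

Lemma squash_le n (x : nat -> R) i : (i < n)%N -> `|squash n x i| <= nrm2 n x.
Proof.
move=> lt; rewrite /squash normrM (ger0_norm (divr_ge0 (sqrtr_ge0 _) (nrm_ge0 _ _ _))).
have := @nrm_ge _ (iota 0 n) zero x i; rewrite mem_iota /= add0n lt => /(_ isT).
rewrite /zero subr0 => h; have := nrm_ge0 (iota 0 n) zero x; rewrite le_eqVlt => /orP[/eqP e|p].
  by rewrite -e invr0 !mulr0 sqrtr_ge0.
by rewrite mulrA ler_pdivrMr // mulrC ler_wpM2l // sqrtr_ge0.
Qed.

Lemma squash_cts (X : set (nat -> R)) n i : (i < n)%N -> cts X (fun x => squash n x i).
Proof.
move=> lt x Xx e e0.
have [n0|n0] := eqVneq (nrm (iota 0 n) zero x) 0; last first.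
  pose U : set (nat -> R) := [set y | nrm (iota 0 n) zero y != 0].
  have hU : cts (X `&` U) (fun x => squash n x i).
    apply: ctsM; first exact: cts_coord.
    apply: ctsM; first exact: nrm2_cts.
    by apply: ctsV; [move=> y []|exact: nrm_cts].
  have [d d0 hd] := hU x (conj Xx n0) e e0.
  have [|d' d'0 hd'] := @nrm_cts _ X (iota 0 n) zero x Xx (nrm (iota 0 n) zero x).
    by rewrite lt_neqAle eq_sym n0 nrm_ge0.
  exists (Num.min d d'); first by rewrite lt_min d0.
  move=> y Xy cl; apply: hd; last by apply: close_le cl; rewrite ge_min lexx.
  split=> //; apply/eqP => ny.
  have := hd' y Xy; rewrite ny subr0 ger0_norm ?nrm_ge0 // ltxx => h.
  by suff : false by []; apply: h; apply: close_le cl; rewrite ge_min lexx orbT.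
have xz j : (j < n)%N -> x j = 0.
  move=> jn; have := @nrm_ge _ (iota 0 n) zero x j.
  rewrite mem_iota /= add0n jn n0 /zero subr0 => /(_ isT).
  by rewrite normr_le0 => /eqP.
have z2 : nrm2 n x = 0.
  by rewrite /nrm2 /sqnorm big1 ?sqrtr0 // => j _; rewrite xz // expr0n.
have [d d0 hd] := @nrm2_cts X n x Xx e e0.
exists d => // y Xy cl; have := hd y Xy cl.
rewrite z2 sub0r normrN (ger0_norm (sqrtr_ge0 _)) => h.
rewrite {1}/squash xz // mul0r sub0r normrN; apply: le_lt_trans h.
exact: squash_le.
Qed.

Lemma emb_sqnorm n (v : 'rV[R]_n) : sqnorm n (emb v) = \sum_(i < n) v ord0 i ^+ 2.
Proof. by apply: eq_bigr => i _; rewrite emb_ord. Qed.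

Lemma unit_sphere_compact n : compact [set v : 'rV[R]_n | \sum_(i < n) v ord0 i ^+ 2 = 1].
Proof.
apply: bounded_closed_compact.
  exists 1; split; first exact: real1.
  move=> r r1 v /= hv; rewrite [leLHS]/Num.norm /= mx_normrE; apply/bigmax_leP; split=> /=.
    by apply: ltW; apply: lt_trans r1.
  move=> [j i] _ /=; rewrite (ord1 j); apply: le_trans (ltW r1).
  rewrite -(emb_ord v); apply: le_trans (nrm2_ge _ (ltn_ord i)) _.
  by rewrite /nrm2 emb_sqnorm hv sqrtr1.
rewrite -[X in closed X]setCK; apply: open_closedC; apply/rv_openP => v /= hv.
have e0 : 0 < `|sqnorm n (emb v) - 1|.
  by rewrite normr_gt0 subr_eq0 emb_sqnorm; exact/eqP.
have [d d0 hd] := @sqnorm_cts setT n (emb v) I _ e0.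
exists d => // w vw e; have := hd (emb w) I (emb_close d0 vw).
by rewrite (emb_sqnorm w) e ltxx.
Qed.

End BallCube.

Section KConnected.
Variables (T : eqType) (le : rel T).
Hypotheses (refl_le : reflexive le) (trans_le : transitive le) (anti_le : antisymmetric le).

Lemma sphere_compact n : compact (@sphere n).
Proof. exact: (@unit_sphere_compact (RR : realType) n.+1). Qed.

(** Radial projections identify the sphere with the boundary of the cube: [row] divides by the
    Euclidean norm and [squash] goes back. Compactness of the sphere supplies the finite vertex list
    which [fct] asks for. *)
Lemma fills_sphere (S : set T) n : fills (RR : realType) (comp le) n.+1 S ->
  forall f, cont_into le S (@sphere n) f ->
  exists g, cont_into le S (@ball_closed n) g /\ (forall x, sphere x -> g x = f x).
Proof.
move=> fl f cf.
have [ts uts gf] := compact_support refl_le trans_le anti_le (@sphere_compact n) cf.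
have cc := cont_into_coord cf.
pose D := iota 0 n.+1; pose z : nat -> RR := fun=> 0.
pose row (x : nat -> RR) : 'rV[RR]_n.+1 := \row_i (x i / nrm2 n.+1 x).
have n2 x : bdry D z 1 x -> 0 < nrm2 n.+1 x.
  move=> [_ [i iD e]]; apply: lt_le_trans (nrm2_ge _ (_ : i < n.+1)%N).
    by rewrite -[x i]subr0 e ltr01.
  by move: iD; rewrite mem_iota.
have rs x : bdry D z 1 x -> sphere (row x).
  move=> /n2 h; rewrite /sphere /=.
  have -> : \sum_(i < n.+1) row x ord0 i ^+ 2 = sqnorm n.+1 (fun i => (nrm2 n.+1 x)^-1 * x i).
    by apply: eq_bigr => i _; rewrite mxE mulrC.
  rewrite sqnormZ -[X in _ * X](sqr_sqrtr (sqnorm_ge0 _ _)) -/(nrm2 n.+1 x) -exprMn.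
  by rewrite mulVf ?expr1n // gt_eqF.
have ff : fct (comp le) S (bdry D z 1) (fun x => f (row x)).
  exists ts => //; split=> [x /rs/gf//|t x bx e e0].
  have [d d0 hd] := cc t (row x) (rs _ bx) e e0.
  have [||d' d'0 hd'] := @seq_min_pos _ _ (enum 'I_n.+1) (fun i d' => forall y,
      bdry D z 1 y -> close d' x y -> `|row x ord0 i - row y ord0 i| < d).
  - by move=> i a b ba h y by' cl; apply: h => //; exact: close_le cl.
  - move=> i _; have := _ : cts (bdry D z 1) (fun x => x i / nrm2 n.+1 x).
    move=> /(_ _ x bx d d0)[|d' d'0 hd'].
      apply: ctsM; first exact: cts_coord.
      by apply: ctsV; [move=> y /n2 h; rewrite gt_eqF|exact: nrm2_cts].
    by exists d' => // y by' cl; rewrite !mxE; exact: hd'.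
  exists d' => // y by' cl; apply: hd => //; first exact: rs.
  by move=> i; apply: hd' => //; rewrite mem_enum.
have [g [ts' uts' [gg cg]] gb] := fl D z 1 _ (iota_uniq _ _) (size_iota _ _) ltr01 ff.
pose G (v : 'rV[RR]_n.+1) := g (squash n.+1 (emb v)).
have sq (v : 'rV[RR]_n.+1) : ball_closed v -> cube D z 1 (squash n.+1 (emb v)).
  move=> bv i; rewrite /z subr0 mem_iota /= add0n; case: ltnP => h.
    apply: le_trans (squash_le _ h) _; by rewrite /nrm2 emb_sqnorm -[leRHS]sqrtr1 ler_sqrt ?ler01.
  by rewrite /squash emb_out // mul0r normr0.
exists G; split; last first.
  move=> v sv.
  have nv : nrm2 n.+1 (emb v) = 1 by rewrite /nrm2 emb_sqnorm sv sqrtr1.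
  have ni : 0 < nrm D z (emb v).
    rewrite lt_neqAle eq_sym nrm_ge0 andbT; apply/eqP => n0.
    have : sqnorm n.+1 (emb v) = 0.
      apply: big1 => i _; have := @nrm_ge _ D z (emb v) i.
      rewrite mem_iota /= add0n ltn_ord n0 /z subr0 => /(_ isT).
      by rewrite normr_le0 => /eqP ->; rewrite expr0n.
    by rewrite emb_sqnorm sv => /eqP; rewrite oner_eq0.
  have es : squash n.+1 (emb v) = fun i => (nrm D z (emb v))^-1 * emb v i.
    by apply/funext => i; rewrite /squash nv mul1r mulrC.
  have bs : bdry D z 1 (squash n.+1 (emb v)).
    split.
      apply: sq; rewrite /ball_closed /=; by rewrite sv.
    have [i iD e] := nrm_attained ni; exists i => //.
    move: e; rewrite /z !subr0 es normrM normfV (gtr0_norm ni) => ->.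
    by rewrite mulVf // gt_eqF.
  rewrite /G gb //; congr f; apply/rowP => i; rewrite mxE es emb_ord /nrm2 sqnormZ.
  rewrite sqrtrM ?sqr_ge0 // -/(nrm2 n.+1 (emb v)) nv mulr1 sqrtr_sqr gtr0_norm ?invr_gt0 //.
  by rewrite mulrAC divff ?mul1r // invr_eq0 gt_eqF.
apply: (geo_cont_into trans_le anti_le uts').
  by move=> v /sq/gg.
move=> t v bv e e0.
pose Y : set (nat -> RR) := [set x | exists2 w : 'rV[RR]_n.+1, ball_closed w & x = emb w].
have cY : cts Y (fun x => g (squash n.+1 x) t).
  apply: (@cts_subst _ (cube D z 1) _ D z) (cg t).
  - by move=> _ [w bw ->]; exact: sq.
  - move=> i _ iD [w bw ->]; rewrite /squash emb_out ?mul0r //.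
    by move: iD; rewrite mem_iota /= add0n -leqNgt.
  - by move=> i; rewrite mem_iota /= add0n => h; exact: squash_cts.
have [|d d0 hd] := cY (emb v) _ e e0; first by exists v.
by exists d => // w bw vw; apply: hd; [exists w|exact: emb_close].
Qed.

Lemma con_k_connected N (S : set T) : con (comp le) N S -> k_connected le S (N%:Z - 2).
Proof.
move=> cN.
have fl j : (j < N)%N -> fills (RR : realType) (comp le) j S.
  exact: (@con_fills _ _ (compxx refl_le) (@compC _ le) _ _ _ cN).
split=> [hN|n hn f cf]; last by apply: fills_sphere cf; apply: fl; lia.
(* The boundary of the 0-cube is empty, so any function will do; filling it yields a point. *)
have f0 : fct (comp le) S (bdry [::] (fun=> 0) (1 : RR)) (fun _ _ => 0).
  by exists [::] => //; split=> [x [_ []]|t x [_ []]].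
have N0 : (0 < N)%N by lia.
have [g [ts u [gg _]] _] := fl _ N0 [::] (fun=> 0) 1 _ isT erefl ltr01 f0.
exists (g (fun=> 0)); apply: (geo_realization trans_le anti_le u (S := S)).
by apply: gg => i; rewrite subrr normr0.
Qed.

End KConnected.

(** * Posets of subspaces *)

Section Subspaces.
Variables (F : fieldType) (E : vectType F).
Implicit Types (A K L V W X Y : {vspace E}) (S : set {vspace E}).

Let le := @vsub_le F E.
Definition scon := con (comp le).

Lemma vle_refl : reflexive le. Proof. exact: subvv. Qed.
Lemma vle_trans : transitive le. Proof. exact: subv_trans. Qed.
Lemma vle_anti : antisymmetric le. Proof. exact: subv_anti. Qed.

Lemma plt_dim W V : plt le W V -> (\dim W < \dim V)%N.
Proof.
move=> /andP[WV ne]; rewrite ltn_neqAle dimvS // andbT; apply: contra ne => /eqP e.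
by rewrite eqEdim [(_ <= _)%VS]WV e /=.
Qed.

Lemma dim_cmp W V : comp le W V -> \dim W = \dim V -> W = V.
Proof.
by move=> /orP[] h e; apply/eqP; [|rewrite eq_sym]; rewrite eqEdim [(_ <= _)%VS]h e /=.
Qed.

Lemma conical_up N S V (phi : {vspace E} -> {vspace E}) : S V ->
  (forall W, S W -> [/\ S (phi W), (W <= phi W)%VS & (V <= phi W)%VS]) ->
  (forall W W', S W -> S W' -> (W <= W')%VS -> (phi W <= phi W')%VS) -> scon N S.
Proof.
move=> SV h m.
apply: (@con_conical _ _ le (fun W => \dim {:E} - \dim W)%N (\dim {:E}).+1 N S V phi) => //.
- exact: vle_refl.
- exact: vle_trans.
- exact: vle_anti.
- move=> W W' l ne; have := @plt_dim W W'; rewrite /plt l ne => /(_ isT).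
  by have := dimvS (subvf W'); lia.
- by move=> W _; lia.
Qed.

Lemma conical_down N S V (phi : {vspace E} -> {vspace E}) : S V ->
  (forall W, S W -> [/\ S (phi W), (phi W <= W)%VS & (phi W <= V)%VS]) ->
  (forall W W', S W -> S W' -> (W <= W')%VS -> (phi W <= phi W')%VS) -> scon N S.
Proof.
move=> SV h m.
apply: (@con_conical _ _ (fun W W' => le W' W) (fun W => \dim W) (\dim {:E}).+1 N S V phi) => //.
- exact: vle_refl.
- by move=> W1 W2 W3 a b; exact: vle_trans b a.
- by move=> W W' /andP[a b]; apply: vle_anti; rewrite a b.
- by move=> W W'; rewrite /comp orbC.
- by move=> W W' l ne; apply: plt_dim; rewrite /plt l eq_sym.
- by move=> W _; rewrite ltnS dimvS ?subvf.
- by move=> W W' SW SW' l; exact: m.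
Qed.

Lemma scon_min N S V : S V -> (forall W, S W -> (V <= W)%VS) -> scon N S.
Proof.
by move=> SV h; apply: (con_cone _ SV) => W /h l; rewrite /comp /le /vsub_le l orbT.
Qed.

Lemma scon_join a b S S' : (forall W W', S W -> S' W' -> (W <= W')%VS) ->
  scon a S -> scon b S' -> scon (a + b) (S `|` S').
Proof.
move=> h; apply: (@con_join _ (comp le) (@compC _ le) (fun W => \dim W) (\dim {:E}).+1).
- by move=> W; rewrite ltnS dimvS ?subvf.
- exact: dim_cmp.
- by move=> W W' SW SW'; rewrite /comp [le _ _]h.
Qed.

(** When [V] is attached by increasing dimension, all of [S] below [V] is already present, but above
    [V] only [S0]; the link is the join of these two parts. *)
Lemma scon_inc N S0 S : S0 `<=` S -> scon N S0 ->
  (forall V, S V -> ~ S0 V -> exists a b, [/\ (N.-1 <= a + b)%N,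
     scon a [set W | S W /\ plt le W V] & scon b [set W | S0 W /\ plt le V W]]) ->
  scon N S.
Proof.
move=> sub c0 h; apply: (@con_build _ _ N S0 S (fun W => \dim W) (\dim {:E}).+1) => //.
- by move=> W W' _ _ _ _; exact: dim_cmp.
- by move=> W _ _; rewrite ltnS dimvS ?subvf.
move=> V SV nV; have [a [b [ab ca cb]]] := h V SV nV.
apply: (con_mono ab).
have -> : [set W | [/\ S W, S0 W \/ (\dim W < \dim V)%N & comp le W V]] =
   [set W | S W /\ plt le W V] `|` [set W | S0 W /\ plt le V W].
  apply/seteqP; split=> W /=.
    move=> [SW hW c]; have ne : W != V.
      by apply/eqP => e; case: hW; rewrite e ?ltnn.
    case/orP: c => l; first by left; split=> //; rewrite /plt l ne.
    have VW : plt le V W by rewrite /plt l eq_sym ne.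
    right; split=> //; case: hW => // lt.
    by have := plt_dim VW; lia.
  move=> [[SW l]|[SW l]].
    by split=> //; [right; exact: plt_dim|rewrite /comp; case/andP: l => ->].
  by split; [exact: sub|left|rewrite /comp; case/andP: l => ->; rewrite orbT].
apply: scon_join ca cb => W W' [_ /andP[l _]] [_ /andP[l' _]].
exact: subv_trans l l'.
Qed.

(** The dual order: all of [S] above [V] is present, and below it only [S0]. The order of attachment
    decides on which side of the link the restriction to [S0] falls. *)
Lemma scon_dec N S0 S : S0 `<=` S -> scon N S0 ->
  (forall V, S V -> ~ S0 V -> exists a b, [/\ (N.-1 <= a + b)%N,
     scon a [set W | S0 W /\ plt le W V] & scon b [set W | S W /\ plt le V W]]) ->
  scon N S.
Proof.
move=> sub c0 h.
apply: (@con_build _ _ N S0 S (fun W => \dim {:E} - \dim W)%N (\dim {:E}).+1) => //.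
- move=> W W' _ _ _ _ c e; apply: (dim_cmp c).
  by have := dimvS (subvf W); have := dimvS (subvf W'); lia.
- by move=> W _ _; lia.
move=> V SV nV; have [a [b [ab ca cb]]] := h V SV nV.
apply: (con_mono ab).
have -> : [set W | [/\ S W, S0 W \/ (\dim {:E} - \dim W < \dim {:E} - \dim V)%N & comp le W V]] =
   [set W | S0 W /\ plt le W V] `|` [set W | S W /\ plt le V W].
  apply/seteqP; split=> W /=.
    move=> [SW hW c]; have ne : W != V.
      by apply/eqP => e; case: hW; rewrite e ?ltnn.
    case/orP: c => l; last by right; split=> //; rewrite /plt l eq_sym ne.
    have VW : plt le W V by rewrite /plt l ne.
    left; split=> //; case: hW => // lt.
    by have := plt_dim VW; lia.
  move=> [[SW l]|[SW l]].
    by split; [exact: sub|left|rewrite /comp; case/andP: l => ->].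
  split=> //; last by rewrite /comp; case/andP: l => ->; rewrite orbT.
  by right; have := plt_dim l; have := dimvS (subvf W); lia.
apply: scon_join ca cb => W W' [_ /andP[l _]] [_ /andP[l' _]].
exact: subv_trans l l'.
Qed.

Lemma hyperplane_avoid1 A V y : (A <= V)%VS -> y \in V -> y \notin A ->
  exists H, [/\ (A <= H)%VS, (H <= V)%VS, y \notin H & (H + <[y]>)%VS = V].
Proof.
move=> AV yV yA; pose C := (V :\: (A + <[y]>))%VS.
have AyV : (A + <[y]> <= V)%VS by rewrite subv_add AV -memvE.
exists (A + C)%VS; split.
- exact: addvSl.
- by rewrite subv_add AV diffvSl.
- apply/negP => /memv_addP[a aA [c cC e]]; case/negP: yA.
  have : c \in (C :&: (A + <[y]>))%VS.
    rewrite memv_cap cC /= -[c](addKr a) -e.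
    by apply: memv_add; [rewrite memvN|exact: memv_line].
  by rewrite capv_diff memv0 => /eqP c0; rewrite e c0 addr0.
- rewrite -addvA (addvC C) addvA addvC addv_diff.
  exact/addv_idPl.
Qed.

Lemma hyperplane_any H V y k : (H <= V)%VS -> (H + <[y]>)%VS = V -> k \in V -> k \notin H ->
  (H + <[k]>)%VS = V.
Proof.
move=> HV e kV kH; apply/eqP; rewrite eqEsubv subv_add HV -memvE kV /= -e subv_add addvSl /= -memvE.
move: kV; rewrite -e => /memv_addP[h hH [_ /vlineP[c ->] ek]].
have c0 : c != 0 by apply: contraNneq kH => c0; rewrite ek c0 scale0r addr0.
have -> : y = - (c^-1 *: h) + c^-1 *: k.
  by rewrite ek scalerDr scalerA mulVf // scale1r addKr.
by apply: memv_add; [rewrite memvN memvZ|rewrite memvZ // memv_line].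
Qed.

(** In the generic case [H] is taken through [A] and [y - z] while avoiding [y], and then avoids [z]
    as well. This works over every field, the field with two elements included. *)
Lemma hyperplane_avoid2 A V y z : (A <= V)%VS -> y \in V -> y \notin A -> z \notin A ->
  exists H, [/\ (A <= H)%VS, (H <= V)%VS, y \notin H, z \notin H & (H + <[y]>)%VS = V].
Proof.
move=> AV yV yA zA.
have [zV|zV] := boolP (z \in V); last first.
  have [H [h1 h2 h3 h4]] := hyperplane_avoid1 AV yV yA; exists H; split=> //.
  by apply: contra zV; move/subvP: h2; apply.
have [zy|zy] := boolP (z \in (A + <[y]>)%VS).
  have [H [h1 h2 h3 h4]] := hyperplane_avoid1 AV yV yA; exists H; split=> //.
  move: zy => /memv_addP[a aA [_ /vlineP[c ->] e]].
  have c0 : c != 0 by apply: contraNneq zA => c0; rewrite e c0 scale0r addr0.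
  apply: contra h3 => zH; have aH : a \in H by move/subvP: h1; apply.
  have : c *: y \in H by rewrite -(addKr a (c *: y)) -e rpredD // rpredN.
  by rewrite rpredZeq (negPf c0).
have yA' : y \notin (A + <[y - z]>)%VS.
  apply/negP => /memv_addP[a aA [_ /vlineP[c ->] e]].
  have c0 : c != 0 by apply: contraNneq yA => c0; rewrite e c0 scale0r addr0.
  case/negP: zy.
  have -> : z = c^-1 *: a + (1 - c^-1) *: y.
    have h : c^-1 *: y = c^-1 *: a + (y - z) by rewrite {1}e scalerDr scalerA mulVf // scale1r.
    rewrite scalerBl scale1r h; move: (c^-1 *: a) => u.
    by rewrite addrA (addrC u y) opprD addrA addrK opprB addrC subrK.
  by apply: memv_add; rewrite memvZ // memv_line.
have [|H [h1 h2 h3 h4]] := @hyperplane_avoid1 (A + <[y - z]>)%VS V y _ yV yA'.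
  by rewrite subv_add AV -memvE rpredB.
exists H; split=> //; first by apply: subv_trans h1; exact: addvSl.
apply: contra h3 => zH; rewrite -(subrK z y) rpredD //.
by move/subvP: h1; apply; apply: (subvP (addvSr _ _)); exact: memv_line.
Qed.

End Subspaces.

(** * Complexes of supplements and Tits buildings *)

Section LinearComplexes.
Variables (F : fieldType) (E : vectType F).
Implicit Types (A K L V W X Y H : {vspace E}) (S : set {vspace E}).

Let le := @vsub_le F E.

(** With [L = V] these are the proper supplements of [K] in [V] above [A]; with [L] a line, those
    avoiding a vector. Both occur as lower links among isotropic subspaces. *)
Definition supplements A V K L : set {vspace E} :=
  [set W | [/\ (A <= W)%VS, (W <= V)%VS, W != V, (W + K)%VS = V & ~~ (L <= W)%VS]].

(* For a hyperplane [H >= A] containing neither [K] nor [L], the [W] with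
   [(W :&: H) + K = V] contract to [H]; the other [W] are added by increasing dimension,
   along the join of two smaller instances. *)
Lemma supplements_con A V K L : (A <= K)%VS -> (K <= V)%VS -> ~~ (L <= A)%VS ->
  scon (\dim K - \dim A) (supplements A V K L).
Proof.
have [n] := ubnP (\dim V - \dim A)%N; elim: n A V K L => // n IH A V K L dn AK KV LA.
have AV := subv_trans AK KV.
have [KA|KA] := boolP (K <= A)%VS.
  have -> : (\dim K - \dim A = 0)%N by have := dimvS KA; lia.
  exact: con_zero.
have [eKV|nKV] := eqVneq K V.
  apply: (@scon_min _ _ _ _ A); last by move=> W [].
  split=> //; first by apply: contraNneq KA => ->.
  by rewrite eKV; apply/addv_idPr.
have /subvPn[y yK yA] := KA; have /subvPn[z zL zA] := LA.
have yV : y \in V by move/subvP: KV; apply.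
have [H [AH HV yH zH HyV]] := hyperplane_avoid2 AV yV yA zA.
have HK : (H + K)%VS = V.
  apply/eqP; rewrite eqEsubv subv_add HV KV /= -HyV subv_add addvSl /= -memvE.
  exact: (subvP (addvSr _ _)).
have nL W : (W <= H)%VS -> ~~ (L <= W)%VS.
  by move=> WH; apply: contra zH => LW; move/subvP: (subv_trans LW WH); apply.
have nV W : (W <= H)%VS -> W != V.
  by move=> WH; apply: contraNneq yH => e; move/subvP: WH; apply; rewrite e.
pose S := supplements A V K L.
pose S0 := [set W | S W /\ (W :&: H + K)%VS = V].
apply: (@scon_inc _ _ _ S0); first by move=> W [].
  apply: (@conical_down _ _ _ _ H (fun W => (W :&: H)%VS)).
  - by split; [split=> //; [exact: nV|exact: nL]|rewrite capvv].
  - move=> W [[AW WV _ _ _] WK]; split; [|exact: capvSl|exact: capvSr].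
    split; last by rewrite -capvA capvv.
    split=> //; first by rewrite subv_cap AW AH.
    + exact: subv_trans (capvSl _ _) WV.
    + exact/nV/capvSr.
    + exact/nL/capvSr.
  - by move=> W W' _ _ l; exact: capvS.
move=> W SW nS0; have [AW WV nWV WK LW] := SW.
have bad : (W :&: H + K)%VS <> V by move=> e; apply: nS0.
have WH : ~~ (W <= H)%VS by apply/negP => h; apply: bad; rewrite (capv_idPl h).
have /subvPn[w wW wH] := WH.
have wV : w \in V by move/subvP: WV; apply.
(* [W] contains a vector outside [H]. For [X] above [W] the condition on [X :&: H] therefore becomes
   [X + K2 = V], and the upper link is again a complex of supplements. *)
pose K2 := (W + (H :&: K))%VS.
(* Along a vector of [W :&: K] outside [H], all of [W] could be moved into [W :&: H], and [W] would
   belong to [S0]. *)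
have WKH : (W :&: K <= H)%VS.
  apply: contraT => /subvPn[k]; rewrite memv_cap => /andP[kW kK] kH.
  have kV : k \in V by move/subvP: WV; apply.
  have ek := hyperplane_any HV HyV kV kH.
  case: bad; apply/eqP; rewrite eqEsubv subv_add KV (subv_trans (capvSl _ _) WV) /=.
  rewrite -{1}WK subv_add addvSr andbT; apply/subvP => x xW.
  have : x \in V by move/subvP: WV; apply.
  rewrite -{1}ek => /memv_addP[h hH [_ /vlineP[c ->] ex]].
  rewrite ex; apply: memv_add; last by rewrite memvZ.
  by rewrite memv_cap hH andbT -(addrK (c *: k) h) -ex rpredB // memvZ.
have goodE X : (W <= X)%VS -> (X <= V)%VS -> (X + K)%VS = V ->
    (X :&: H + K)%VS = V <-> (X + K2)%VS = V.
  move=> WX XV XK; rewrite /K2 addvA (addv_idPl WX); split=> h.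
    apply/eqP; rewrite eqEsubv subv_add XV (subv_trans (capvSr _ _) KV) /=.
    rewrite -{1}XK subv_add addvSl /=; apply/subvP => x xK.
    move: wV; rewrite -{1}h => /memv_addP[s]; rewrite memv_cap => /andP[sX sH] [k kK ew].
    have kX : k \in X.
      by rewrite -(addKr s k) -ew rpredD ?rpredN //; move/subvP: WX; apply.
    have kH : k \notin H by apply: contra wH => kH; rewrite ew rpredD.
    have kV : k \in V by move/subvP: KV; apply.
    have : x \in V by move/subvP: KV; apply.
    rewrite -{1}(hyperplane_any HV HyV kV kH) => /memv_addP[g gH [_ /vlineP[c ->] ex]].
    rewrite ex addrC; apply: memv_add; first by rewrite memvZ.
    by rewrite memv_cap gH /= -(addrK (c *: k) g) -ex rpredB // memvZ.
  have eH : (X :&: H + (H :&: K) = H)%VS.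
    by rewrite capvC vspace_modr ?capvSl // h; apply/capv_idPl.
  apply/eqP; rewrite eqEsubv subv_add KV (subv_trans (capvSl _ _) XV) /= -HK subv_add addvSr andbT.
  by rewrite -{1}eH addvS // capvSr.
have nK2 : K2 <> V.
  by move=> e; apply: bad; apply/goodE => //; rewrite e; apply/addv_idPr.
have WA : W <> A by move=> e; move: nKV; rewrite -WK e (addv_idPr AK) eqxx.
have dAW : (\dim A < \dim W)%N by apply: plt_dim; rewrite /plt /vsub_le AW eq_sym; apply/eqP.
have dWV : (\dim W < \dim V)%N by apply: plt_dim; rewrite /plt /vsub_le WV.
(* As [W :&: K] lies in [H], the two bounds add up to [\dim (H :&: K) - \dim A], which is at least
   [\dim K - \dim A - 1]. *)
exists (\dim (W :&: K) - \dim A)%N, (\dim K2 - \dim W)%N; split.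
- have d1 : (\dim K <= (\dim (H :&: K)).+1)%N.
    have := dimv_sum_cap H K; rewrite HK.
    have := dimv_sum_cap H <[y]>%VS; rewrite HyV dim_vline.
    by case: (y != 0); clear; lia.
  have d2 := dimv_sum_cap W (H :&: K)%VS; rewrite -/K2 in d2.
  have d3 : \dim (W :&: (H :&: K)) = \dim (W :&: K).
    by rewrite (capvC H) capvA (capv_idPl WKH).
  have d4 : (\dim A <= \dim (W :&: K))%N by rewrite dimvS // subv_cap AW AK.
  have d5 : (\dim W <= \dim K2)%N by rewrite dimvS // addvSl.
  by move: d1 d2 d3 d4 d5; clear; lia.
- have -> : [set X | S X /\ plt le X W] = supplements A W (W :&: K)%VS L.
    apply/seteqP; split=> X /=.
      move=> [[AX XV nXV XK LX] /andP[XW nXW]]; split=> //.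
      by rewrite capvC (vspace_modl _ XW) XK; apply/capv_idPr.
    move=> [AX XW nXW XK LX]; split; last by rewrite /plt /le /vsub_le XW.
    split=> //; first exact: subv_trans XW WV.
      apply: contraNneq nXW => e; rewrite eqEsubv XW /= e.
      by rewrite (subv_trans WV).
    by rewrite -{1}(addv_idPr (capvSr W K)) addvA XK.
  apply: IH => //; first by move: dn dAW dWV; clear; lia.
  + by rewrite subv_cap AW AK.
  + exact: capvSl.
- have -> : [set X | S0 X /\ plt le W X] = supplements W V K2 L.
    apply/seteqP; split=> X /=.
      move=> [[[AX XV nXV XK LX] good] /andP[WX _]]; split=> //.
      exact/goodE.
    move=> [WX XV nXV XK LX].
    have XKV : (X + K)%VS = V.
      apply/eqP; rewrite eqEsubv subv_add XV KV /= -WK; exact: addvS.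
    split.
      by split; [split=> //; exact: subv_trans AW WX|apply/goodE].
    rewrite /plt /le /vsub_le WX /=; apply/eqP => e; apply: nK2.
    by rewrite -XK -e; apply/esym/addv_idPr; exact: addvSl.
  apply: IH => //; first by move: dn dAW dWV; clear; lia.
  + exact: addvSl.
  + by rewrite subv_add WV (subv_trans (capvSr _ _) KV).
Qed.

Definition between A V : set {vspace E} := [set W | plt le A W /\ plt le W V].

(** Solomon-Tits for [V / A]: the [W] with [W + <[y]> <> V] contract to [A + <[y]>], and the others
    are hyperplanes of [V], attached along the smaller buildings below them. *)
Lemma between_con A V : (A <= V)%VS -> scon (\dim V - \dim A).-1 (between A V).
Proof.
have [n] := ubnP (\dim V); elim: n V => // n IH V dn AV.
have [d1|d1] := leqP (\dim V - \dim A) 1.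
  have -> : (\dim V - \dim A).-1 = 0%N by lia.
  exact: con_zero.
have /subvPn[y yV yA] : ~~ (V <= A)%VS by apply/negP => /dimvS; lia.
have nL W : (\dim W < (\dim (W + <[y]>)).+1)%N /\ (\dim (W + <[y]>) <= (\dim W).+1)%N.
  split; first by rewrite ltnS dimvS ?addvSl.
  by have := dimv_sum_cap W <[y]>%VS; rewrite dim_vline; case: (y != 0); clear; lia.
pose S0 := [set W | between A V W /\ (W + <[y]>)%VS <> V].
apply: (@scon_inc _ _ _ S0); first by move=> W [].
  apply: (@conical_up _ _ _ _ (A + <[y]>)%VS (fun W => (W + <[y]>)%VS)).
  - have AyV : (A + <[y]>)%VS <> V by move=> e; have := nL A; rewrite e; lia.
    split; last by rewrite -addvA addvv.
    split; rewrite /plt /le /vsub_le.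
      rewrite addvSl /=; apply: contraNneq yA => ->.
      by apply: (subvP (addvSr _ _)); exact: memv_line.
    by rewrite subv_add AV -memvE yV; apply/eqP.
  - move=> W [[/andP[AW nAW] /andP[WV nWV]] hW]; split.
    + split; last by rewrite -addvA addvv.
      split; rewrite /plt /le /vsub_le.
        rewrite (subv_trans AW (addvSl _ _)) /=; apply: contra nAW => /eqP e.
        by rewrite eqEsubv [(_ <= _)%VS]AW e addvSl.
      by rewrite subv_add [(_ <= _)%VS]WV -memvE yV; apply/eqP.
    + exact: addvSl.
    + exact: addvS.
  - by move=> W W' _ _ l; exact: addvS.
move=> W bW nS0; have [AW WV] := bW.
have e : (W + <[y]>)%VS = V by apply: contrapT => h; apply: nS0.
exists (\dim W - \dim A).-1, 0%N; split; last exact: con_zero.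
  by have := nL W; rewrite e; lia.
have -> : [set X | between A V X /\ plt le X W] = between A W.
  apply/seteqP; split=> X /=; first by move=> [[]].
  move=> [AX XW]; split=> //; split=> //.
  exact: (plt_trans (@vle_trans _ _) (@vle_anti _ _) XW WV).
apply: IH; last by case/andP: AW.
by have := plt_dim WV; lia.
Qed.

End LinearComplexes.

(** * Chains and dimensions of intervals *)

Section Grading.
Variables (F : fieldType) (E : vectType F).
Implicit Types (A V W X Y : {vspace E}) (S : set {vspace E}) (c : seq {vspace E}).

Let le := @vsub_le F E.

Lemma subspace_between A V d : (A <= V)%VS -> (\dim A <= d)%N -> (d <= \dim V)%N ->
  exists W, [/\ (A <= W)%VS, (W <= V)%VS & \dim W = d].
Proof.
move=> AV; have [n] := ubnP (d - \dim A)%N; elim: n A AV => // n IH A AV dn Ad dV.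
have [e|ne] := eqVneq (\dim A) d; first by exists A.
have /subvPn[y yV yA] : ~~ (V <= A)%VS by apply/negP => /dimvS; move/eqP: ne; lia.
have d1 : \dim (A + <[y]>) = (\dim A).+1.
  have : (\dim A < \dim (A + <[y]>))%N.
    apply: plt_dim; rewrite /plt /vsub_le addvSl /=; apply: contraNneq yA => ->.
    by apply: (subvP (addvSr _ _)); exact: memv_line.
  by have := dimv_sum_cap A <[y]>%VS; rewrite dim_vline; case: (y != 0); lia.
have [||||W [h1 h2 h3]] := IH (A + <[y]>)%VS.
- by rewrite subv_add AV -memvE.
- by rewrite d1; move/eqP: ne; lia.
- by rewrite d1; move/eqP: ne; lia.
- by [].
by exists W; split=> //; exact: subv_trans (addvSl _ _) h1.
Qed.

Lemma chain_dims_uniq S c : is_chain le S c -> uniq (map (fun W => \dim W) c).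
Proof.
move=> cc; rewrite map_inj_in_uniq; first exact: (chain_uniq (@vle_trans _ _) (@vle_anti _ _) cc).
move=> V W Vc Wc; apply: dim_cmp.
exact: (chain_comp (@vle_refl _ _) (@vle_trans _ _) (@vle_anti _ _) cc).
Qed.

Lemma chain_max c : (forall V W, V \in c -> W \in c -> comp le V W) -> c != [::] ->
  exists2 V, V \in c & forall W, W \in c -> (W <= V)%VS.
Proof.
elim: c => // V c IH cc _; have [->|nc] := eqVneq c [::].
  by exists V; rewrite ?inE // => W; rewrite inE => /eqP ->; exact: subvv.
have [|X Xc hX] := IH _ nc; first by move=> Y W Yc Wc; apply: cc; rewrite inE ?Yc ?Wc orbT.
have /orP[VX|XV] : comp le V X by apply: cc; rewrite inE ?eqxx ?Xc ?orbT.
  by exists X; rewrite ?inE ?Xc ?orbT // => W; rewrite inE => /orP[/eqP ->//|/hX].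
exists V; rewrite ?inE ?eqxx // => W; rewrite inE => /orP[/eqP ->|/hX h]; first exact: subvv.
exact: subv_trans h XV.
Qed.

Lemma chain_min c : (forall V W, V \in c -> W \in c -> comp le V W) -> c != [::] ->
  exists2 V, V \in c & forall W, W \in c -> (V <= W)%VS.
Proof.
elim: c => // V c IH cc _; have [->|nc] := eqVneq c [::].
  by exists V; rewrite ?inE // => W; rewrite inE => /eqP ->; exact: subvv.
have [|X Xc hX] := IH _ nc; first by move=> Y W Yc Wc; apply: cc; rewrite inE ?Yc ?Wc orbT.
have /orP[VX|XV] : comp le V X by apply: cc; rewrite inE ?eqxx ?Xc ?orbT.
  exists V; rewrite ?inE ?eqxx // => W; rewrite inE => /orP[/eqP ->|/hX h]; first exact: subvv.
  exact: subv_trans VX h.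
by exists X; rewrite ?inE ?Xc ?orbT // => W; rewrite inE => /orP[/eqP ->//|/hX].
Qed.

(** A missing bound is [None], so that a chain can also be refined below its least and above its
    greatest element. *)
Definition interpolates S lo N := forall d, (lo <= d < lo + N)%N -> forall x y : option {vspace E},
  (forall a, x = Some a -> S a /\ (\dim a < d)%N) ->
  (forall b, y = Some b -> S b /\ (d < \dim b)%N) ->
  (forall a b, x = Some a -> y = Some b -> (a <= b)%VS) ->
  exists W, [/\ S W, \dim W = d, forall a, x = Some a -> (a <= W)%VS &
    forall b, y = Some b -> (W <= b)%VS].

(** Members of a chain have distinct dimensions. If a dimension of the range is missing, an element
    of that dimension fits between the neighbouring members, and the chain is not maximal. *)
Lemma maxchain_size S lo N c : (forall W, S W -> (lo <= \dim W < lo + N)%N) ->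
  interpolates S lo N -> is_maxchain le S c -> size c = N.
Proof.
move=> dS IP [cc mc]; have uc := chain_dims_uniq cc.
have cmp V W : V \in c -> W \in c -> comp le V W.
  exact: (chain_comp (@vle_refl _ _) (@vle_trans _ _) (@vle_anti _ _) cc).
have cS W : W \in c -> S W by case: cc => _; apply.
apply/eqP; rewrite eqn_leq -(size_map (fun W => \dim W) c) -{1}(size_iota lo N) -{2}(size_iota lo N).
apply/andP; split.
  apply: uniq_leq_size => // d /mapP[W Wc ->]; rewrite mem_iota; exact/dS/cS.
apply: uniq_leq_size (iota_uniq _ _) _ => d; rewrite mem_iota => dr.
apply: contraT => nd.
have dim_ne W : W \in c -> \dim W != d.
  by move=> Wc; apply: contraNneq nd => <-; apply: map_f.
pose c1 := [seq W <- c | (\dim W < d)%N]; pose c2 := [seq W <- c | (d < \dim W)%N].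
have m1 V : V \in c1 -> V \in c /\ (\dim V < d)%N by rewrite mem_filter => /andP[].
have m2 V : V \in c2 -> V \in c /\ (d < \dim V)%N by rewrite mem_filter => /andP[].
have [x [xS xmax]] : exists x : option {vspace E}, (forall a, x = Some a -> a \in c1) /\
    forall W, W \in c1 -> exists2 a, x = Some a & (W <= a)%VS.
  have [e|ne] := eqVneq c1 [::]; first by exists None; split=> // W; rewrite e.
  have [|V Vc hV] := chain_max _ ne.
    by move=> V W /m1[Vc _] /m1[Wc _]; exact: cmp.
  by exists (Some V); split=> [a [<-]//|W /hV]; exists V.
have [y [yS ymin]] : exists y : option {vspace E}, (forall b, y = Some b -> b \in c2) /\
    forall W, W \in c2 -> exists2 b, y = Some b & (b <= W)%VS.
  have [e|ne] := eqVneq c2 [::]; first by exists None; split=> // W; rewrite e.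
  have [|V Vc hV] := chain_min _ ne.
    by move=> V W /m2[Vc _] /m2[Wc _]; exact: cmp.
  by exists (Some V); split=> [a [<-]//|W /hV]; exists V.
have [|||W [SW dW xW Wy]] := IP d dr x y.
- by move=> a /xS /m1[ac ad]; split=> //; exact: cS.
- by move=> b /yS /m2[bc bd]; split=> //; exact: cS.
- move=> a b /xS /m1[ac ad] /yS /m2[bc bd]; case/orP: (cmp a b ac bc) => // ba.
  by have := dimvS ba; lia.
have Wc : W \notin c by apply: contra nd => Wc; rewrite -dW; apply: map_f.
have cW V : V \in c -> comp le V W.
  move=> Vc; rewrite /comp; have := dim_ne V Vc; rewrite neq_ltn => /orP[lt|lt].
    have [|a /xW aW Va] := xmax V; first by rewrite mem_filter lt.
    by rewrite [le V W](subv_trans Va aW).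
  have [|b /Wy Wb bV] := ymin V; first by rewrite mem_filter lt.
  by rewrite [le W V](subv_trans Wb bV) orbT.
have ch : is_chain le S (sort le (W :: c)).
  apply: (sort_chain (@vle_trans _ _) (@vle_anti _ _)).
  - by rewrite /= Wc; exact: (chain_uniq (@vle_trans _ _) (@vle_anti _ _) cc).
  - by move=> V; rewrite inE => /orP[/eqP ->|/cS].
  - move=> V V'; rewrite !inE => /orP[/eqP ->|Vc] /orP[/eqP ->|V'c].
    + exact/compxx/vle_refl.
    + by rewrite compC; exact: cW.
    + exact: cW.
    + exact: cmp.
case/negP: Wc; apply: (mc _ ch); last by rewrite mem_sort mem_head.
by move=> V Vc; rewrite mem_sort inE Vc orbT.
Qed.

Lemma interpolates_has_dim S lo N : (forall W, S W -> (lo <= \dim W < lo + N)%N) ->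
  interpolates S lo N -> has_dim le S (N%:Z - 1).
Proof.
move=> dS IP.
have bd c : is_chain le S c -> (size c <= N)%N.
  move=> cc; rewrite -(size_map (fun W => \dim W)) -(size_iota lo N).
  apply: uniq_leq_size (chain_dims_uniq cc) _ => d /mapP[W Wc ->]; rewrite mem_iota.
  by apply: dS; case: cc => _; apply.
(* Chains have at most [N] members, so each can be enlarged to a maximal one; started from the empty
   chain this gives the witness of size [N]. *)
have ext n : forall c, (N - size c < n)%N -> is_chain le S c -> exists c', is_maxchain le S c'.
  elim: n => // n IH c dn cc.
  have [mc|nmc] := pselect (is_maxchain le S c); first by exists c.
  have [c' [cc' sub nsub]] : exists c', [/\ is_chain le S c', {subset c <= c'} & ~ {subset c' <= c}].
    apply: contrapT => nex; apply: nmc; split=> // c' cc' sub.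
    by apply: contrapT => ns; apply: nex; exists c'.
  have uc := chain_uniq (@vle_trans _ _) (@vle_anti _ _) cc.
  have lt : (size c < size c')%N.
    rewrite ltnNge; apply/negP => sz; apply: nsub.
    by move=> V; rewrite -(uniq_min_size uc sub sz).2.
  by apply: (IH c') => //; have := bd c' cc'; lia.
have [|c mc] := ext _ [::] (ltnSn _); first by split.
split; last by move=> c' /bd h; rewrite subrK lez_nat.
by exists c; split; [case: mc|rewrite (maxchain_size dS IP mc) subrK].
Qed.

Variables (X : set {vspace E}) (lo hi : nat).
Hypothesis X_dim : forall W, X W -> (lo <= \dim W <= hi)%N.
Hypothesis X_up : forall W d, X W -> (\dim W <= d)%N -> (d <= hi)%N ->
  exists W', [/\ X W', (W <= W')%VS & \dim W' = d].
Hypothesis X_down : forall W d, X W -> (lo <= d)%N -> (d <= \dim W)%N ->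
  exists W', [/\ X W', (W' <= W)%VS & \dim W' = d].
Hypothesis X_convex : forall V W W', X V -> X W -> (V <= W')%VS -> (W' <= W)%VS -> X W'.
Hypothesis X_ne : exists W, X W.

Lemma X_between d : (lo <= d <= hi)%N -> forall x y : option {vspace E},
  (forall a, x = Some a -> X a /\ (\dim a < d)%N) ->
  (forall b, y = Some b -> X b /\ (d < \dim b)%N) ->
  (forall a b, x = Some a -> y = Some b -> (a <= b)%VS) ->
  exists W, [/\ X W, \dim W = d, forall a, x = Some a -> (a <= W)%VS &
    forall b, y = Some b -> (W <= b)%VS].
Proof.
move=> /andP[d1 d2] [a|] [b|] ha hb hab.
- have [Xa da] := ha a erefl; have [Xb db] := hb b erefl.
  have [W [h1 h2 h3]] := subspace_between (hab a b erefl erefl) (ltnW da) (ltnW db).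
  exists W; split=> //; first exact: X_convex Xa Xb h1 h2.
  + by move=> _ [<-].
  + by move=> _ [<-].
- have [Xa da] := ha a erefl; have [W [h1 h2 h3]] := X_up Xa (ltnW da) d2.
  by exists W; split=> // _ [<-].
- have [Xb db] := hb b erefl; have [W [h1 h2 h3]] := X_down Xb d1 (ltnW db).
  by exists W; split=> // _ [<-].
- have [V XV] := X_ne; have /andP[l1 l2] := X_dim XV.
  have [W [XW _ dW]] := X_down XV (leqnn lo) l1.
  have [|W' [XW' _ dW']] := X_up XW _ d2; first by rewrite dW.
  by exists W'.
Qed.

(** Together with [upper_dim], the half-open range of dimensions in an interval. The value at [Top],
    and that of [upper_dim] at [Bot], make the range empty for degenerate intervals. *)
Definition lower_dim (x : ext {vspace E}) :=
  match x with Bot => lo | Mid a => (\dim a).+1 | Top => hi.+1 end.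
Definition upper_dim (y : ext {vspace E}) :=
  match y with Bot => lo | Mid b => \dim b | Top => hi.+1 end.

Lemma open_interval_has_dim x y : in_ext X x -> in_ext X y -> ext_le le x y ->
  has_dim le (open_interval le X x y) ((upper_dim y - lower_dim x)%N%:Z - 1) /\
  forall c, is_maxchain le (open_interval le X x y) c -> size c = (upper_dim y - lower_dim x)%N.
Proof.
move=> Xx Xy xy; set S := open_interval le X x y.
have dS W : S W -> (lower_dim x <= \dim W < lower_dim x + (upper_dim y - lower_dim x))%N.
  move=> [XW [[xW nxW] [Wy nWy]]]; have /andP[w1 w2] := X_dim XW.
  have h1 : (lower_dim x <= \dim W)%N.
    case: x nxW xW {S Xx xy} => [|a|] //= nxW xW; apply: plt_dim; apply/andP; split; first exact: xW.
    by apply/eqP => e; apply: nxW; rewrite e.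
  have h2 : (\dim W < upper_dim y)%N.
    case: y nWy Wy {S Xy xy} => [|b|] //= nWy Wy; apply: plt_dim; apply/andP; split; first exact: Wy.
    by apply/eqP => e; apply: nWy; rewrite e.
  by rewrite h1 /=; lia.
have lo_x : (lo <= lower_dim x)%N.
  by case: x Xx {S xy dS} => [|a|] //= Xx; have := X_ne; [have := X_dim Xx; lia|move=> [V /X_dim]; lia].
have hi_y : (upper_dim y <= hi.+1)%N.
  by case: y Xy {S xy dS} => [|b|] //= Xy; have := X_ne; [move=> [V /X_dim]; lia|have := X_dim Xy; lia].
have IP : interpolates S (lower_dim x) (upper_dim y - lower_dim x).
  move=> d dr x' y' hx' hy' hxy'.
  (* Where the chain gives no bound, the end point of the interval serves as one; only [Bot] and
     [Top] leave a side free. *)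
  pose x2 := if x' is Some a then Some a else if x is Mid a then Some a else None.
  pose y2 := if y' is Some b then Some b else if y is Mid b then Some b else None.
  have [|||| W [XW dW xW Wy]] := @X_between d _ x2 y2.
  - by apply/andP; split; lia.
  - move=> a; rewrite /x2; case: x' hx' {hxy' x2} => [a' hx'|_].
      by move=> [<-]; have [[Xa _] da] := hx' a' erefl.
    by case: (x) Xx dr => [|a'|] //= Xa dr [<-]; split=> //; lia.
  - move=> b; rewrite /y2; case: y' hy' {hxy' y2} => [b' hy'|_].
      by move=> [<-]; have [[Xb _] db] := hy' b' erefl.
    by case: (y) Xy dr => [|b'|] //= Xb dr [<-]; split=> //; lia.
  - move=> a b; rewrite /x2 /y2.
    case: x' hx' hxy' {x2} => [a'|] hx' hxy'; case: y' hy' hxy' {y2} => [b'|] hy' hxy'.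
    + by move=> [<-] [<-]; exact: hxy'.
    + have [[_ [_ [h _]]] _] := hx' a' erefl.
      by move=> [<-]; case: (y) h => [|b'|] //= h [<-].
    + have [[_ [[h _] _]] _] := hy' b' erefl.
      by case: (x) h => [|a'|] //= h [<-] [<-].
    + by case: (x) (y) xy => [|a'|] [|b'|] //= h [<-] [<-].
  exists W; split=> //.
  - split=> //; split.
      have xW' : ext_le le x (Mid W).
        move: hx' xW; rewrite /x2; case: x' {hxy' x2} => [a'|] hx' xW.
          have [[_ [[h _] _]] _] := hx' a' erefl; have aW := xW a' erefl.
          by case: (x) h => [|a|] //= h; exact: subv_trans h aW.
        by case: (x) xW xy dr => [|a|] //= xW; [move=> _ _; exact: xW|case: (y) => //= _; lia].
      split=> // e; move: dr; rewrite e /= dW; lia.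
    have Wy' : ext_le le (Mid W) y.
      move: hy' Wy; rewrite /y2; case: y' {hxy' y2} => [b'|] hy' Wy.
        have [[_ [_ [h _]]] _] := hy' b' erefl; have Wb := Wy b' erefl.
        by case: (y) h => [|b|] //= h; exact: subv_trans Wb h.
      by case: (y) Wy xy dr => [|b|] //= Wy; [case: (x) => //= _; lia|move=> _ _; exact: Wy].
    split=> // e; move: dr; rewrite -e /= dW; lia.
  - by move=> a e; apply: xW; rewrite /x2 e.
  - by move=> b e; apply: Wy; rewrite /y2 e.
split; first exact: interpolates_has_dim dS IP.
by move=> c; exact: maxchain_size dS IP.
Qed.

End Grading.

(** * Formed spaces *)

Section SubspaceOfPredicate.
Variables (F : fieldType) (E : vectType F).

Lemma subspace_ex (P : E -> Prop) : P 0 -> (forall u v, P u -> P v -> P (u + v)) ->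
  (forall a v, P v -> P (a *: v)) -> exists W : {vspace E}, forall v, v \in W <-> P v.
Proof.
move=> P0 PD PZ.
suff gen n : (exists W : {vspace E}, (forall v, v \in W -> P v) /\ (\dim {:E} < \dim W + n)%N) ->
    exists W : {vspace E}, forall v, v \in W <-> P v.
  apply: (gen (\dim {:E}).+1); exists 0%VS; split; last by rewrite dimv0 add0n.
  by move=> v; rewrite memv0 => /eqP ->.
elim: n => [|n IH] [W [WP dW]].
  by have := dimvS (subvf W); move: dW; rewrite addn0; lia.
have [[v [Pv vW]]|nex] := pselect (exists v, P v /\ v \notin W).
  apply: IH; exists (W + <[v]>)%VS; split.
    by move=> _ /memv_addP[w wW [_ /vlineP[c ->] ->]]; apply: PD; [exact: WP|exact: PZ].
  have : (\dim W < \dim (W + <[v]>))%N.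
    apply: plt_dim; rewrite /plt /vsub_le addvSl /=; apply: contraNneq vW => ->.
    by apply: (subvP (addvSr _ _)); exact: memv_line.
  by move: dW; lia.
exists W => v; split; first exact: WP.
by move=> Pv; apply: contrapT => /negP vW; apply: nex; exists v.
Qed.

End SubspaceOfPredicate.

Section Forms.
Variables (F : fieldType) (E : vectType F).
Variables (sigma : {rmorphism F -> F}) (eps : F) (Lam : pred F) (q : E -> E -> F).
Hypothesis params : form_parameters sigma eps Lam.
Hypothesis Lam_scale : forall a c, c \in Lam -> sigma a * c * a \in Lam.
Hypothesis sesq : sesquilinear sigma q.
Implicit Types (A K L M U V W X Y Z H : {vspace E}) (u v w : E).

Let om := omega sigma eps q.
Let Qz := Qzero Lam q.
Let iso := isotropic sigma eps Lam q.

Let sigmaK : involutive sigma. Proof. by case: params. Qed.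
Let Lam0 : 0 \in Lam.
Proof. by case: params => _ _ _ h _; have := h 0; rewrite rmorph0 mulr0 subr0. Qed.
Let LamB a b : a \in Lam -> b \in Lam -> a - b \in Lam.
Proof. by case: params => _ _ h _ _; exact: h. Qed.
Let LamD a b : a \in Lam -> b \in Lam -> a + b \in Lam.
Proof. by move=> ha hb; rewrite -(opprK b) LamB // -sub0r LamB. Qed.
Let sigma_eq0 a : (sigma a == 0) = (a == 0).
Proof. exact: fmorph_eq0. Qed.

Lemma omC v w : om w v = eps * sigma (om v w).
Proof.
rewrite /om /omega rmorphD rmorphM sigmaK mulrDr mulrA.
by case: params => _ -> _ _ _; rewrite mul1r addrC.
Qed.

Lemma om_eq0C v w : om v w = 0 -> om w v = 0.
Proof. by move=> h; rewrite omC h rmorph0 mulr0. Qed.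

Lemma omDr u v w : om u (v + w) = om u v + om u w.
Proof.
by rewrite /om /omega; case: sesq => h1 h2 _; rewrite h1 h2 rmorphD mulrDr addrACA.
Qed.

Lemma omZr u a v : om u (a *: v) = om u v * a.
Proof.
case: sesq => _ _ h; rewrite /om /omega -{1}(scale1r u) -{2}(scale1r u) !h rmorph1 mul1r mulr1.
by rewrite rmorphM sigmaK mulrDl (mulrC a) mulrA.
Qed.

Lemma omDl u v w : om (u + v) w = om u w + om v w.
Proof. by rewrite omC omDr rmorphD mulrDr -!omC. Qed.

Lemma omZl a u v : om (a *: u) v = sigma a * om u v.
Proof. by rewrite omC omZr rmorphM mulrA -omC mulrC. Qed.

Lemma omNr u v : om u (- v) = - om u v.
Proof. by rewrite -scaleN1r omZr mulrN1. Qed.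

Lemma omNl u v : om (- u) v = - om u v.
Proof. by rewrite -scaleN1r omZl rmorphN1 mulN1r. Qed.

Lemma om0r u : om u 0 = 0.
Proof. by rewrite -(scale0r 0) omZr mulr0. Qed.

Lemma om_Qz v : Qz v -> om v v = 0.
Proof. by case: params => _ _ _ _ h; exact: h. Qed.

Lemma QzZ a v : Qz v -> Qz (a *: v).
Proof. by rewrite /Qz /Qzero => h; case: sesq => _ _ ->; exact: Lam_scale. Qed.

Lemma QzD u v : om u v = 0 -> Qz u -> Qz v -> Qz (u + v).
Proof.
rewrite /Qz /Qzero /om /omega => h hu hv; case: sesq => h1 h2 _; rewrite h1 !h2.
have -> : q u u + q u v + (q v u + q v v) = (q u u + q v v) + (q v u - eps * sigma (q v u)).
  by have -> : q u v = - (eps * sigma (q v u)); [apply/eqP; rewrite -addr_eq0 h|ring].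
by apply: LamD; [exact: LamD|case: params].
Qed.

(* Solves [q (v + c *: u) (v + c *: u) = 0] modulo [Lam], which is linear in [sigma c]. *)
Lemma isotropize u v : Qz u -> om u v != 0 -> exists c, Qz (v + c *: u).
Proof.
move=> hu huv; pose d := - (q v v) / om u v; exists (sigma d).
rewrite /Qz /Qzero; case: sesq => h1 h2 h3; rewrite h1 !h2.
have qr a x y : q x (a *: y) = q x y * a by rewrite -{1}(scale1r x) h3 rmorph1 mul1r.
have ql a x y : q (a *: x) y = sigma a * q x y by rewrite -{1}(scale1r y) h3 mulr1.
rewrite h3 qr ql sigmaK.
set X := q v u * sigma d.
have -> : q v v + X + (d * q u v + d * q u u * sigma d) =
   (q v v + d * om u v) + (X - eps * sigma X) + sigma (sigma d) * q u u * sigma d.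
  by rewrite /X /om /omega rmorphM sigmaK; ring.
rewrite /d divfK // subrr add0r; apply: LamD; last exact: Lam_scale.
by case: params.
Qed.

Lemma orth_ex U : exists W : {vspace E}, forall v, v \in W <-> forall u, u \in U -> om u v = 0.
Proof.
apply: subspace_ex.
- by move=> u _; exact: om0r.
- by move=> v w hv hw u uU; rewrite omDr hv // hw // addr0.
- by move=> a v hv u uU; rewrite omZr hv // mul0r.
Qed.

Definition orth U : {vspace E} := projT1 (cid (orth_ex U)).

Lemma orthP U v : v \in orth U <-> forall u, u \in U -> om u v = 0.
Proof. by rewrite /orth; case: cid => W /= h; exact: h. Qed.

Lemma orth_om U u v : v \in orth U -> u \in U -> om u v = 0.
Proof. by move/orthP; apply. Qed.

Lemma orth_omC U u v : v \in orth U -> u \in U -> om v u = 0.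
Proof. by move=> h hu; apply: om_eq0C; exact: orth_om h hu. Qed.

Lemma orthS U V : (U <= V)%VS -> (orth V <= orth U)%VS.
Proof. by move=> /subvP h; apply/subvP => v /orthP hv; apply/orthP => u /h/hv. Qed.

Lemma sub_orthC U V : (U <= orth V)%VS -> (V <= orth U)%VS.
Proof.
by move=> /subvP h; apply/subvP => v vV; apply/orthP => u /h uO; exact: orth_omC uO vV.
Qed.

Lemma orth_line z v : v \in orth <[z]>%VS <-> om z v = 0.
Proof.
split=> [/orthP|h]; first by apply; exact: memv_line.
by apply/orthP => _ /vlineP[c ->]; rewrite omZl h mulr0.
Qed.

Lemma orth_add U V : orth (U + V) = (orth U :&: orth V)%VS.
Proof.
apply/vspaceP => v; apply/idP/idP.
  move=> h; rewrite memv_cap; apply/andP; split.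
    exact: (subvP (orthS (addvSl U V))).
  exact: (subvP (orthS (addvSr U V))).
rewrite memv_cap => /andP[h1 h2]; apply/orthP => _ /memv_addP[a aU [b bV ->]].
by rewrite omDl (orth_om h1) // (orth_om h2) // addr0.
Qed.

Definition Kv : {vspace E} := orth fullv.

Lemma Kv_om u v : v \in Kv -> om u v = 0.
Proof. by move=> h; apply: orth_om h _; exact: memvf. Qed.

Lemma Kv_omC u v : v \in Kv -> om v u = 0.
Proof. by move=> h; apply: om_eq0C; exact: Kv_om. Qed.

(** Subtracting a suitable multiple of [y] makes [u] orthogonal to the larger space [orth H], which
    allows induction on [\dim X]. *)
Lemma double_orth X u : (forall v, v \in orth X -> om u v = 0) -> u \in (X + Kv)%VS.
Proof.
have [n] := ubnP (\dim X); elim: n X u => // n IH X u dX hu.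
have [X0|X0] := eqVneq X 0%VS.
  rewrite X0 add0v; apply/orthP => v _; apply: om_eq0C; apply: hu; rewrite X0.
  by apply/orthP => x; rewrite memv0 => /eqP ->; apply: om_eq0C; exact: om0r.
have /subvPn[y yX y0] : ~~ (X <= 0)%VS by rewrite subv0.
have [H [_ HX yH HyX]] := hyperplane_avoid1 (sub0v X) yX y0.
have dHX : (\dim H < \dim X)%N.
  by apply: plt_dim; rewrite /plt /vsub_le HX /=; apply: contraNneq yH => ->.
have dH : (\dim H < n)%N by move: dHX dX; clear; lia.
suff [c hc] : exists c, u - c *: y \in (H + Kv)%VS.
  rewrite -(subrK (c *: y) u) -HyX -addvA (addvC <[y]>%VS) addvA.
  by apply: memv_add => //; rewrite memvZ // memv_line.
have [[v0 [v0H yv0]]|nex] := pselect (exists v0, v0 \in orth H /\ om y v0 != 0); last first.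
  exists 0; rewrite scale0r subr0; apply: IH => // v vH; apply: hu.
  rewrite -HyX orth_add memv_cap vH /=; apply/orth_line.
  by apply: contrapT => /eqP h; apply: nex; exists v.
exists (sigma (om u v0 / om y v0)); apply: IH => // v vH.
pose l := om y v / om y v0.
have : om u (v - l *: v0) = 0.
  apply: hu; rewrite -HyX orth_add memv_cap rpredB ?memvZ //=; apply/orth_line.
  by rewrite omDr omNr omZr /l mulrC divfK // subrr.
rewrite omDr omNr omZr => /eqP; rewrite subr_eq0 => /eqP e.
by rewrite omDl omNl omZl sigmaK e /l; field.
Qed.

Lemma codim_line M z : (\dim M <= (\dim (M :&: orth <[z]>)).+1)%N.
Proof.
have [h|/subvPn[v0 v0M v0z]] := boolP (M <= orth <[z]>)%VS; first by rewrite (capv_idPl h).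
have zv0 : om z v0 != 0 by apply: contra v0z => /eqP h; apply/orth_line.
have : (M <= M :&: orth <[z]> + <[v0]>)%VS.
  apply/subvP => v vM; pose l := om z v / om z v0.
  rewrite -(subrK (l *: v0) v); apply: memv_add; last by rewrite memvZ // memv_line.
  rewrite memv_cap rpredB ?memvZ //=; apply/orth_line.
  by rewrite omDr omNr omZr /l mulrC divfK // subrr.
move=> /dimvS h; apply: leq_trans h _.
have := dimv_sum_cap (M :&: orth <[z]>)%VS <[v0]>%VS; rewrite dim_vline.
by case: (v0 != 0); lia.
Qed.

Lemma codim_orth M C : (\dim M <= \dim (M :&: orth C) + \dim C)%N.
Proof.
have [n] := ubnP (\dim C); elim: n C => // n IH C dC.
have [C0|C0] := eqVneq C 0%VS.
  suff -> : (M :&: orth C)%VS = M by rewrite leq_addr.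
  apply/capv_idPl/subvP => v _; apply/orthP => x; rewrite C0 memv0 => /eqP ->.
  by apply: om_eq0C; exact: om0r.
have /subvPn[y yC y0] : ~~ (C <= 0)%VS by rewrite subv0.
have [H [_ HC yH HyC]] := hyperplane_avoid1 (sub0v C) yC y0.
have dH : (\dim H < \dim C)%N.
  apply: plt_dim; rewrite /plt /vsub_le HC /=.
  by apply: contraNneq yH => ->.
have := IH H (leq_trans dH (dC : (\dim C <= n)%N)); have := codim_line (M :&: orth H)%VS y.
by rewrite -capvA -orth_add HyC; move: dH; clear; lia.
Qed.

(** Half of the symmetry of the rank of the pairing: a complement of [W :&: orth M] in [W] imposes
    the same conditions on [M] as [W] does, and at most as many as its dimension. Exchanging [M] and
    [W] gives equality. *)
Lemma pair_dim M W : (\dim M + \dim (W :&: orth M) <= \dim W + \dim (M :&: orth W))%N.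
Proof.
pose C := (W :\: orth M)%VS.
have dC := dimv_cap_compl W (orth M); rewrite -/C in dC.
have e : (M :&: orth C)%VS = (M :&: orth W)%VS.
  rewrite -{1}(addv_diff_cap W (orth M)) orth_add capvA; apply/esym/capv_idPl.
  apply: subv_trans (capvSl _ _) _; apply: sub_orthC.
  exact: capvSr.
by have := codim_orth M C; rewrite e; move: dC; clear; lia.
Qed.

Lemma dual_dim Y Z : (Z :&: orth Y = 0)%VS -> (\dim (Y :&: orth Z) + \dim Z = \dim Y)%N.
Proof.
move=> h; have := pair_dim Y Z; have := pair_dim Z Y; rewrite h dimv0.
by clear; lia.
Qed.

Lemma isoS W W' : (W <= W')%VS -> iso W' -> iso W.
Proof. by move=> /subvP s [h1 h2]; split=> [v w /s hv /s hw|v /s hv]; [exact: h1|exact: h2]. Qed.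

Lemma iso_orth W : iso W -> (W <= orth W)%VS.
Proof. by move=> [h _]; apply/subvP => v vW; apply/orthP => u uW; exact: h. Qed.

Lemma iso_add W v : iso W -> Qz v -> v \in orth W -> iso (W + <[v]>).
Proof.
move=> [h1 h2] hv vW; split.
  move=> _ _ /memv_addP[a aW [_ /vlineP[c ->] ->]] /memv_addP[b bW [_ /vlineP[d ->] ->]].
  rewrite -/om !omDl !omDr !omZl !omZr [om a b]h1 // (om_Qz hv) (orth_om vW) // (orth_omC vW) //.
  by rewrite !mul0r !mulr0 !addr0.
move=> _ /memv_addP[a aW [_ /vlineP[c ->] ->]]; apply: QzD.
- by rewrite omZr (orth_om vW) // mul0r.
- exact: h2.
- exact: QzZ.
Qed.

(** If [M :&: orth W] lay in [W], it would lie in [W :&: orth M], and [pair_dim] would give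
    [\dim M <= \dim W]. So maximal isotropic subspaces all have the same dimension, without an
    appeal to Witt's theorem. *)
Lemma iso_extend W M : iso W -> iso M -> (\dim W < \dim M)%N ->
  exists v, [/\ v \in orth W, Qz v & v \notin W].
Proof.
move=> iW iM d.
have /subvPn[v] : ~~ (M :&: orth W <= W)%VS.
  apply/negP => h.
  have e : (\dim (M :&: orth W) <= \dim (W :&: orth M))%N.
    apply/dimvS; rewrite subv_cap h /=.
    exact: subv_trans (capvSl _ _) (iso_orth iM).
  by have := pair_dim M W; move: e d; clear; lia.
rewrite memv_cap => /andP[vM vW] nvW; exists v; split=> //.
by case: iM => _; apply.
Qed.


(** * Connectivity of posets of isotropic subspaces *)

Variable g : nat.
Hypothesis g_max : forall W, iso W -> (\dim W <= g)%N.
Hypothesis g_att : exists2 M, iso M & \dim M = g.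
Variable Rv : {vspace E}.
Hypothesis RvP : forall v, v \in Rv <-> v \in Kv /\ Qz v.

Let le := @vsub_le F E.

Lemma isotropic_vector A : iso A -> (\dim A < g)%N ->
  exists v, [/\ v \in orth A, Qz v & v \notin A].
Proof. by move=> iA dA; have [M iM dM] := g_att; apply: iso_extend iA iM _; rewrite dM. Qed.

Definition iso_above A : set {vspace E} := [set W | iso W /\ plt le A W].

(** The [W] in [orth <[v]>] contract to [A + <[v]>], and those with [W :&: orth <[v]>] larger than
    [A] deform to them. What remains has dimension [\dim A + 1] and is attached along the same kind
    of poset above it. *)
Lemma iso_above_con A N : iso A -> (N + \dim A <= g)%N -> scon N (iso_above A).
Proof.
elim: N A => [|N IH] A iA dN; first exact: con_zero.
have [|v [vA Qv nvA]] := isotropic_vector iA; first by move: dN; clear; lia.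
pose o := orth <[v]>%VS.
have vo : v \in o by apply/orth_line; exact: om_Qz.
have Ao : (A <= o)%VS by apply: sub_orthC; rewrite -memvE.
have addo W : iso W -> (W <= o)%VS -> iso (W + <[v]>).
  by move=> iW Wo; apply: iso_add => //; rewrite memvE sub_orthC.
have nA W : (A <= W)%VS -> ~~ (W <= A)%VS -> plt le A W.
  by move=> AW nW; rewrite /plt /le /vsub_le AW; apply: contraNneq nW => ->.
have pA W : plt le A W -> ~~ (W <= A)%VS.
  by move=> /andP[AW]; apply: contra => WA; rewrite eqEsubv [(_ <= _)%VS]AW WA.
pose S0 := [set W | iso_above A W /\ ~~ (W :&: o <= A)%VS].
pose S1 := [set W | iso_above A W /\ (W <= o)%VS].
have c1 : scon N.+1 S1.
  apply: (@conical_up _ _ _ _ (A + <[v]>)%VS (fun W => (W + <[v]>)%VS)).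
  - split; last by rewrite subv_add Ao -memvE.
    split; first exact: addo.
    apply: nA; first exact: addvSl.
    by rewrite subv_add subvv -memvE.
  - move=> W [[iW AW] Wo]; split; [|exact: addvSl|].
      split; last by rewrite subv_add Wo -memvE.
      split; first exact: addo.
      have /andP[l _] := AW; apply: nA; first exact: subv_trans l (addvSl _ _).
      by rewrite subv_add -memvE (negPf nvA) andbF.
    by apply: addvS => //; case/andP: AW.
  - by move=> W W' _ _ l; exact: addvS.
have c0 : scon N.+1 S0.
  apply: (@scon_inc _ _ _ S1) => //.
    by move=> W [aW Wo]; split=> //; rewrite (capv_idPl Wo); apply: pA; case: aW.
  move=> V [aV nV] nS1.
  have Vo : ~~ (V <= o)%VS by apply/negP => h; apply: nS1.
  have lV W : (W <= V)%VS -> (W <= o)%VS -> plt le W V.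
    by move=> WV Wo; rewrite /plt /le /vsub_le WV; apply: contraNneq Vo => <-.
  exists N.+1, 0%N; split; [by clear; lia| |exact: con_zero].
  have S0o W : S0 W -> S0 (W :&: o)%VS.
    move=> [[iW AW] nW]; split; last by rewrite -capvA capvv.
    split; first exact: isoS (capvSl _ _) iW.
    by apply: nA => //; rewrite subv_cap Ao andbT; case/andP: AW.
  apply: (@conical_down _ _ _ _ (V :&: o)%VS (fun W => (W :&: o)%VS)).
  - by split; [exact: S0o|apply: lV; [exact: capvSl|exact: capvSr]].
  - move=> W [S0W WV]; have WV' : (W <= V)%VS by case/andP: WV.
    split; [|exact: capvSl|exact: capvS].
    split; first exact: S0o.
    by apply: lV; [exact: subv_trans (capvSl _ _) WV'|exact: capvSr].
  - by move=> W W' _ _ l; exact: capvS.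
apply: (@scon_inc _ _ _ S0) => //; first by move=> W [].
move=> V aV nS0; have [iV AV] := aV.
have VoA : (V :&: o <= A)%VS by apply: contrapT => /negP h; apply: nS0.
have dV : \dim V = (\dim A).+1.
  by have := codim_line V v; have := dimvS VoA; have := plt_dim AV; rewrite -/o; clear; lia.
exists 0%N, N; split; [by clear; lia|exact: con_zero|].
have -> : [set W | S0 W /\ plt le V W] = iso_above V.
  apply/seteqP; split=> W /=; first by move=> [[[iW _] _] VW].
  move=> [iW VW]; split=> //; split.
    split=> //; exact: (plt_trans (@vle_trans _ _) (@vle_anti _ _) AV VW).
  (* A subspace strictly above [V] has dimension at least [\dim A + 2], and [o] cuts it in
     codimension at most 1. *)
  apply/negP => /dimvS; have := codim_line W v; have := plt_dim VW; rewrite dV -/o.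
  by clear; lia.
by apply: IH => //; move: dN dV; clear; lia.
Qed.

(** [A] and [Z] are separate parameters because the induction enlarges [A] by [w] while [Z] shrinks
    to [Z']; the poset of the theorem is the case where [A] is the radical. *)
Definition opposite A Z : set {vspace E} :=
  [set W | [/\ iso W, (A <= W)%VS & (Z :&: orth W)%VS = 0%VS]].

Lemma cap0_sub Z X Y : (X <= Y)%VS -> (Z :&: Y)%VS = 0%VS -> (Z :&: X)%VS = 0%VS.
Proof. by move=> XY e; apply/eqP; rewrite -subv0 -e capvS. Qed.

Lemma opposite_up A Z V W : opposite A Z V -> iso W -> (V <= W)%VS -> opposite A Z W.
Proof.
move=> [iV AV ZV] iW VW; split=> //; first exact: subv_trans AV VW.
by apply: cap0_sub ZV; exact: orthS.
Qed.

(** The pairing makes [V / (V :&: orth Z)] dual to [Z], and a subspace of [V] still separates [Z]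
    iff it maps onto this quotient. So the lower links are purely linear. *)
Lemma opposite_below A Z V : (Z <= orth A)%VS -> opposite A Z V ->
  [set W | opposite A Z W /\ plt le W V] = supplements A V (V :&: orth Z)%VS V.
Proof.
move=> ZA [iV AV ZV].
have nle W : (W <= V)%VS -> (W != V) = ~~ (V <= W)%VS by move=> WV; rewrite eqEsubv WV.
apply/seteqP; split=> W /=.
  move=> [[iW AW ZW] /andP[WV' nWV]]; have WV : (W <= V)%VS := WV'.
  split=> //; last by rewrite -nle.
  apply/eqP; rewrite eqEdim subv_add WV capvSl /=.
  have := dimv_sum_cap W (V :&: orth Z)%VS; rewrite capvA (capv_idPl WV).
  by have := dual_dim ZW; have := dual_dim ZV; clear; lia.
move=> [AW WV nWV e _]; split; last by rewrite /plt /le /vsub_le WV.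
split=> //; first exact: isoS WV iV.
apply/eqP; rewrite -subv0 -ZV subv_cap capvSl /=; apply/subvP => x.
rewrite memv_cap => /andP[xZ xW]; rewrite -e orth_add memv_cap xW /=.
by apply/orthP => v; rewrite memv_cap => /andP[_ vZ]; exact: orth_omC vZ xZ.
Qed.

Lemma opposite_line A z W : z != 0 ->
  opposite A <[z]> W <-> [/\ iso W, (A <= W)%VS & ~~ (W <= orth <[z]>)%VS].
Proof.
move=> z0.
have hz : (W <= orth <[z]>)%VS = (z \in orth W).
  by apply/idP/idP => h; [rewrite memvE sub_orthC|apply: sub_orthC; rewrite -memvE].
split=> [[iW AW e]|[iW AW n]]; split=> //; last first.
  apply/eqP; rewrite -subv0; apply/subvP => x; rewrite memv_cap => /andP[/vlineP[c ->]].
  by rewrite rpredZeq -hz (negPf n) orbF => /eqP ->; rewrite scale0r mem0v.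
rewrite hz; apply: contra z0 => zW.
have : z \in (<[z]> :&: orth W)%VS by rewrite memv_cap memv_line.
by rewrite e memv0.
Qed.

(* The contraction towards [w] covers the [W] with [W :&: orth <[w]>] still opposite
   to [Z]. For any other [W] there is a unique [z1] in [Z] with [w - z1] orthogonal to [W];
   those with [w - z1 \notin W + Kv] are added by increasing dimension, the
   others by decreasing dimension. *)
Lemma opposite_step A Z Z' z w N :
  iso A -> (Rv <= A)%VS -> (Z <= orth A)%VS -> (Z :&: (A + Kv))%VS = 0%VS ->
  (Z' + <[z]>)%VS = Z -> (Z <= orth Z')%VS ->
  w \in orth A -> w \in orth Z' -> Qz w -> om z w != 0 ->
  (N + \dim A + \dim Z <= g.+1)%N ->
  scon N (opposite (A + <[w]>) Z') ->
  (forall A' y N', iso A' -> (A <= A')%VS -> (\dim A < \dim A')%N -> y \in orth A' ->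
     y \notin (A' + Kv)%VS -> (N' + \dim A' <= g)%N -> scon N' (opposite A' <[y]>)) ->
  scon N (opposite A Z).
Proof.
move=> iA RA ZA ZAK eZ ZZ' wA wZ' Qw zw dN cw HC.
pose S := opposite A Z; pose o := orth <[w]>%VS.
have zZ : z \in Z by rewrite -eZ; apply: (subvP (addvSr _ _)); exact: memv_line.
have zn0 : z != 0.
  by apply: contraNneq zw => ->; apply/eqP; apply: om_eq0C; exact: om0r.
have Z'Z : (Z' <= Z)%VS by rewrite -eZ addvSl.
have wo : w \in o by apply/orth_line; exact: om_Qz.
have Ao : (A <= o)%VS by apply: sub_orthC; rewrite -memvE.
have subo W : (W <= o)%VS = (w \in orth W).
  by apply/idP/idP => h; [rewrite memvE sub_orthC|apply: sub_orthC; rewrite -memvE].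
have addo W : iso W -> (W <= o)%VS -> iso (W + <[w]>).
  by move=> iW Wo; apply: iso_add => //; rewrite -subo.
have nSA : ~ S A.
  move=> [_ _]; rewrite (capv_idPl ZA) => Z0.
  by move: zZ; rewrite Z0 memv0 (negPf zn0).
have uniq1 W z1 z2 : S W -> z1 \in Z -> z2 \in Z -> w - z1 \in orth W -> w - z2 \in orth W -> z1 = z2.
  move=> [_ _ e] h1 h2 o1 o2; apply/eqP; rewrite -subr_eq0 -memv0 -e memv_cap rpredB //=.
  have -> : z1 - z2 = (w - z2) - (w - z1) by rewrite opprB [RHS]addrC addrA subrK.
  exact: rpredB.
pose Sa := [set W | S W /\ w \in W].
pose Sb := [set W | S W /\ (W <= o)%VS].
pose Sc := [set W | S W /\ S (W :&: o)%VS].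
(* If [w \in W], a vector [z' + c *: z] orthogonal to [W] is orthogonal to [w], which is orthogonal
   to [z'] but not to [z]. Hence [c = 0], and only [Z'] has to be tested. *)
have ca : scon N Sa.
  have -> : Sa = opposite (A + <[w]>) Z'; last exact: cw.
  apply/seteqP; split=> W /=.
    move=> [[iW AW e] wW]; split=> //; first by rewrite subv_add AW -memvE.
    by apply/eqP; rewrite -subv0 -e capvS.
  move=> [iW]; rewrite subv_add -memvE => /andP[AW wW] e; split=> //; split=> //.
  apply/eqP; rewrite -subv0; apply/subvP => x; rewrite memv_cap => /andP[xZ xW].
  rewrite -e memv_cap xW andbT; move: (xZ); rewrite -eZ => /memv_addP[z' z'Z [_ /vlineP[c ->] ex]].
  have := orth_omC xW wW; rewrite ex omDl omZl (orth_om wZ' z'Z) add0r => /eqP.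
  by rewrite mulf_eq0 (negPf zw) orbF sigma_eq0 => /eqP ->; rewrite scale0r addr0.
(* Attached from the top: the upper link of [V] contracts to [V + <[w]>], so nothing is asked of the
   lower one. *)
have cb : scon N Sb.
  apply: (@scon_dec _ _ _ Sa) => //.
    move=> W [SW wW]; split=> //; rewrite subo.
    by case: SW => /iso_orth/subvP h _ _; exact: h.
  move=> V [SV Vo] nSa.
  have wV : w \notin V by apply/negP => h; apply: nSa.
  have up W : (V <= W)%VS -> iso W -> (W <= o)%VS -> Sb (W + <[w]>)%VS.
    move=> VW iW Wo; split; last by rewrite subv_add Wo -memvE.
    by apply: (opposite_up SV); [exact: addo|exact: subv_trans VW (addvSl _ _)].
  have ltV W : (V <= W)%VS -> plt le V (W + <[w]>)%VS.
    move=> VW; rewrite /plt /le /vsub_le (subv_trans VW (addvSl _ _)) /=.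
    by apply: contraNneq wV => ->; apply: (subvP (addvSr _ _)); exact: memv_line.
  exists 0%N, N; split; [by clear; lia|exact: con_zero|].
  apply: (@conical_up _ _ _ _ (V + <[w]>)%VS (fun W => (W + <[w]>)%VS)).
  - by split; [apply: up => //; case: SV|exact: ltV].
  - move=> W [[SW Wo] /andP[VW' _]]; have VW : (V <= W)%VS := VW'.
    split; [|exact: addvSl|exact: addvS].
    by split; [apply: up => //; case: SW|exact: ltV].
  - by move=> W W' _ _ l; exact: addvS.
(* Attached from the bottom: the lower link of [V] contracts to [V :&: o]. *)
have cc : scon N Sc.
  apply: (@scon_inc _ _ _ Sb) => //.
    by move=> W [SW Wo]; split=> //; rewrite (capv_idPl Wo).
  move=> V [SV SVo] nSb.
  have Vo : ~~ (V <= o)%VS by apply/negP => h; apply: nSb.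
  have lV W : (W <= V)%VS -> (W <= o)%VS -> plt le W V.
    by move=> WV Wo; rewrite /plt /le /vsub_le WV; apply: contraNneq Vo => <-.
  have Sco W : S (W :&: o)%VS -> Sc (W :&: o)%VS.
    by move=> SW; split=> //; rewrite -capvA capvv.
  exists N, 0%N; split; [by clear; lia| |exact: con_zero].
  apply: (@conical_down _ _ _ _ (V :&: o)%VS (fun W => (W :&: o)%VS)).
  - by split; [exact: Sco|apply: lV; [exact: capvSl|exact: capvSr]].
  - move=> W [[SW SWo] /andP[WV' _]]; have WV : (W <= V)%VS := WV'.
    split; [|exact: capvSl|exact: capvS].
    split; first exact: Sco.
    by apply: lV; [exact: subv_trans (capvSl _ _) WV|exact: capvSr].
  - by move=> W W' _ _ l; exact: capvS.
pose bad W z1 := [/\ z1 \in Z, z1 != 0 & w - z1 \in orth W].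
have badP V : S V -> ~ Sc V -> exists z1, bad V z1.
  move=> SV nSc; have [iV AV eV] := SV.
  have [Vo|/subvPn[v0 v0V v0o]] := boolP (V <= o)%VS.
    by case: nSc; split=> //; rewrite (capv_idPl Vo).
  have wv0 : om w v0 != 0 by apply: contra v0o => /eqP h; apply/orth_line.
  (* [V :&: o] is a hyperplane of [V], so [z0] and [w], both orthogonal to it, are proportional as
     functionals on [V]. The factor [c] is nonzero because [Z] meets [orth V] in 0; dividing by it
     gives [z1]. *)
  have [z0 [z0Z z0n z0o]] : exists z0, [/\ z0 \in Z, z0 != 0 & z0 \in orth (V :&: o)].
    apply: contrapT => nex; apply: nSc; split=> //; split.
    - exact: isoS (capvSl _ _) iV.
    - by rewrite subv_cap AV.
    - apply/eqP; rewrite -subv0; apply/subvP => x; rewrite memv_cap memv0 => /andP[xZ xo].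
      by apply: contrapT => /negP x0; apply: nex; exists x.
  pose c := sigma (om z0 v0 / om w v0).
  have zc : z0 - c *: w \in orth V.
    apply/orthP => v vV; apply: om_eq0C; pose l := om w v / om w v0.
    have : om z0 (v - l *: v0) = 0.
      apply: orth_omC z0o _; rewrite memv_cap rpredB ?memvZ //=; apply/orth_line.
      by rewrite omDr omNr omZr /l mulrC divfK // subrr.
    rewrite omDr omNr omZr => /eqP; rewrite subr_eq0 => /eqP e.
    by rewrite omDl omNl omZl /c sigmaK e /l; field.
  have c0 : c != 0.
    apply: contraNneq z0n => c0; rewrite -memv0 -eV memv_cap z0Z /=.
    by move: zc; rewrite c0 scale0r subr0.
  exists (c^-1 *: z0); split; first by rewrite memvZ.
    by rewrite scaler_eq0 invr_eq0 negb_or c0.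
  have -> : w - c^-1 *: z0 = - (c^-1 *: (z0 - c *: w)).
    by rewrite scalerBr scalerA mulVf // scale1r opprB.
  by rewrite rpredN memvZ.
have nbad V z1 : bad V z1 -> ~ Sc V.
  move=> [z1Z z1n h] [_ [_ _ e]]; case/eqP: z1n; apply/eqP; rewrite -memv0 -e memv_cap z1Z /=.
  apply/orthP => v; rewrite memv_cap => /andP[vV /orth_line vo].
  have := orth_om h vV; rewrite omDr omNr (om_eq0C vo) sub0r => /eqP.
  by rewrite oppr_eq0 => /eqP.
have badS V W z1 : (W <= V)%VS -> bad V z1 -> bad W z1.
  by move=> WV [h1 h2 h3]; split=> //; move/subvP: (orthS WV); apply.
pose Sd := [set W | S W /\ (Sc W \/ exists z1, bad W z1 /\ w - z1 \notin (W + Kv)%VS)].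
have dims V : S V -> (\dim (V :&: orth Z) + \dim Z = \dim V)%N /\
    (\dim A <= \dim (V :&: orth Z))%N /\ (\dim V <= g)%N.
  move=> [iV AV eV]; split; first exact: dual_dim.
  by split; [apply: dimvS; rewrite subv_cap AV sub_orthC|exact: g_max].
have nVA V : S V -> ~~ (V <= A)%VS.
  move=> SV; apply/negP => VA; apply: nSA; suff <- : V = A by [].
  by apply/eqP; rewrite eqEsubv VA; case: SV => _ ->.
have cd : scon N Sd.
  apply: (@scon_inc _ _ _ Sc) => //; first by move=> W h; split; [case: h|left].
  move=> V [SV hV] nSc; case: hV => // -[z1 [bV yV]].
  pose y := w - z1; have [iV AV eV] := SV.
  have [z1Z z1n yo] := bV.
  exists (\dim (V :&: orth Z) - \dim A)%N, (g - \dim V)%N; split.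
  - by have := dims V SV; move: dN; clear; lia.
  - have -> : [set W | Sd W /\ plt le W V] = [set W | S W /\ plt le W V].
      apply/seteqP; split=> W /=; first by move=> [[SW _] l].
      move=> [SW l]; have WV : (W <= V)%VS by case/andP: l.
      split=> //; split=> //; right; exists z1; split; first exact: badS bV.
      by apply: contra yV; move/subvP: (addvS WV (subvv Kv)); apply.
    rewrite (opposite_below ZA SV); apply: supplements_con.
    + by rewrite subv_cap AV sub_orthC.
    + exact: capvSl.
    + exact: nVA.
  - have yn0 : y != 0 by apply: contraNneq yV => e; rewrite -/y e; exact: mem0v.
    (* A [W] above [V] is outside [Sc] iff it is orthogonal to some [w - z2] with [z2] in [Z]; by
       uniqueness on [V], [z2] is [z1]. *)
    have -> : [set W | Sc W /\ plt le V W] = opposite V <[y]>.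
      apply/seteqP; split=> W /=.
        move=> [ScW /andP[VW _]]; apply/opposite_line => //; split=> //; first by case: ScW => -[].
        apply/negP => Wy; apply: (nbad W z1) ScW; split=> //.
        by rewrite memvE sub_orthC.
      move=> /(opposite_line _ _ yn0)[iW VW nWy].
      have SW : S W by exact: opposite_up SV iW VW.
      split.
        apply: contrapT => /(badP _ SW)[z2 bz2]; have [z2Z _ yo2] := badS _ _ _ VW bz2.
        have e := uniq1 V z1 z2 SV z1Z z2Z yo yo2.
        case/negP: nWy; apply: sub_orthC; rewrite -memvE /y e.
        by case: bz2.
      rewrite /plt /le /vsub_le VW /=; apply: contraNneq nWy => <-.
      by apply: sub_orthC; rewrite -memvE.
    apply: HC => //.
    + rewrite ltnNge; apply: contra (nVA V SV) => d.
      by have [d1 <-] := dimv_leqif_sup AV; rewrite eqn_leq d1 d.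
    + by have := g_max iV; clear; lia.
apply: (@scon_dec _ _ _ Sd) => //; first by move=> W [].
move=> V SV nSd; have [iV AV eV] := SV.
have nSc : ~ Sc V by move=> h; apply: nSd; split=> //; left.
have [z1 bV] := badP V SV nSc; have [z1Z z1n yo] := bV.
have yVK : w - z1 \in (V + Kv)%VS.
  by apply: contrapT => /negP h; apply: nSd; split=> //; right; exists z1.
have /memv_addP[t tV [k kK ey]] := yVK.
(* Otherwise [z] and [w] would both be orthogonal to [w - z1], that is, [om z w = om z z1] and
   [om w z1 = 0]. The second confines [z1] to [Z'], which is orthogonal to [z], and the first then
   contradicts [om z w != 0]. *)
have tA : t \notin A.
  apply/negP => tA.
  have zy : om z w = om z z1.
    have : om z (w - z1) = 0.
      rewrite ey omDr (Kv_om _ kK) addr0; apply: om_eq0C.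
      by apply: orth_om (tA); move/subvP: ZA; apply.
    by rewrite omDr omNr => /eqP; rewrite subr_eq0 => /eqP.
  have wz1 : om w z1 = 0.
    have : om w (w - z1) = 0.
      by rewrite ey omDr (Kv_om _ kK) addr0; exact: orth_omC wA tA.
    by rewrite omDr omNr (om_Qz Qw) sub0r => /eqP; rewrite oppr_eq0 => /eqP.
  move: z1Z; rewrite -eZ => /memv_addP[z' z'Z [_ /vlineP[c ->] ez]].
  move: wz1; rewrite ez omDr omZr (orth_omC wZ' z'Z) add0r => /eqP; rewrite mulf_eq0.
  have wz : om w z != 0 by apply: contra zw => /eqP h; apply/eqP; exact: om_eq0C.
  rewrite (negPf wz) /= => /eqP c0; case/negP: zw; rewrite zy ez c0 scale0r addr0.
  by apply/eqP; apply: orth_omC z'Z; move/subvP: ZZ'; apply.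
exists (\dim (V :&: orth Z) - \dim A)%N, (g - \dim V)%N; split.
- by have := dims V SV; move: dN; clear; lia.
- have -> : [set W | Sd W /\ plt le W V] = supplements A V (V :&: orth Z)%VS <[t]>.
    (* [t] represents [w - z1] modulo [Kv]. A representative in [W] differs from [t] by an isotropic
       vector of [Kv], an element of [Rv] and hence of [W]; so [w - z1 \in W + Kv] iff [t \in W]. *)
    have tE W : S W -> (W <= V)%VS -> Sd W <-> t \notin W.
      move=> SW WV; have bW := badS _ _ _ WV bV; have [_ _ yW] := bW; split.
        move=> [_ [/(nbad _ _ bW)//|[z2 [bz2 n2]]]]; have [z2Z _ y2] := bz2.
        have e := uniq1 W z1 z2 SW z1Z z2Z yW y2; rewrite -e ey in n2.
        by apply: contra n2 => tW; exact: memv_add.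
      move=> tW; split=> //; right; exists z1; split=> //.
      apply: contra tW => /memv_addP[s sW [k' k'K e]].
      have tsV : t - s \in V by rewrite rpredB //; move/subvP: WV; apply.
      have tsK : t - s \in Kv.
        suff -> : t - s = k' - k by rewrite rpredB.
        by apply/eqP; rewrite subr_eq addrAC eq_sym subr_eq addrC -e ey.
      have : t - s \in Rv by apply/RvP; split=> //; case: iV => _; apply.
      move=> h; rewrite -(subrK s t) rpredD //.
      by case: SW => _ AW _; move/subvP: (subv_trans RA AW); apply.
    have sE := opposite_below ZA SV.
    apply/seteqP; split=> W /=.
      move=> [SdW l]; have SW : S W by case: SdW.
      have [h1 h2 h3 h4 _] : supplements A V (V :&: orth Z)%VS V W by rewrite -sE.
      by split=> //; rewrite -memvE; apply/tE.
    move=> [h1 h2 h3 h4]; rewrite -memvE => h5.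
    have : [set W | S W /\ plt le W V] W.
      by rewrite sE; split=> //; apply: contra h3 => VW; rewrite eqEsubv h2.
    by move=> [SW l]; split=> //; apply/tE.
  apply: supplements_con.
  + by rewrite subv_cap AV sub_orthC.
  + exact: capvSl.
  + by rewrite -memvE.
- have -> : [set W | S W /\ plt le V W] = iso_above V.
    apply/seteqP; split=> W /=; first by move=> [[iW _ _] l].
    by move=> [iW l]; split=> //; apply: (opposite_up SV iW); case/andP: l.
  by apply: iso_above_con => //; have := g_max iV; clear; lia.
Qed.


(** An isotropic [p] in [orth A] outside [A] either works or is orthogonal to [z]. In the second
    case some [x] in [orth A] is orthogonal neither to [z] nor to [p], and a multiple of [p] makes
    it isotropic without changing [om z x]. *)
Lemma isotropic_off_orth A z : iso A -> (Rv <= A)%VS -> (\dim A < g)%N ->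
  z \in orth A -> z \notin (A + Kv)%VS ->
  exists w, [/\ w \in orth A, Qz w & om z w != 0].
Proof.
move=> iA RA dA zA zAK.
have sep x : x \notin (A + Kv)%VS -> exists2 v, v \in orth A & om x v != 0.
  move=> xA; apply: contrapT => nex; case/negP: xA; apply: double_orth => v vA.
  by apply: contrapT => /eqP h; apply: nex; exists v.
have [p [pA Qp npA]] := isotropic_vector iA dA.
have [zp|zp] := eqVneq (om z p) 0; last by exists p.
have pAK : p \notin (A + Kv)%VS.
  apply: contra npA => /memv_addP[a aA [k kK e]].
  have kR : k \in Rv.
    apply/RvP; split=> //; rewrite -(addKr a k) -e; apply: QzD => //.
      by rewrite omNl (orth_om pA) // oppr0.
    by rewrite -scaleN1r; apply: QzZ; case: iA => _; apply.
  by rewrite e rpredD //; move/subvP: RA; apply.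
have [v vA zv] := sep z zAK; have [u uA pu] := sep p pAK.
have [x [xA zx px]] : exists x, [/\ x \in orth A, om z x != 0 & om p x != 0].
  have [zu|zu] := eqVneq (om z u) 0; last by exists u.
  have [pv|pv] := eqVneq (om p v) 0; last by exists v.
  by exists (v + u); split; [rewrite rpredD|rewrite omDr zu addr0|rewrite omDr pv add0r].
have [c Qc] := isotropize Qp px.
by exists (x + c *: p); split; [rewrite rpredD ?memvZ| |rewrite omDr omZr zp mul0r addr0].
Qed.

Lemma orth0 : orth 0%VS = fullv.
Proof.
apply/vspaceP => v; rewrite memvf; apply/orthP => u; rewrite memv0 => /eqP ->.
by apply: om_eq0C; exact: om0r.
Qed.

(** With [Z' = 0] the subspaces containing [w] have the least element [A + <[w]>], and
    [Z <= orth Z'] holds for anisotropic [z] too. The links lead to the same statement over a larger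
    [A'], hence the induction on [g - \dim A]. *)
Lemma opposite_line_con A z N : iso A -> (Rv <= A)%VS -> z \in orth A ->
  z \notin (A + Kv)%VS -> (N + \dim A <= g)%N -> scon N (opposite A <[z]>).
Proof.
have [n] := ubnP (g - \dim A)%N; elim: n A z N => // n IH A z N dn iA RA zA zAK dN.
case: N dN => [|N] dN; first exact: con_zero.
have dA : (\dim A < g)%N by move: dN; clear; lia.
have [w [wA Qw zw]] := isotropic_off_orth iA RA dA zA zAK.
apply: (@opposite_step A <[z]> 0%VS z w) => //.
- apply/eqP; rewrite -subv0; apply/subvP => x; rewrite memv_cap => /andP[/vlineP[c ->]].
  by rewrite rpredZeq (negPf zAK) orbF => /eqP ->; rewrite scale0r mem0v.
- by rewrite add0v.
- by rewrite orth0 subvf.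
- by rewrite orth0 memvf.
- by rewrite dim_vline; case: (z != 0); move: dN; clear; lia.
- apply: (@scon_min _ _ _ _ (A + <[w]>)%VS); last by move=> W [].
  by split=> //; [exact: iso_add|exact: cap0v].
- move=> A' y N' iA' AA' dA' yA' yAK dN'.
  apply: IH => //; first by move: dn dA' dA; clear; lia.
  exact: subv_trans AA'.
Qed.

Lemma opposite_con A Z N : iso A -> (Rv <= A)%VS -> iso Z -> (Z <= orth A)%VS ->
  (Z :&: (A + Kv))%VS = 0%VS -> (N + \dim A + \dim Z <= g.+1)%N -> scon N (opposite A Z).
Proof.
have [n] := ubnP (\dim Z); elim: n A Z N => // n IH A Z N dn iA RA iZ ZA ZAK dN.
have [Z0|Z0] := eqVneq Z 0%VS.
  apply: (@scon_min _ _ _ _ A); last by move=> W [].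
  by split=> //; rewrite Z0 cap0v.
have /subvPn[z zZ z0] : ~~ (Z <= 0)%VS by rewrite subv0.
have [Z' [_ Z'Z zZ' eZ]] := hyperplane_avoid1 (sub0v Z) zZ z0.
have dZ' : (\dim Z' < \dim Z)%N.
  by apply: plt_dim; rewrite /plt /vsub_le Z'Z; apply: contraNneq zZ' => ->.
have ZZ' : (Z <= orth Z')%VS by apply: subv_trans (iso_orth iZ) (orthS Z'Z).
have zA : z \in orth A by move/subvP: ZA; apply.
have Qzz : Qz z by case: iZ => _; apply.
have cap0 x : x \in Z -> x \in (A + Kv)%VS -> x = 0.
  by move=> h1 h2; apply/eqP; rewrite -memv0 -ZAK memv_cap h1.
(* Without such a [v], [double_orth] would put [z] into [A + Z' + Kv], and then into [Z'], as [Z]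
   meets [A + Kv] in 0. The multiple of [z] that makes [v] isotropic does not disturb orthogonality
   to [A] and [Z']. *)
have [v vo zv] : exists2 v, v \in orth (A + Z') & om z v != 0.
  apply: contrapT => nex.
  have : z \in (A + Z' + Kv)%VS.
    apply: double_orth => v vo; apply: contrapT => /eqP h; apply: nex; by exists v.
  move=> /memv_addP[_ /memv_addP[a aA [z' z'Z ->]] [k kK e]].
  have e0 : z - z' = 0.
    apply: cap0; first by rewrite rpredB //; move/subvP: Z'Z; apply.
    by rewrite e addrAC addrK memv_add.
  by case/negP: zZ'; rewrite -(subrK z' z) e0 add0r.
have [c Qw] := isotropize Qzz zv.
move: vo; rewrite orth_add memv_cap => /andP[vA vZ'].
pose w := v + c *: z.
have wA : w \in orth A by rewrite rpredD ?memvZ.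
have wZ' : w \in orth Z' by rewrite rpredD ?memvZ //; move/subvP: ZZ'; apply.
have zw : om z w != 0 by rewrite omDr omZr (om_Qz Qzz) mul0r addr0.
apply: (@opposite_step A Z Z' z w) => //.
  have dAw : (\dim (A + <[w]>) <= (\dim A).+1)%N.
    by have := dimv_sum_cap A <[w]>%VS; rewrite dim_vline; case: (w != 0); clear; lia.
  apply: IH.
  - by move: dZ' dn; clear; lia.
  - exact: iso_add.
  - exact: subv_trans RA (addvSl _ _).
  - exact: isoS Z'Z iZ.
  - rewrite orth_add subv_cap (subv_trans Z'Z ZA) /=; apply: sub_orthC.
    by rewrite -memvE.
  - apply/eqP; rewrite -subv0; apply/subvP => x; rewrite memv_cap memv0 => /andP[xZ'].
    move=> /memv_addP[_ /memv_addP[a aA [_ /vlineP[d ->] ->]] [k kK e]].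
    have xZ : x \in Z by move/subvP: Z'Z; apply.
    have : om z x = 0 by case: iZ => h _; exact: h.
    rewrite e !omDr omZr (Kv_om _ kK) addr0 (orth_omC zA aA) add0r => /eqP.
    rewrite mulf_eq0 (negPf zw) /= => /eqP d0.
    have xAK : x \in (A + Kv)%VS by rewrite e d0 scale0r addr0 memv_add.
    by rewrite -e (cap0 x xZ xAK).
  - by move: dAw dZ' dN; clear; lia.
move=> A' y N' iA' AA' dA' yA' yAK dN'.
by apply: opposite_line_con => //; exact: subv_trans AA'.
Qed.


Lemma iso_Rv : iso Rv.
Proof.
by split=> [v w vR /RvP[wK _]|v /RvP[]//]; exact: Kv_om.
Qed.

Lemma opposite_cohen_macaulay Z : iso Z -> (Z :&: Kv)%VS = 0%VS -> cohen_macaulay le (opposite Rv Z).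
Proof.
move=> iZ ZK.
have RK : (Rv <= Kv)%VS by apply/subvP => v /RvP[].
have ZR : (Z <= orth Rv)%VS by apply: sub_orthC; apply: subv_trans RK (orthS (subvf Z)).
have ZRK : (Z :&: (Rv + Kv))%VS = 0%VS by rewrite (addv_idPr RK).
have dRZ : (\dim Rv + \dim Z <= g)%N.
  have iRZ : iso (Rv + Z).
    split=> [_ _ /memv_addP[a /RvP[aK _] [b bZ ->]] /memv_addP[c /RvP[cK _] [d dZ ->]]|].
      rewrite -/om !omDl !omDr (Kv_omC _ aK) (Kv_omC _ aK) (Kv_om _ cK) !add0r.
      by case: iZ => h _; exact: h.
    move=> _ /memv_addP[a /RvP[aK Qa] [b bZ ->]]; apply: QzD => //; first exact: Kv_omC.
    by case: iZ => _; apply.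
  have := g_max iRZ; have := dimv_sum_cap Rv Z.
  rewrite capvC (cap0_sub RK ZK) dimv0; clear; lia.
pose X := opposite Rv Z; pose lo := (\dim Rv + \dim Z)%N.
have X_dim W : X W -> (lo <= \dim W <= g)%N.
  move=> [iW RW ZW]; rewrite g_max // andbT -(dual_dim ZW) leq_add2r dimvS //.
  by rewrite subv_cap RW sub_orthC.
have X_up W d : X W -> (\dim W <= d)%N -> (d <= g)%N ->
    exists W', [/\ X W', (W <= W')%VS & \dim W' = d].
  have [n] := ubnP (d - \dim W)%N; elim: n W => // n IH W dn XW Wd dg.
  have [e|ne] := eqVneq (\dim W) d; first by exists W.
  have iW : iso W by case: XW.
  have [|v [vW Qv nvW]] := isotropic_vector iW; first by move/eqP: ne; move: Wd dg; clear; lia.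
  have d1 : \dim (W + <[v]>) = (\dim W).+1.
    have : (\dim W < \dim (W + <[v]>))%N.
      apply: plt_dim; rewrite /plt /vsub_le addvSl /=; apply: contraNneq nvW => ->.
      by apply: (subvP (addvSr _ _)); exact: memv_line.
    by have := dimv_sum_cap W <[v]>%VS; rewrite dim_vline; case: (v != 0); clear; lia.
  have [||||W' [h1 h2 h3]] := IH (W + <[v]>)%VS => //.
  - by rewrite d1; move/eqP: ne; move: dn Wd; clear; lia.
  - by apply: (opposite_up XW); [exact: iso_add|exact: addvSl].
  - by rewrite d1; move/eqP: ne; move: Wd; clear; lia.
  by exists W'; split=> //; exact: subv_trans (addvSl _ _) h2.
have X_down W d : X W -> (lo <= d)%N -> (d <= \dim W)%N ->
    exists W', [/\ X W', (W' <= W)%VS & \dim W' = d].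
  move=> XW lod dW; have [iW RW ZW] := XW.
  (* Every [W'] between [W0] and [W] supplements [D] in [W], hence is still opposite to [Z]; and
     [\dim W0 <= lo] leaves room for every dimension from [lo] on. *)
  pose D := (W :&: orth Z)%VS; pose W0 := (Rv + (W :\: D))%VS.
  have W0W : (W0 <= W)%VS by rewrite subv_add RW diffvSl.
  have dW0 : (\dim W0 <= lo)%N.
    have := dimv_sum_cap Rv (W :\: D)%VS; have := dimv_cap_compl W D.
    have -> : (W :&: D)%VS = D by apply/capv_idPr; exact: capvSl.
    by have := dual_dim ZW; rewrite -/D -/W0 /lo; clear; lia.
  have [W' [h1 h2 h3]] := subspace_between W0W (leq_trans dW0 lod) dW.
  exists W'; split=> //.
  have [->//|ne] := eqVneq W' W.
  have : supplements Rv W D W W'.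
    split=> //; first exact: subv_trans (addvSl _ _) h1.
      apply/eqP; rewrite eqEsubv subv_add h2 capvSl /=.
      apply: (@subv_trans _ _ (W0 + D)%VS); last by rewrite addvS.
      by rewrite /W0 -addvA addv_diff (addvC W) addvA addvSr.
    by apply: contra ne => WW'; rewrite eqEsubv h2.
  by rewrite -(opposite_below ZR XW) => -[].
have X_convex V W W' : X V -> X W -> (V <= W')%VS -> (W' <= W)%VS -> X W'.
  by move=> XV [iW _ _] VW' W'W; apply: (opposite_up XV) => //; exact: isoS iW.
have cX N : (N + lo <= g.+1)%N -> scon N X.
  by move=> h; apply: opposite_con => //; [exact: iso_Rv|rewrite -addnA].
have X_ne : exists W, X W.
  by apply: (@con_inhabited _ (comp le) 0); apply: cX; move: dRZ; rewrite /lo; clear; lia.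
have main := open_interval_has_dim X_dim X_up X_down X_convex X_ne.
split.
  have [h1 h2] := main (Bot _) (Top _) I I I.
  have eX : open_interval le X (Bot _) (Top _) = X.
    by apply/seteqP; split=> W /=; [case|move=> XW; split].
  rewrite eX in h1 h2; eexists; split; first exact: h1.
  by move=> c /h2 ->; rewrite subrK.
move=> x y Xx Xy xy; have [h1 _] := main x y Xx Xy xy.
eexists; split; first exact: h1.
(* An interval of dimension [N - 1] has to be [(N - 2)]-connected, which is what [con N]
   certifies. *)
rewrite -addrA -opprD -[(1 + 1)%R]/(2 : int).
apply: (con_k_connected (@vle_refl _ _) (@vle_trans _ _) (@vle_anti _ _)).
case: x y Xx Xy xy {h1} => [|a|] [|b|] //= Xa Xb ab; rewrite ?subnn; try exact: con_zero.
- have -> : open_interval le X (Bot _) (Mid b) = [set W | X W /\ plt le W b].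
    apply/seteqP; split=> W /=.
      move=> [XW [_ [h n]]]; split=> //; apply/andP; split=> //.
      by apply/eqP => e; apply: n; rewrite e.
    move=> [XW /andP[h n]]; split=> //; split=> //; split=> //.
    by move=> [e]; rewrite e eqxx in n.
  have [ib Rb Zb] := Xb.
  have [bR|bR] := boolP (b <= Rv)%VS.
    have -> : (\dim b - lo = 0)%N by have := dimvS bR; rewrite /lo; clear; lia.
    exact: con_zero.
  rewrite (opposite_below ZR Xb).
  have -> : (\dim b - lo)%N = (\dim (b :&: orth Z) - \dim Rv)%N.
    by rewrite -(dual_dim Zb) /lo; clear; lia.
  by apply: supplements_con; [rewrite subv_cap Rb sub_orthC|exact: capvSl|].
- have -> : open_interval le X (Bot _) (Top _) = X.
    by apply/seteqP; split=> W /=; [case|move=> XW; split].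
  by apply: cX; move: dRZ; rewrite /lo; clear; lia.
- have -> : open_interval le X (Mid a) (Mid b) = between a b.
    apply/seteqP; split=> W /=.
      move=> [XW [[h n] [h' n']]]; split; apply/andP; split=> //.
        by apply/eqP => e; apply: n; rewrite e.
      by apply/eqP => e; apply: n'; rewrite e.
    move=> [/andP[h n] /andP[h' n']]; split; first exact: X_convex Xa Xb h h'.
    by split; split=> // -[e]; [rewrite e eqxx in n|rewrite e eqxx in n'].
  by rewrite subnS; exact: between_con.
- have -> : open_interval le X (Mid a) (Top _) = iso_above a.
    apply/seteqP; split=> W /=.
      move=> [[iW _ _] [[h n] _]]; split=> //; apply/andP; split=> //.
      by apply/eqP => e; apply: n; rewrite e.
    move=> [iW /andP[h n]]; split; first exact: opposite_up Xa iW h.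
    by split=> //; split=> // -[e]; rewrite e eqxx in n.
  have ia : iso a by case: Xa.
  by apply: iso_above_con => //; have := g_max ia; clear; lia.
Qed.

End Forms.

(** * Form parameters stable under scaling *)

Section ScaledLambda.
Variables (F : fieldType) (E : vectType F).
Variables (sigma : {rmorphism F -> F}) (eps : F) (Lambda : pred F) (q : E -> E -> F).
Hypothesis params : form_parameters sigma eps Lambda.
Hypothesis sesq : sesquilinear sigma q.
Implicit Types (U W : {vspace E}) (v : E).

(* [Lambda] need not be stable under [c |-> sigma a * c * a]. Isotropy of a subspace
   only depends on the largest stable subgroup of [Lambda]. *)
Definition stable_part : pred F := fun c => `[< forall a, sigma a * c * a \in Lambda >].

Lemma stable_partP c : c \in stable_part <-> forall a, sigma a * c * a \in Lambda.
Proof. by rewrite unfold_in; split=> [/asboolP|h]; [|apply/asboolP]. Qed.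

Lemma stable_part_sub c : c \in stable_part -> c \in Lambda.
Proof. by move/stable_partP/(_ 1); rewrite rmorph1 mul1r mulr1. Qed.

Lemma stable_part_params : form_parameters sigma eps stable_part.
Proof.
have [h1 h2 h3 h4 h5] := params; split=> //.
- move=> a b /stable_partP ha /stable_partP hb; apply/stable_partP => c.
  by rewrite mulrBr mulrBl; exact: h3.
- move=> c; apply/stable_partP => a.
  have -> : sigma a * (c - eps * sigma c) * a = sigma a * c * a - eps * sigma (sigma a * c * a).
    by rewrite !rmorphM h1; ring.
  exact: h4.
- by move=> c /stable_part_sub; exact: h5.
Qed.

Lemma stable_part_scale a c : c \in stable_part -> sigma a * c * a \in stable_part.
Proof.
move=> /stable_partP h; apply/stable_partP => b.
have -> : sigma b * (sigma a * c * a) * b = sigma (a * b) * c * (a * b) by rewrite rmorphM; ring.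
exact: h.
Qed.

Lemma isotropic_stable_part W :
  isotropic sigma eps Lambda q W <-> isotropic sigma eps stable_part q W.
Proof.
split=> -[h1 h2]; split=> // v vW; last exact/stable_part_sub/h2.
apply/stable_partP => a; have [_ _ <-] := sesq; apply: h2.
by rewrite memvZ.
Qed.

End ScaledLambda.

Lemma max_isotropic (F : fieldType) (E : vectType F) (P : {vspace E} -> Prop) U : P U ->
  exists2 g, (forall W, P W -> (\dim W <= g)%N) & exists2 M, P M & \dim M = g.
Proof.
move=> PU; pose Q n := `[< exists2 M, P M & \dim M = n >].
have ex : exists n, Q n by exists (\dim U); apply/asboolP; exists U.
have bd n : Q n -> (n <= \dim {:E})%N by move=> /asboolP[M _ <-]; exact/dimvS/subvf.
case: (ex_maxnP ex bd) => g /asboolP gM gmax; exists g => // W PW.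
by apply: gmax; apply/asboolP; exists W.
Qed.

Theorem theorem4p7 (F : fieldType) (E : vectType F)
    (sigma : {rmorphism F -> F}) (eps : F) (Lambda : pred F)
    (q : E -> E -> F) :
  form_parameters sigma eps Lambda ->
  sesquilinear sigma q ->
  forall U : {vspace E}, Pomega sigma eps Lambda q U ->
    cohen_macaulay (@vsub_le F E) (PomegaU sigma eps Lambda q U).
Proof.
move=> params sesq U [isoU RadU [u0 u0U nRad_u0] _].
pose Lam := stable_part sigma Lambda.
have paramsL := stable_part_params params.
have scaleL := @stable_part_scale F sigma Lambda.
have isoE := @isotropic_stable_part F E sigma eps Lambda q sesq.
have iU : isotropic sigma eps Lam q U by apply/isoE.
have [g g_max g_att] := max_isotropic iU.
pose K := Kv paramsL sesq; pose o := orth paramsL sesq.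
have KP v : v \in K <-> Kset sigma eps q v.
  by split=> [h u|h]; [exact: Kv_om h|apply/orthP => u _; exact: h].
(* The radicals for [Lambda] and for [Lam] both equal [U :&: K], because [U] contains them and is
   isotropic; in particular they are a subspace. *)
pose Rv := (U :&: K)%VS.
have RvP v : v \in Rv <-> v \in K /\ Qzero Lam q v.
  rewrite memv_cap; split=> [/andP[vU vK]|[vK Qv]].
    by split=> //; case: iU => _; apply.
  rewrite vK andbT; apply: RadU; split; first exact/KP.
  exact: stable_part_sub Qv.
have RadE v : Rad sigma eps Lambda q v <-> v \in Rv.
  split=> [rv|/RvP[/KP vK Qv]]; last by split=> //; exact: stable_part_sub Qv.
  by rewrite memv_cap RadU //; case: rv => /KP.
pose Z := (U :\: Rv)%VS.
have ZU : (Z <= U)%VS by exact: diffvSl.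
have UZR : (Z + Rv)%VS = U.
  by rewrite -[RHS](addv_diff_cap U Rv); congr (_ + _)%VS; apply/esym/capv_idPr; exact: capvSl.
have iZ : isotropic sigma eps Lam q Z by exact: isoS ZU iU.
have ZK : (Z :&: K)%VS = 0%VS.
  apply/eqP; rewrite -subv0 -(capv_diff U Rv) subv_cap capvSl subv_cap capvSr andbT.
  exact: subv_trans (capvSl _ _) ZU.
(* As [U] exceeds the radical, [Z] is not in [K]. An opposite [W] then neither lies in [K] nor is
   the whole space, which gives the two strictness conditions of [Pomega]. *)
have Zn0 : ~ (Z <= K)%VS.
  move=> ZsubK; apply: nRad_u0; apply/RadE; move: u0U; rewrite -{1}UZR.
  by rewrite -(capv_idPl ZsubK) ZK add0v.
suff -> : PomegaU sigma eps Lambda q U = opposite paramsL sesq Rv Z.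
  exact: (opposite_cohen_macaulay scaleL g_max g_att RvP iZ ZK).
apply/seteqP; split=> W.
  move=> [[/isoE iW RW _ _] sum]; split=> //.
    by apply/subvP => v /RadE/RW.
  apply/eqP; rewrite -subv0 -ZK subv_cap capvSl /=; apply/subvP => x.
  rewrite memv_cap => /andP[xZ xW]; apply/KP => e; have [w [y [wW yU ->]]] := sum e.
  rewrite (omDl paramsL sesq) (orth_om xW wW) add0r; apply: yU.
  by move/subvP: ZU; apply.
move=> [iW RW ZW]; split.
  split=> //; first exact/isoE.
  - by move=> v /RadE; move/subvP: RW; apply.
  - apply: contrapT => nex; apply: Zn0.
    have WK : (W <= K)%VS.
      apply/subvP => v vW; apply: contrapT => /negP vK; apply: nex; exists v => // /RadE.
      by rewrite memv_cap (negPf vK) andbF.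
    have : (Z <= o W)%VS by apply: sub_orthC; apply: subv_trans WK (orthS _ _ (subvf Z)).
    by move=> /capv_idPl; rewrite ZW => <-; exact: sub0v.
  - move=> Wf; apply: Zn0; apply: subv_trans (subvf Z) _.
    by have := iso_orth paramsL sesq iW; rewrite Wf.
move=> e.
(* By [dual_dim], [W] modulo [W :&: o Z] has dimension [\dim Z], and [o Z] has codimension at most
   [\dim Z]. *)
have WoZ : (W + o Z)%VS = fullv.
  apply/eqP; rewrite eqEdim subvf /=.
  have := dual_dim ZW; have := codim_orth paramsL sesq fullv Z; have := dimv_sum_cap W (o Z).
  by rewrite capfv -/o; clear; lia.
have : e \in (W + o Z)%VS by rewrite WoZ memvf.
move=> /memv_addP[w wW [x xZ ->]]; exists w, x; split=> //.
move=> u; rewrite -UZR => /memv_addP[z zZ [r /RvP[rK _] ->]].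
by rewrite (omDr eps sesq) (orth_omC xZ zZ) (Kv_om _ rK) addr0.
Qed.
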